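(* Let $0<\alpha<n$, $b\in BMO(\mathbb{R}^n)$ and let $\Phi,\Psi$ be Young functions such that $\Phi\in\Delta_2\cap\nabla_2$ and $\Psi\in\Delta_2\cap\nabla_2$. If there is a constant $C>0$ such that $$r^{-\frac{\alpha}{n}}\,\Phi^{-1}(r)\le C\,\Psi^{-1}(r)\qquad\text{for all } r>0,$$ then the commutator $[b,I_\alpha]$ is bounded from $L^{\Phi}(\mathbb{R}^n)$ to $L^{\Psi}(\mathbb{R}^n)$.
   Context: A function $\Phi:[0,\infty)\to[0,\infty]$ is a Young function if it is convex, left-continuous, $\lim_{r\to+0}\Phi(r)=\Phi(0)=0$ and $\lim_{r\to\infty}\Phi(r)=\infty$. For $0\le s\le\infty$, $\Phi^{-1}(s)=\inf\{r\ge 0:\Phi(r)>s\}$. $\Phi\in\Delta_2$ means that there is $C>1$ with $\Phi(2r)\le C\Phi(r)$ for all $r>0$. $\Phi\in\nabla_2$ means that there is $C>1$ with $\Phi(r)\le\frac{1}{2C}\Phi(Cr)$ for all $r\ge 0$. The Orlicz space $L^{\Phi}(\mathbb{R}^n)$ is the set of measurable $f$ with $\int_{\mathbb{R}^n}\Phi(k|f(x)|)\,dx<\infty$ for some $k>0$, with norm $\|f\|_{L^\Phi}=\inf\{\lambda>0:\int_{\mathbb{R}^n}\Phi(|f(x)|/\lambda)\,dx\le 1\}$. $BMO(\mathbb{R}^n)$ is the set of $b\in L^1_{\rm loc}(\mathbb{R}^n)$ with $\|b\|_*=\sup_{x\in\mathbb{R}^n,r>0}\frac{1}{|B(x,r)|}\int_{B(x,r)}|b(y)-b_{B(x,r)}|\,dy<\infty$,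 where $B(x,r)$ is the ball of radius $r$ centered at $x$ and $b_{B(x,r)}$ is the average of $b$ over $B(x,r)$. The Riesz potential is $I_\alpha f(x)=\int_{\mathbb{R}^n}\frac{f(y)}{|x-y|^{n-\alpha}}\,dy$, and the commutator is formally defined by $[b,I_\alpha]f=b\,I_\alpha f-I_\alpha(bf)$, i.e. $[b,I_\alpha]f(x)=\int_{\mathbb{R}^n}\frac{b(x)-b(y)}{|x-y|^{n-\alpha}}f(y)\,dy$. Boundedness of an operator $T$ from $X$ to $Y$ means that there is a constant $C>0$ with $\|Tf\|_Y\le C\|f\|_X$ for all $f\in X$. *)

(* Defs.v *)
From HB Require Import structures.
From mathcomp Require Import all_boot all_order all_algebra.
From mathcomp Require Import all_classical all_reals all_analysis.

Set Implicit Arguments.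
Unset Strict Implicit.
Unset Printing Implicit Defensive.

Import Order.TTheory GRing.Theory Num.Theory.
Import numFieldTopology.Exports numFieldNormedType.Exports.

Local Open Scope classical_set_scope.
Local Open Scope ring_scope.

(* R^n as n-tuples, which carry the product (that is, Borel) sigma-algebra. *)
Notation "'Rn[' R ]_ n" := (n.-tuple (measurableTypeR R))
  (at level 8, R at level 200, n at level 2, format "'Rn[' R ]_ n").

Definition cons_pair {R : realType} {n : nat}
    (p : measurableTypeR R * Rn[R]_n) : Rn[R]_n.+1 :=
  [tuple of p.1 :: p.2].

Definition cons_measure {R : realType} {n : nat} (mu : set Rn[R]_n -> \bar R) :
    set Rn[R]_n.+1 -> \bar R :=
  pushforward (product_measure1 (@lebesgue_measure R) mu) cons_pair.

Fixpoint lebesgue_measure_n {R : realType} (n : nat) : set Rn[R]_n -> \bar R :=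
  match n with
  | 0 => dirac [tuple]
  | m.+1 => cons_measure (@lebesgue_measure_n R m)
  end.
Arguments lebesgue_measure_n {R} n _.

Lemma measurable_cons_pair (R : realType) (n : nat) :
  measurable_fun setT (@cons_pair R n).
Proof.
apply: (@measurable_cons _ _ _ _ fst n snd).
  exact: measurable_fst.
exact: measurable_snd.
Qed.

Lemma cons_pair_preimage_box (R : realType) (n : nat)
    (A : 'I_n.+1 -> set (measurableTypeR R)) :
  cons_pair @^-1` [set t | forall i, A i (tnth t i)] =
  A ord0 `*` [set t | forall i, A (lift ord0 i) (tnth t i)].
Proof.
apply/seteqP; split => -[a t] /= H.
  split => /=; first exact: (H ord0).
  by move=> i; have := H (lift ord0 i); rewrite tnthS.
move=> i; case: (unliftP ord0 i) => [j ->|->].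
  by rewrite tnthS; exact: H.2.
exact: H.1.
Qed.

(* The library proves this, but canonical inference on `\x` does not find it. *)
Lemma sigma_finite_product d1 d2 (T1 : measurableType d1)
    (T2 : measurableType d2) (R : realType)
    (m1 : {sigma_finite_measure set T1 -> \bar R})
    (m2 : {sigma_finite_measure set T2 -> \bar R}) :
  sigma_finite setT (product_measure1 m1 m2).
Proof.
have /sigma_finiteP[F [TF ndF Foo]] := sigma_finiteT m1.
have /sigma_finiteP[G [TG ndG Goo]] := sigma_finiteT m2.
exists (fun n => F n `*` G n) => [|k].
  rewrite -setXTT TF TG predeqE => -[x y]; split => [[]|[n _ []]].
    move=> /= [n _ Fnx] [k _ Gky]; exists (maxn n k) => //; split.
    - by move: x Fnx; exact/subsetPset/ndF/leq_maxl.
    - by move: y Gky; exact/subsetPset/ndG/leq_maxr.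
  by move=> /= ? ?; split; exists n.
have [? ?] := Foo k; have [? ?] := Goo k.
split; first exact: measurableX.
by rewrite product_measure1E// lte_mul_pinfty// ge0_fin_numE.
Qed.

Lemma sigma_finite_pushforward_cons (R : realType) (n : nat)
    (mu : set (measurableTypeR R * Rn[R]_n)%type -> \bar R) :
  sigma_finite setT mu -> sigma_finite setT (pushforward mu (@cons_pair R n)).
Proof.
move=> [F FT Fmu].
pose g (t : Rn[R]_n.+1) : (measurableTypeR R * Rn[R]_n)%type :=
  (thead t, [tuple of behead t]).
have gK : cancel cons_pair g.
  by move=> [a t]; congr pair; exact/val_inj.
have Kg : cancel g cons_pair by move=> t; rewrite [RHS]tuple_eta.
have mg : measurable_fun setT g.
  apply/measurable_fun_pairP; split => /=.
    exact: (@measurable_tnth _ (measurableTypeR R) _ ord0).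
  exact: measurable_behead.
exists (fun i => g @^-1` F i) => [|i].
  by rewrite -preimage_bigcup -FT preimage_setT.
have [mF muF] := Fmu i; split; first by rewrite -[X in measurable X]setTI; exact: mg.
rewrite /pushforward (_ : _ @^-1` _ = F i)//.
by apply/seteqP; split => p /=; rewrite gK.
Qed.

Section cons_measure_instances.
Context (R : realType) (n : nat)
  (mu : {sigma_finite_measure set Rn[R]_n -> \bar R}).

Local Notation nu := (cons_measure mu).

Let nu0 : nu set0 = 0%E.
Proof. by rewrite /cons_measure /pushforward preimage_set0 measure0. Qed.

Let nu_ge0 A : (0 <= nu A)%E.
Proof. by rewrite /cons_measure /pushforward measure_ge0. Qed.

Let nu_sigma_additive : semi_sigma_additive nu.
Proof.
have mf := @measurable_cons_pair R n.
exact: (@measure_semi_sigma_additive _ _ _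
  (measure_function_pushforward__canonical__measure_function_Measure
    (product_measure1 (@lebesgue_measure R) mu) mf)).
Qed.

Let nu_sigma_finite : sigma_finite setT nu.
Proof. exact/sigma_finite_pushforward_cons/sigma_finite_product. Qed.

HB.instance Definition _ := isMeasure.Build _ _ _ nu
  nu0 nu_ge0 nu_sigma_additive.
HB.instance Definition _ := Measure_isSigmaFinite.Build _ _ _ nu
  nu_sigma_finite.

End cons_measure_instances.

Lemma lebesgue_measure_n_bundle (R : realType) (n : nat) :
  exists mu : {sigma_finite_measure set Rn[R]_n -> \bar R},
    lebesgue_measure_n n = mu :> (set Rn[R]_n -> \bar R).
Proof.
elim: n => [|n [mu IH]].
  by exists (@dirac _ Rn[R]_0 [tuple] R).
by exists (cons_measure mu); rewrite /= IH.
Qed.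

Section lebesgue_measure_n_instances.
Context (R : realType) (n : nat).

Let mu0 : @lebesgue_measure_n R n set0 = 0%E.
Proof. by have [mu ->] := lebesgue_measure_n_bundle R n. Qed.

Let mu_ge0 A : (0 <= @lebesgue_measure_n R n A)%E.
Proof. by have [mu ->] := lebesgue_measure_n_bundle R n. Qed.

Let mu_sigma_additive : semi_sigma_additive (@lebesgue_measure_n R n).
Proof.
by have [mu ->] := lebesgue_measure_n_bundle R n; exact: measure_semi_sigma_additive.
Qed.

Let mu_sigma_finite : sigma_finite setT (@lebesgue_measure_n R n).
Proof. by have [mu ->] := lebesgue_measure_n_bundle R n; exact: sigma_finiteT. Qed.

HB.instance Definition _ := isMeasure.Build _ _ _ (@lebesgue_measure_n R n)
  mu0 mu_ge0 mu_sigma_additive.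
HB.instance Definition _ := Measure_isSigmaFinite.Build _ _ _
  (@lebesgue_measure_n R n) mu_sigma_finite.

End lebesgue_measure_n_instances.

Lemma lebesgue_measure_n_box (R : realType) (n : nat)
    (A : 'I_n -> set (measurableTypeR R)) :
  (forall i, measurable (A i)) ->
  lebesgue_measure_n n [set t | forall i, A i (tnth t i)] =
  (\prod_(i < n) lebesgue_measure (A i))%E.
Proof.
elim: n A => [A _|n IH A mA].
  rewrite big_ord0 /= diracE mem_set//=; by case.
rewrite big_ord_recl -IH//= /cons_measure /pushforward cons_pair_preimage_box.
rewrite (product_measure1E _ (lebesgue_measure_n n))//.
rewrite [X in measurable X](_ : _ = \bigcap_(i in [set: 'I_n])
   (fun t : Rn[R]_n => tnth t i) @^-1` A (lift ord0 i)).
  apply: fin_bigcap_measurable => // i _; rewrite -[X in measurable X]setTI.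
  exact: (@measurable_tnth _ (measurableTypeR R)).
by apply/seteqP; split => t /= H i => [_|]; exact: H.
Qed.

Section euclidean_space.
Context {R : realType} {n : nat}.
Implicit Types (x y : Rn[R]_n) (f g b : Rn[R]_n -> R) (D : set Rn[R]_n).

Local Notation mu := (lebesgue_measure_n n).

Definition eucl_dist x y : R :=
  Num.sqrt (\sum_(i < n) (tnth x i - tnth y i) ^+ 2).

Definition eball x (r : R) : set Rn[R]_n := [set y | eucl_dist x y < r].

(* The sigma-algebra on Rn is the Borel one; measurability with respect to its
   Lebesgue completion amounts to agreeing almost everywhere with a Borel
   function. The library integral is insensitive to such modifications. *)
Definition lebesgue_measurable f : Prop :=
  exists2 g, measurable_fun setT g & ae_eq mu setT f g.

Definition lebesgue_integrable D f : Prop :=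
  lebesgue_measurable f /\ (\int[mu]_(x in D) `|f x|%:E < +oo)%E.

Definition locally_integrable_n f : Prop :=
  forall x (r : R), 0 < r -> lebesgue_integrable (eball x r) f.

Definition average b D : R := (fine (mu D))^-1 * \int[mu]_(y in D) b y.

Definition bmo_norm b : \bar R :=
  ereal_sup [set m | exists x (r : R), 0 < r /\
    m = ((fine (mu (eball x r)))^-1%:E *
         \int[mu]_(y in eball x r) `|b y - average b (eball x r)|%:E)%E].

Definition bmo b : Prop := locally_integrable_n b /\ (bmo_norm b < +oo)%E.

(* Only the values of Phi on [0, +oo[ are relevant, here and below. *)
Definition orlicz_space (Phi : R -> \bar R) : set (Rn[R]_n -> R) :=
  [set f | lebesgue_measurable f /\
    exists2 k : R, 0 < k & (\int[mu]_x Phi (k * `|f x|)%R < +oo)%E].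

Definition orlicz_norm (Phi : R -> \bar R) f : \bar R :=
  ereal_inf [set l%:E | l in
    [set l : R | 0 < l /\ (\int[mu]_x Phi (`|f x| / l)%R <= 1)%E]].

(* Set to 0 at y = x, where the quotient is undefined. *)
Definition commutator_integrand (alpha : R) b f x y : R :=
  (b x - b y) / eucl_dist x y `^ (n%:R - alpha) * f y.

(* The value is irrelevant at points x where the integral does not converge. *)
Definition commutator (alpha : R) b f : Rn[R]_n -> R :=
  fun x => \int[mu]_y commutator_integrand alpha b f x y.

Definition commutator_defined (alpha : R) b f : Prop :=
  {ae mu, forall x, lebesgue_integrable setT (commutator_integrand alpha b f x)}.

Definition bounded_operator (X Y : set (Rn[R]_n -> R))
    (normX normY : (Rn[R]_n -> R) -> \bar R)
    (T : (Rn[R]_n -> R) -> Rn[R]_n -> R) : Prop :=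
  exists2 C : R, 0 < C &
    forall f, X f -> Y (T f) /\ (normY (T f) <= C%:E * normX f)%E.

End euclidean_space.

Section young_functions.
Context {R : realType}.
Implicit Types Phi : R -> \bar R.
Local Open Scope ereal_scope.

Record young_function Phi : Prop := {
  young_ge0 : forall r : R, (0 <= r)%R -> 0 <= Phi r ;
  young_convex : forall r s t : R, (0 <= r)%R -> (0 <= s)%R ->
    (0 <= t <= 1)%R ->
    Phi (t * r + (1 - t) * s)%R <= t%:E * Phi r + (1 - t)%:E * Phi s ;
  young_left_continuous : forall r : R, (0 < r)%R ->
    Phi s @[s --> r^'-] --> Phi r ;
  young0 : Phi 0%R = 0 ;
  young_cvg0 : Phi r @[r --> 0%R^'+] --> 0 ;
  young_cvgy : Phi r @[r --> +oo%R] --> +oo }.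

Definition young_inv Phi (s : \bar R) : \bar R :=
  ereal_inf [set r%:E | r in [set r : R | (0 <= r)%R /\ s < Phi r]].

Definition Delta2 Phi : Prop :=
  exists2 C : R, (1 < C)%R &
    forall r : R, (0 < r)%R -> Phi (2 * r)%R <= C%:E * Phi r.

Definition nabla2 Phi : Prop :=
  exists2 C : R, (1 < C)%R &
    forall r : R, (0 <= r)%R -> Phi r <= ((2 * C)^-1)%:E * Phi (C * r)%R.

End young_functions.

(* Main.v *)
Require Import Defs.
From HB Require Import structures.
From mathcomp Require Import all_boot all_order all_algebra.
From mathcomp Require Import all_classical all_reals all_analysis.
From mathcomp Require Import measurable_realfun.
From mathcomp Require Import ring lra.

Set Implicit Arguments.
Unset Strict Implicit.
Unset Printing Implicit Defensive.

Import Order.TTheory GRing.Theory Num.Theory.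
Import numFieldTopology.Exports numFieldNormedType.Exports.

Local Open Scope classical_set_scope.
Local Open Scope ring_scope.

(** Write kappa = alpha / n, which lies strictly between 0 and 1, and
    K (x, y) = |b x - b y| |x - y|^(alpha - n). Since |[b, I_alpha] f| is at
    most the potential P |f| x = \int K (x, y) |f y| dy, everything reduces to
    a modular inequality: if f >= 0 and \int Phi (f) <= 1, then
    \int Psi (c P f) <= C, where c and C do not depend on f. It also yields
    the finiteness of P f almost everywhere, that is, the convergence of the
    integrals that define the commutator. The proof has two main steps.

    Restricted bounds (restricted_estimate): for kappa < a < 1 and sets F and G
    of finite measure, the integral of K over G x F is at most
    C |F|^(1 - a + kappa) |G|^a. By the John-Nirenberg inequality, the
    oscillation of b on a subset A of a cube Q satisfies
    \int_A |b - b_Q| <= C |Q| (|A| / |Q|)^t for every t < 1 (oscillation_le).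
    Applied to two sets in one cube, and averaged over all the cubes of a given
    side, this controls the pairs of points at distance less than r
    (scale_bound). The sum over the dyadic scales r is of geometric type:
    small scales are tamed by r^alpha, large ones by the small density of F in
    large cubes. The John-Nirenberg inequality itself comes from a
    recursion along the dyadic tree: the mean of
    exp (c |b_Q' - v|) over the descendants Q' of generation k of a cube is
    bounded independently of k (leaf_exp_le), and Young's inequality
    u <= (d exp (c u) - ln d) / c then bounds the integral of b - b_Q over
    unions of dyadic cells, which approximate all Borel sets.

    Summation over levels (truncated_modular_bound): let F_j be the set where
    f >= l_j, let G_i be the set where P f > s_i, with levels l_j and s_i in
    geometric progressions of ratio 2, and put A_j = Phi (l_j) and
    B_i = Psi (c s_i). Integrating P f over G_i bounds s_i |G_i| by the sum over
    j of 2 l_j times the integral of K over G_i x F_j. The exponent a of the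
    restricted bound may depend on (i, j): two values of a suffice, according
    to whether A_j >= B_i or not, in order that the inequality between the
    inverse functions, the nabla_2 condition on Phi (A_j grows at least like a
    power p > 1 of l_j) and the Delta_2 condition on Psi (B_i grows at most like
    a power of s_i) produce a gain min (A_j / B_i, B_i / A_j)^d
    (exponent_gain). A pigeonhole argument then gives
    B_i |G_i| <= \sum_j D_ij A_j |F_j|, where the sums of D_ij over i and over
    j are bounded (summed_restricted_bounds). Summing over i concludes, because
    \sum_j A_j |F_j| is at most 2 \int Phi (f), while \sum_i B_i |G_i|
    controls \int Psi (c P f) up to a factor given by the Delta_2 condition.

    Up to that point, f takes values in finitely many dyadic layers and G_i is
    cut by a set of finite measure, so that all the quantities are real numbers;
    monotone convergence removes these truncations. There remains to pass from
    the modulars to the norms, by convexity, and from b and f to Borel functions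
    that agree with them almost everywhere. *)

(** * Exponential moments along a tree *)

Section tree_exponential_moments.
Context {R : realType} {N : Type} {C : finType} (child : N -> C -> N).
Context (avg : N -> R) (dev : N -> R -> R).

(** Mean of exp (c |avg - v|) over the k-th generation of descendants of Q;
    for the tree of dyadic subcubes, avg is the average of b on a cube and dev
    its mean oscillation about a constant. *)
Fixpoint leaf_exp (c : R) (k : nat) (Q : N) (v : R) : R :=
  if k is k'.+1 then #|C|%:R^-1 * \sum_i leaf_exp c k' (child Q i) v
  else expR (c * `|avg Q - v|).

Hypothesis C_gt0 : (0 < #|C|)%N.
Hypothesis avg_dev : forall Q v, `|avg Q - v| <= dev Q v.
Hypothesis dev_child : forall Q v,
  dev Q v = #|C|%:R^-1 * \sum_i dev (child Q i) v.
Hypothesis dev_avg : forall Q, dev Q (avg Q) <= 1.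

Let C_R_gt0 : 0 < #|C|%:R :> R. Proof. by rewrite ltr0n. Qed.

Let mean_le (F G : C -> R) : (forall i, F i <= G i) ->
  #|C|%:R^-1 * \sum_i F i <= #|C|%:R^-1 * \sum_i G i.
Proof. by move=> FG; rewrite ler_wpM2l ?invr_ge0 ?ler0n// ler_sum. Qed.

Lemma leaf_exp_recenter c k Q v w : 0 <= c ->
  leaf_exp c k Q v <= expR (c * `|v - w|) * leaf_exp c k Q w.
Proof.
move=> c0; elim: k Q => [|k IH] Q /=.
  rewrite -expRD ler_expR -mulrDr ler_wpM2l//.
  by rewrite [leRHS]addrC (distrC v w); exact: ler_distD.
apply: le_trans (mean_le (fun i => IH (child Q i))) _.
by rewrite -mulr_sumr mulrCA.
Qed.

(** The oscillation of a node is the mean of those of its #|C| children, hence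
    at least #|C|^-1 times that of any of them. *)
Lemma avg_child Q i : `|avg (child Q i) - avg Q| <= #|C|%:R.
Proof.
have dev_ge0 Q' v : 0 <= dev Q' v by exact: le_trans (avg_dev _ _).
apply: le_trans (avg_dev _ _) _.
have := dev_avg Q; rewrite dev_child ler_pdivrMl// mulr1.
by apply: le_trans; rewrite (bigD1 i)//= lerDl sumr_ge0.
Qed.

(** By induction on the generation. A child whose average stays within 2 of v
    satisfies the induction hypothesis for v, and this hypothesis passes to
    the mean because dev is itself a mean over the children. For any other
    child, recentre at the average of the child: the moment about that average
    is at most 3/2 + 9/2 = 6 by induction, the recentring costs a factor at
    most 3/2, and 3/2 * 6 = 9/2 * 2 is below 9/2 * dev because
    2 < |avg - v| <= dev. *)
Lemma leaf_exp_le c k Q v : 0 <= c -> expR (c * (#|C|%:R + 2)) <= 3 / 2 ->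
  `|avg Q - v| <= 2 -> leaf_exp c k Q v <= 3 / 2 + 9 / 2 * dev Q v.
Proof.
move=> c0 cC; elim: k Q v => [|k IH] Q v Qv /=.
  apply: (@le_trans _ _ (3 / 2)).
    apply: le_trans cC; rewrite ler_expR ler_wpM2l//.
    by apply: le_trans Qv _; rewrite lerDr.
  by rewrite lerDl mulr_ge0// (le_trans _ (avg_dev _ _)).
rewrite [dev Q v]dev_child.
have -> : 3 / 2 + 9 / 2 * (#|C|%:R^-1 * \sum_i dev (child Q i) v) =
    #|C|%:R^-1 * \sum_i (3 / 2 + 9 / 2 * dev (child Q i) v).
  rewrite big_split/= sumr_const mulrDr -mulr_sumr mulrCA; congr (_ + _).
  by rewrite -(mulr_natl (3 / 2) #|C|) mulKf// lt0r_neq0.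
apply: mean_le => i.
have [near|far] := leP (`|avg (child Q i) - v|) 2; first exact: IH.
have jump : `|v - avg (child Q i)| <= #|C|%:R + 2.
  rewrite distrC; apply: le_trans (ler_distD (avg Q) _ _) _.
  by rewrite lerD// avg_child.
apply: le_trans (leaf_exp_recenter k (child Q i) v (avg (child Q i)) c0) _.
have /IH : `|avg (child Q i) - avg (child Q i)| <= 2 by rewrite subrr normr0.
have := dev_avg (child Q i); set d := dev _ (avg _); move=> d1 S6.
have : expR (c * `|v - avg (child Q i)|) <= 3 / 2.
  by apply: le_trans cC; rewrite ler_expR ler_wpM2l.
have := avg_dev (child Q i) v.
have := expR_ge0 (c * `|v - avg (child Q i)|).
move: (expR _) (leaf_exp _ _ _ _) S6 (dev _ v) far => e s S6 dv far e0 dv0 e1.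
have : e * s <= 3 / 2 * 6 by apply: (le_trans (y := e * 6));
  [rewrite ler_wpM2l//; lra | rewrite ler_wpM2r//].
lra.
Qed.

Lemma leaf_exp_avg c k Q : 0 <= c -> expR (c * (#|C|%:R + 2)) <= 3 / 2 ->
  leaf_exp c k Q (avg Q) <= 6.
Proof.
move=> c0 cC; have /(leaf_exp_le k c0 cC) : `|avg Q - avg Q| <= 2.
  by rewrite subrr normr0.
by have := dev_avg Q; lra.
Qed.

End tree_exponential_moments.

(** * Dyadic windows and power growth *)

Section dyadic_windows.
Context {R : realType}.

Lemma lt_exp2_bound (x : R) : 0 <= x -> x < 2 ^+ Num.bound x.
Proof.
move=> x0; apply: (lt_le_trans (Num.Theory.archi_boundP x0)).
by rewrite -natrX ler_nat ltnW// ltn_expl.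
Qed.

Lemma dyadic_windowE N : 2 ^- N * 2 ^+ (N + N) = 2 ^+ N :> R.
Proof. by rewrite exprD mulKf// expf_neq0. Qed.

Lemma dyadic_window_nondecreasing (t : R) N N' : (N <= N')%N ->
  2 ^- N <= t < 2 ^- N * 2 ^+ (N + N) -> 2 ^- N' <= t < 2 ^- N' * 2 ^+ (N' + N').
Proof.
move=> NN /andP[lo hi]; apply/andP; split.
  by apply: le_trans lo; rewrite lef_pV2 ?posrE ?exprn_gt0// ler_eXn2l// ltr1n.
by apply: lt_le_trans hi _; rewrite !dyadic_windowE ler_eXn2l// ltr1n.
Qed.

Lemma dyadic_window_exists (t : R) : 0 < t ->
  exists N, 2 ^- N <= t < 2 ^- N * 2 ^+ (N + N).
Proof.
move=> t0; pose N := maxn (Num.bound t) (Num.bound t^-1).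
have bd (x : R) : 0 < x -> (Num.bound x <= N)%N -> x < 2 ^+ N.
  move=> x0 xN; apply: (lt_le_trans (lt_exp2_bound (ltW x0))).
  by rewrite ler_eXn2l// ltr1n.
exists N; rewrite dyadic_windowE; apply/andP; split.
  rewrite -[leRHS]invrK lef_pV2 ?posrE ?exprn_gt0 ?invr_gt0//.
  by apply/ltW/bd; [rewrite invr_gt0|exact: leq_maxr].
by apply: bd => //; exact: leq_maxl.
Qed.

End dyadic_windows.

Section growth_types.
Context {R : realType}.
Implicit Types (phi psi : R -> R).

Lemma exprn_powRC (x p : R) k : 0 <= x -> (x `^ p) ^+ k = (x ^+ k) `^ p.
Proof.
move=> x0.
rewrite -(powR_mulrn k (powR_ge0 x p)) -(powR_mulrn k x0).
by rewrite -!powRrM (mulrC p).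
Qed.

Lemma exprn_bracket (c t : R) : 1 < c -> 1 <= t ->
  exists k : nat, c ^+ k <= t < c ^+ k.+1.
Proof.
move=> c1 t1; have c0 : 0 < c by lra.
have lnc : 0 < ln c by rewrite ln_gt0.
have t0 : 0 < t by lra.
have x0 : 0 <= ln t / ln c by rewrite divr_ge0 ?ln_ge0// ltW.
have [k /andP[lo hi]] : exists k : nat, k%:R <= ln t / ln c < k.+1%:R.
  by exists (Num.truncn (ln t / ln c)); exact: truncn_itv.
exists k.
have cE j : c ^+ j = expR (j%:R * ln c).
  by rewrite expRM_natl lnK ?posrE.
by rewrite !cE -[t]lnK ?posrE// ler_expR ltr_expR -ler_pdivlMr// -ltr_pdivrMr// lo.
Qed.

(** Multiplying the argument by c multiplies phi by at least 2 c, so phi grows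
    at least like a power of exponent log_c (2 c) = 1 + log_c 2, which is
    larger than 1. *)
Lemma nabla2_lower_type phi c : 1 < c ->
  (forall r, 0 <= r -> 0 <= phi r) ->
  (forall r s, 0 <= r -> r <= s -> phi r <= phi s) ->
  (forall r, 0 <= r -> phi r <= (2 * c)^-1 * phi (c * r)) ->
  exists2 p : R, 1 < p & exists2 a : R, 0 < a &
    forall r s, 0 < r -> r <= s -> a * (s / r) `^ p * phi r <= phi s.
Proof.
move=> c1 phi0 phi_nd nab; have c0 : 0 < c by lra.
have lnc : 0 < ln c by rewrite ln_gt0.
have ln2 : 0 < ln (2 : R) by rewrite ln_gt0// ltr1n.
exists (1 + ln 2 / ln c); first by rewrite ltrDl divr_gt0.
exists (2 * c)^-1; first by rewrite invr_gt0; lra.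
move=> r s r0 rs; have r1 : 1 <= s / r by rewrite ler_pdivlMr// mul1r.
have [k /andP[lo hi]] := exprn_bracket c1 r1.
set p := 1 + _.
have cp : c `^ p = 2 * c.
  rewrite /p powRD; last by rewrite (gt_eqF c0) implybT.
  rewrite powRr1; last exact: ltW.
  rewrite mulrC; congr (_ * _).
  by rewrite /powR gt_eqF// divfK ?gt_eqF// lnK ?posrE//.
have iter j : (2 * c) ^+ j * phi r <= phi (c ^+ j * r).
  elim: j => [|j IH]; first by rewrite !expr0 !mul1r.
  have cj : 0 <= c ^+ j * r by rewrite mulr_ge0 ?exprn_ge0 ?ltW.
  have := nab _ cj; rewrite mulrA -exprS ler_pdivlMl; last lra.
  by apply: le_trans; rewrite exprS -mulrA ler_pM2l//; lra.
have : (s / r) `^ p <= (2 * c) ^+ k.+1.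
  have -> : (2 * c) ^+ k.+1 = (c ^+ k.+1) `^ p.
    by rewrite -cp exprn_powRC// ltW.
  apply: ge0_ler_powR.
  - by rewrite addr_ge0// divr_ge0// ltW.
  - by rewrite nnegrE (le_trans ler01).
  - by rewrite nnegrE exprn_ge0// ltW.
  - exact: ltW.
rewrite exprS => sp.
have phir := phi0 _ (ltW r0).
apply: (@le_trans _ _ ((2 * c) ^+ k * phi r)).
  by rewrite ler_wpM2r// ler_pdivrMl//; lra.
apply: le_trans (iter k) _; apply: phi_nd.
  by rewrite mulr_ge0 ?exprn_ge0 ?ltW.
by rewrite -ler_pdivlMr.
Qed.

(** Doubling the argument multiplies phi by at most C, so phi grows at most
    like a power of exponent log_2 C. *)
Lemma Delta2_upper_type phi C : 1 < C ->
  (forall r, 0 <= r -> 0 <= phi r) ->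
  (forall r s, 0 <= r -> r <= s -> phi r <= phi s) ->
  (forall r, 0 < r -> phi (2 * r) <= C * phi r) ->
  exists2 q : R, 0 < q &
    forall r s, 0 < r -> r <= s -> phi s <= C * (s / r) `^ q * phi r.
Proof.
move=> C1 phi0 phi_nd D2; have C0 : 0 < C by lra.
have lnC : 0 < ln C by rewrite ln_gt0.
have ln2 : 0 < ln (2 : R) by rewrite ln_gt0// ltr1n.
exists (ln C / ln 2); first by rewrite divr_gt0.
move=> r s r0 rs; have r1 : 1 <= s / r by rewrite ler_pdivlMr// mul1r.
have two1 : 1 < 2 :> R by rewrite ltr1n.
have [k /andP[lo hi]] := exprn_bracket two1 r1.
set q := ln C / ln 2; have q0 : 0 <= q by rewrite divr_ge0 ?ltW.
have cp : 2 `^ q = C by rewrite /powR gt_eqF// divfK ?gt_eqF// lnK ?posrE//.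
have iter j : phi (2 ^+ j * r) <= C ^+ j * phi r.
  elim: j => [|j IH]; first by rewrite !expr0 !mul1r.
  rewrite exprS -mulrA; apply: le_trans (D2 _ _) _.
    by rewrite mulr_gt0// exprn_gt0.
  by rewrite exprS -mulrA ler_pM2l.
have : C ^+ k <= (s / r) `^ q.
  have -> : C ^+ k = (2 ^+ k) `^ q.
    by rewrite -cp exprn_powRC.
  apply: ge0_ler_powR => //.
  - by rewrite nnegrE exprn_ge0.
  - by rewrite nnegrE; exact: le_trans ler01 r1.
move=> Ck; have phir := phi0 _ (ltW r0).
apply: (@le_trans _ _ (phi (2 ^+ k.+1 * r))).
  apply: phi_nd; first exact: le_trans (ltW r0) rs.
  by rewrite -ler_pdivrMr//; exact: ltW.
apply: le_trans (iter _) _.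
by rewrite exprS ler_wpM2r// ler_pM2l.
Qed.

End growth_types.

(** * The gain from comparing the growth of two functions *)

Section exponent_gain.
Context {R : realType}.
Implicit Types (phi psi : R -> R).

(** The last hypothesis is phi^-1 (B) <= CH B^k psi^-1 (B), expressed by means
    of phi and psi themselves. Put A = phi l and B = psi s. If B <= A, it
    bounds phi^-1 (B) in terms of s, and the lower type p of phi then bounds l
    by a multiple of B^k s (A / B)^(1 / p); the left-hand side is at most K s
    (B / A)^(k + b - 1 / p), which is a gain as soon as k + b > 1 / p; this is
    possible with b < 1 - k because p > 1. If A < B, the upper type q of psi
    bounds psi^-1 (A) in terms of s, so that l is at most a multiple of A^k s
    (A / B)^(1 / q), and the left-hand side is at most K s
    (A / B)^(1 / q - b), which is a gain if b < 1 / q. *)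
Lemma exponent_gain phi psi (k a p C q CH : R) :
  0 < k < 1 ->
  (forall r, 0 < r -> 0 < phi r) -> (forall r, 0 < r -> 0 < psi r) ->
  (forall r s, 0 <= r -> r < s -> phi r < phi s) ->
  (forall r s, 0 <= r -> r < s -> psi r < psi s) ->
  1 < p -> 0 < a ->
  (forall r s, 0 < r -> r <= s -> a * (s / r) `^ p * phi r <= phi s) ->
  0 < q -> 0 < C ->
  (forall r s, 0 < r -> r <= s -> psi s <= C * (s / r) `^ q * psi r) ->
  0 < CH ->
  (forall B t, 0 < B -> 0 < t -> B < psi t -> B < phi (CH * B `^ k * t)) ->
  exists b0 b1 d K : R,
    [/\ 0 < b0 < 1 - k, 0 < b1 < 1 - k, 0 < d, 0 < K &
      forall l s, 0 < l -> 0 < s -> exists2 b, b = b0 \/ b = b1 &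
        l * phi l `^ (- (k + b)) * psi s `^ b <=
        K * s * Num.min (phi l / psi s) (psi s / phi l) `^ d].
Proof.
move=> /andP[k0 k1] phi0 psi0 phi_inc psi_inc p1 a0 low q0 C0 upp CH0 H.
have p0 : 0 < p by lra.
have ip1 : p^-1 < 1 by rewrite invf_lt1.
have ip0 : 0 < p^-1 by rewrite invr_gt0.
have iq0 : 0 < q^-1 by rewrite invr_gt0.
(* These choices make 1 / q - b0 and k + b1 - 1 / p both at least d. *)
pose b0 := Num.min q^-1 (1 - k) / 2.
pose e := Num.min ((1 - p^-1) / 2) ((1 - k) / 2).
pose b1 := 1 - k - e.
pose d := Num.min (q^-1 / 2) ((1 - p^-1) / 2).
have m0 : 0 < Num.min q^-1 (1 - k) by rewrite lt_min iq0/=; lra.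
have [mq mk] : Num.min q^-1 (1 - k) <= q^-1 /\ Num.min q^-1 (1 - k) <= 1 - k.
  by rewrite !ge_min !lexx/= orbT.
have e0 : 0 < e by rewrite lt_min; apply/andP; split; lra.
have [ep ek] : e <= (1 - p^-1) / 2 /\ e <= (1 - k) / 2.
  by rewrite !ge_min !lexx/= orbT.
have d0 : 0 < d by rewrite lt_min; apply/andP; split; lra.
have [dq dp] : d <= q^-1 / 2 /\ d <= (1 - p^-1) / 2.
  by rewrite !ge_min !lexx/= orbT.
pose K1 := (1 + a^-1 `^ p^-1) * (2 * CH).
pose K2 := 2 * CH * C `^ q^-1.
exists b0, b1, d, (K1 + K2).
have K10 : 0 < K1.
  by rewrite mulr_gt0//; [rewrite ltr_pwDl// powR_ge0|lra].
have K20 : 0 < K2 by rewrite mulr_gt0 ?powR_gt0//; lra.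
split; [by rewrite /b0; lra|by rewrite /b1; lra|by []|lra|].
move=> l s l0 s0.
have A0 := phi0 _ l0; have B0 := psi0 _ s0.
set A := phi l; set B := psi s.
have AB0 : 0 <= A / B by rewrite divr_ge0 ?(ltW A0) ?(ltW B0).
have a'0 : 0 <= a^-1 by rewrite invr_ge0 ltW.
have s0' := ltW s0; have A0' := ltW A0; have B0' := ltW B0.
have K10' := ltW K10; have K20' := ltW K20; have C0' := ltW C0.
have [BA|AB] := leP B A.
- exists b1; first by right.
  have lB : l <= K1 * B `^ k * s * (A / B) `^ p^-1.
    have s2 : 0 < 2 * s by lra.
    have /(H _ _ B0 s2) : psi s < psi (2 * s) by apply: psi_inc; lra.
    rewrite -/B; set t := CH * B `^ k * (2 * s) => Bt.
    have t0 : 0 < t by rewrite !mulr_gt0 ?powR_gt0.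
    have AB1 : 1 <= A / B by rewrite ler_pdivlMr// mul1r.
    have r1 : 1 <= (A / B) `^ p^-1.
      have <- : 1 `^ p^-1 = 1 by rewrite powR1.
      by apply: ge0_ler_powR; rewrite ?nnegrE// ltW.
    have -> : K1 * B `^ k * s * (A / B) `^ p^-1 =
       t * (A / B) `^ p^-1 + t * (a^-1 `^ p^-1 * (A / B) `^ p^-1).
      by rewrite /t /K1; ring.
    have x0 : 0 <= t * (a^-1 `^ p^-1 * (A / B) `^ p^-1).
      by rewrite !mulr_ge0 ?powR_ge0 ?ltW.
    have y0 : 0 <= t * (A / B) `^ p^-1 by rewrite mulr_ge0 ?powR_ge0 ?ltW.
    have [lt|/ltW tl] := leP l t.
      apply: (@le_trans _ _ (t * (A / B) `^ p^-1)); last by rewrite lerDl.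
      by apply: le_trans lt _; rewrite ler_peMr// ltW.
    have := low _ _ t0 tl; rewrite -/A => ltA.
    have : (l / t) `^ p <= a^-1 * (A / B).
      rewrite ler_pdivlMl// ler_pdivlMr//; apply: le_trans ltA.
      by rewrite ler_wpM2l ?mulr_ge0 ?powR_ge0 ?ltW.
    have lt0 : 0 <= l / t by rewrite divr_ge0 ?ltW.
    move=> ltp; have : ((l / t) `^ p) `^ p^-1 <= (a^-1 * (A / B)) `^ p^-1.
      apply: ge0_ler_powR => //; first exact: ltW.
      - by rewrite nnegrE powR_ge0.
      - by rewrite nnegrE mulr_ge0 ?invr_ge0 ?divr_ge0 ?ltW.
    rewrite -powRrM mulfV ?gt_eqF// powRr1// (powRM _ a'0 AB0).
    rewrite ler_pdivrMr// (mulrC _ t) => lz.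
    by apply: (le_trans lz); rewrite lerDr.
  have -> : Num.min (A / B) (B / A) = B / A.
    apply/min_idPr; rewrite ler_pdivrMr// mulrAC ler_pdivlMr//.
    by rewrite -!expr2 lerXn2r.
  apply: (@le_trans _ _ (K1 * s * (B / A) `^ (k + b1 - p^-1))).
    have -> : K1 * s * (B / A) `^ (k + b1 - p^-1) =
      K1 * B `^ k * s * (A / B) `^ p^-1 * (A `^ (- (k + b1)) * B `^ b1).
      have <- : B `^ k * (A / B) `^ p^-1 * (A `^ (- (k + b1)) * B `^ b1) =
          (B / A) `^ (k + b1 - p^-1).
        have [x ->] : exists x, A = expR x by exists (ln A); rewrite lnK.
        have [y ->] : exists y, B = expR y by exists (ln B); rewrite lnK.
        by rewrite -!expRN -!expRD -!expRM -!expRD; congr expR; ring.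
      by ring.
    rewrite mulrA ler_wpM2r ?powR_ge0// ler_wpM2r ?powR_ge0//.
  rewrite mulrDl mulrDl -[leLHS]addr0.
  apply: lerD; last exact: mulr_ge0 (mulr_ge0 K20' s0') (powR_ge0 _ _).
  rewrite (ler_wpM2l (mulr_ge0 K10' s0'))//.
  apply: ger_powR; last by rewrite /b1; lra.
  by rewrite divr_gt0//= ler_pdivrMr// mul1r.
- have AB' := ltW AB; exists b0; first by left.
  have lA : l <= K2 * A `^ k * s * (A / B) `^ q^-1.
    (* The upper type of psi between t and s gives psi t >= A. *)
    pose t := (C * (A / B)) `^ q^-1 * s.
    have t0 : 0 < t.
      by apply: mulr_gt0 => //; apply: powR_gt0; apply: mulr_gt0 => //; exact: divr_gt0.
    have tq : (t / s) `^ q = C * (A / B).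
      rewrite /t mulfK ?gt_eqF// -powRrM mulVf ?gt_eqF// powRr1//.
      by rewrite mulr_ge0 ?divr_ge0 ?ltW.
    have At : A <= psi t.
      have [st|ts] := leP s t.
        apply: (le_trans (ltW AB)); rewrite /B; move: st; rewrite le_eqVlt.
        by case/orP => [/eqP->//|/(psi_inc _ _ (ltW s0))/ltW].
      have := upp _ _ t0 (ltW ts); rewrite -/B.
      have -> : (s / t) `^ q = (C * (A / B))^-1.
        have ts0 : t / s != 0 by rewrite mulf_neq0 ?invr_eq0 ?gt_eqF.
        have tsq0 : (t / s) `^ q != 0 by rewrite powR_eq0 (negPf ts0).
        apply: (mulIf tsq0); rewrite -[in RHS]tq mulVf// -powRM.
        - by rewrite -invf_div mulVf// powR1.
        - by rewrite divr_ge0 ?(ltW t0).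
        - by rewrite divr_ge0 ?(ltW t0).
      rewrite invfM mulrA mulfV ?gt_eqF// mul1r invf_div.
      by rewrite -mulrA ler_pMr// ler_pdivlMl// mulr1.
    have t2 : 0 < 2 * t by lra.
    have /(H _ _ A0 t2) : A < psi (2 * t).
      by apply: le_lt_trans At _; apply: psi_inc; lra.
    rewrite -/A; set u := _ * (2 * t) => Au.
    have -> : K2 * A `^ k * s * (A / B) `^ q^-1 = u.
      by rewrite /u /t /K2 (powRM _ C0' AB0); ring.
    rewrite leNgt; apply/negP => ul.
    have := phi_inc u l; rewrite ul => /(_ _ isT); rewrite -/A.
    have u0 : 0 <= u by rewrite !mulr_ge0 ?powR_ge0 ?ltW.
    by move=> /(_ u0); rewrite ltNge (ltW Au).
  have -> : Num.min (A / B) (B / A) = A / B.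
    apply/min_idPl; rewrite ler_pdivrMr// mulrAC ler_pdivlMr//.
    by rewrite -!expr2 lerXn2r.
  apply: (@le_trans _ _ (K2 * s * (A / B) `^ (q^-1 - b0))).
    have -> : K2 * s * (A / B) `^ (q^-1 - b0) =
      K2 * A `^ k * s * (A / B) `^ q^-1 * (A `^ (- (k + b0)) * B `^ b0).
      have <- : A `^ k * (A / B) `^ q^-1 * (A `^ (- (k + b0)) * B `^ b0) =
          (A / B) `^ (q^-1 - b0).
        have [x ->] : exists x, A = expR x by exists (ln A); rewrite lnK.
        have [y ->] : exists y, B = expR y by exists (ln B); rewrite lnK.
        by rewrite -!expRN -!expRD -!expRM -!expRD; congr expR; ring.
      by ring.
    rewrite mulrA ler_wpM2r ?powR_ge0// ler_wpM2r ?powR_ge0//.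
  rewrite mulrDl mulrDl -[leLHS]add0r.
  apply: lerD; first exact: mulr_ge0 (mulr_ge0 K10' s0') (powR_ge0 _ _).
  rewrite (ler_wpM2l (mulr_ge0 K20' s0'))//.
  apply: ger_powR; last by rewrite /b0; lra.
  by rewrite divr_gt0//= ler_pdivrMr// mul1r ltW.
Qed.

End exponent_gain.

(** * Summation of restricted bounds over levels *)

Section geometric_sums.
Context {R : realType}.

Lemma ler_powR_base (d x y : R) : 0 <= d -> 0 <= x -> x <= y ->
  x `^ d <= y `^ d.
Proof.
move=> d0 x0 xy; apply: ge0_ler_powR => //; rewrite nnegrE//.
exact: le_trans x0 xy.
Qed.

(** The sequence s at least doubles, so its terms below 1 and above 1 are
    dominated by two geometric progressions that meet around 1. *)
Lemma geometric_two_sided (d : R) (s : nat -> R) (n : nat) : 0 < d ->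
  (forall k, 0 < s k) -> (forall k, 2 * s k <= s k.+1) ->
  \sum_(k < n) Num.min (s k) (s k)^-1 `^ d <= 2 / (1 - 2^-1 `^ d).
Proof.
move=> d0 s0 s2; have d0' := ltW d0.
pose h : R := 2^-1 `^ d.
have h1 : h < 1.
  have := @gt0_ltr_powR _ _ d0 2^-1 1.
  by rewrite !nnegrE powR1; apply => //; rewrite invf_lt1// ltr1n.
rewrite ler_pdivlMr ?subr_gt0// -/h.
(* The summand at x is dominated by the sum of the increments g x - g (x / 2)
   and m x - m (2 * x) of two monotone functions bounded by 1; as s at least
   doubles, these increments add up to at most 2. *)
pose g (x : R) := Num.min x 1 `^ d.
pose m (x : R) := Num.min 1 x^-1 `^ d.
have g_nd x y : 0 <= x -> x <= y -> g x <= g y.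
  move=> x0 xy; apply: ler_powR_base => //; first by rewrite le_min x0/=.
  by rewrite le_min !ge_min xy lexx orbT.
have m_ni x y : 0 < x -> x <= y -> m y <= m x.
  move=> x0 xy; have y0 := lt_le_trans x0 xy.
  apply: ler_powR_base => //; first by rewrite le_min ler01 invr_ge0 ltW.
  by rewrite le_min !ge_min lexx lef_pV2// ?posrE// xy orbT.
have m_le1 x : 0 < x -> m x <= 1.
  move=> x0; rewrite -[leRHS](_ : 1 `^ d = 1); last by rewrite powR1.
  apply: ler_powR_base => //; first by rewrite le_min ler01 invr_ge0 ltW.
  by rewrite ge_min lexx.
have g_le1 x : 0 <= x -> g x <= 1.
  move=> x0; rewrite -[leRHS](_ : 1 `^ d = 1); last by rewrite powR1.
  apply: ler_powR_base => //; first by rewrite le_min x0/=.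
  by rewrite ge_min lexx orbT.
have step x : 0 < x ->
    Num.min x x^-1 `^ d * (1 - h) <= g x - g (x / 2) + (m x - m (2 * x)).
  move=> x0; have x0' := ltW x0.
  have gm : g (x / 2) <= g x by apply: g_nd; lra.
  have mm : m (2 * x) <= m x by apply: m_ni; lra.
  have [x1|/ltW x1] := leP x 1.
    have xV : x <= x^-1.
      by rewrite -[x^-1]mul1r ler_pdivlMr// -expr2 expr_le1.
    have -> : Num.min x x^-1 = x by apply/min_idPl.
    have -> : g x = x `^ d by rewrite /g; congr (_ `^ _); apply/min_idPl.
    have -> : g (x / 2) = x `^ d * h.
      rewrite /g -powRM//; congr (_ `^ _); apply/min_idPl; lra.
    lra.
  have xV : x^-1 <= x.
    by rewrite -[x^-1]mul1r ler_pdivrMr// -expr2 exprn_ege1.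
  have xV1 : x^-1 <= 1 by rewrite invf_le1.
  have xV0 : 0 <= x^-1 by rewrite invr_ge0.
  have -> : Num.min x x^-1 = x^-1 by apply/min_idPr.
  have -> : m x = x^-1 `^ d by rewrite /m; congr (_ `^ _); apply/min_idPr.
  have -> : m (2 * x) = x^-1 `^ d * h.
    rewrite /m -powRM// -invfM mulrC; congr (_ `^ _); apply/min_idPr.
    by rewrite invfM mulrC; lra.
  lra.
suff : (\sum_(k < n) Num.min (s k) (s k)^-1 `^ d) * (1 - h) <=
    g (s n / 2) + (1 - m (s n)).
  have : g (s n / 2) <= 1 by apply: g_le1; rewrite divr_ge0// ltW.
  have : 0 <= m (s n) by rewrite powR_ge0.
  lra.
elim: n => [|n IH].
  have : 0 <= g (s 0 / 2) by rewrite powR_ge0.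
  by rewrite big_ord0 mul0r; have := m_le1 _ (s0 0); lra.
rewrite big_ord_recr/= mulrDl.
have := step _ (s0 n).
have : g (s n) <= g (s n.+1 / 2).
  by apply: g_nd; [exact: ltW|have := s2 n; lra].
have : m (s n.+1) <= m (2 * s n) by apply: m_ni => //; have := s0 n; lra.
lra.
Qed.

End geometric_sums.

Section pigeonhole.
Context {R : realType}.

(** Let D i j = min (A j / B i, B i / A j)^d. If B i * g i exceeded the sum of
    the D i j * (A j * T j), it would exceed each of them, that is, A j * T
    j <= (D i j)^-1 * (B i * g i) for all j. In the restricted bounds this
    loses a factor (D i j)^-1 at most, because b <= 1, against a gain of
    (D i j)^2; the remaining D i j have a bounded sum over j, and for small
    eta the pairing inequality s i * g i <= 2 * \sum_j l j * L i j fails. So B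
    i * g i is at most that sum, and it remains to exchange the summations, as
    the sum of the D i j over i is bounded too. *)
Lemma summed_restricted_bounds (k b0 b1 d K0 eta : R) (n m : nat)
    (l A T s B g : nat -> R) (L : nat -> nat -> R) :
  0 <= k -> 0 < b0 <= 1 -> 0 < b1 <= 1 -> 0 < d -> 0 <= K0 -> 0 <= eta ->
  (forall j, 0 < l j) ->
  (forall j, 0 < A j) -> (forall j, 2 * A j <= A j.+1) ->
  (forall i, 0 < B i) -> (forall i, 2 * B i <= B i.+1) ->
  (forall i, 0 < s i) ->
  (forall j, 0 <= T j) -> (forall j, A j * T j <= 1) ->
  (forall i, 0 <= g i) ->
  (forall i j b, b = b0 \/ b = b1 ->
     L i j <= K0 * T j `^ (k + b) * g i `^ (1 - b)) ->
  (forall i, s i * g i <= 2 * \sum_(j < n) l j * L i j) ->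
  (forall i j, exists2 b, b = b0 \/ b = b1 &
     l j * A j `^ (- (k + b)) * B i `^ b <=
     eta * s i * Num.min (A j / B i) (B i / A j) `^ (d + d)) ->
  2 * K0 * eta * (2 / (1 - 2^-1 `^ d)) < 1 ->
  \sum_(i < m) B i * g i <=
    2 / (1 - 2^-1 `^ d) * \sum_(j < n) A j * T j.
Proof.
move=> k0 b0P b1P d0 K00 eta0 l0 A0 A2 B0 B2 s0 T0 x1 g0 Lle sg gain small.
pose D i j := Num.min (A j / B i) (B i / A j) `^ d.
have minE i j : Num.min (A j / B i) (B i / A j) =
    Num.min (A j / B i) (A j / B i)^-1 by rewrite invf_div.
have minE' i j : Num.min (A j / B i) (B i / A j) =
    Num.min (B i / A j) (B i / A j)^-1 by rewrite invf_div minC.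
have D0 i j : 0 <= D i j by rewrite powR_ge0.
have D_gt0 i j : 0 < D i j by rewrite powR_gt0// lt_min !divr_gt0.
have D1 i j : D i j <= 1.
  rewrite -[leRHS](_ : 1 `^ d = 1); last by rewrite powR1.
  apply: ler_powR_base; first exact: ltW.
    by rewrite le_min !divr_ge0 ?(ltW (A0 _)) ?(ltW (B0 _)).
  rewrite ge_min; have [AB|/ltW BA] := leP (A j) (B i).
    by rewrite ler_pdivrMr// mul1r AB.
  by rewrite orbC ler_pdivrMr// mul1r BA.
have sumDj i : \sum_(j < n) D i j <= 2 / (1 - 2^-1 `^ d).
  rewrite /D; under eq_bigr => j _ do rewrite minE.
  apply: (@geometric_two_sided _ d (fun j => A j / B i)) => //.
    by move=> j; rewrite divr_gt0.
  by move=> j; rewrite mulrA ler_pM2r ?invr_gt0.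
have sumDi j : \sum_(i < m) D i j <= 2 / (1 - 2^-1 `^ d).
  rewrite /D; under eq_bigr => i _ do rewrite minE'.
  apply: (@geometric_two_sided _ d (fun i => B i / A j)) => //.
    by move=> i; rewrite divr_gt0.
  by move=> i; rewrite mulrA ler_pM2r ?invr_gt0.
have x0 j : 0 <= A j * T j by rewrite mulr_ge0// ltW.
have key i : B i * g i <= \sum_(j < n) D i j * (A j * T j).
  rewrite leNgt; apply/negP => lt_y.
  have y0 : 0 < B i * g i.
    by apply: le_lt_trans lt_y; rewrite sumr_ge0// => j _; rewrite mulr_ge0.
  have gi0 : 0 < g i by move: y0; rewrite pmulr_rgt0.
  have small_x (j : 'I_n) : D i j * (A j * T j) <= B i * g i.
    apply: le_trans (ltW lt_y); rewrite (bigD1 j)//= lerDl sumr_ge0// => j' _.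
    by rewrite mulr_ge0.
  have term (j : 'I_n) : l j * L i j <= K0 * eta * (s i * g i) * D i j.
    have [b bE gain_b] := gain i j.
    have /andP[bgt0 b1'] : 0 < b <= 1 by case: bE => ->.
    apply: (@le_trans _ _ (l j * (K0 * T j `^ (k + b) * g i `^ (1 - b)))).
      by rewrite ler_pM2l// Lle.
    have Bgb : T j `^ (k + b) * g i `^ (1 - b) =
        (A j `^ (- (k + b)) * B i `^ b) * g i *
        ((A j * T j) `^ (k + b) * (B i * g i) `^ (- b)).
      rewrite (powRM _ (ltW (A0 j)) (T0 j)) (powRM _ (ltW (B0 i)) (g0 i)) !powRN.
      rewrite powRB ?(gt_eqF gi0) ?implybT// (powRr1 (g0 i)).
      field.
      by rewrite !gt_eqF// powR_gt0.
    have ratio : (A j * T j) `^ (k + b) * (B i * g i) `^ (- b) <= (D i j)^-1.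
      rewrite powRN ler_pdivrMr ?powR_gt0//.
      apply: (@le_trans _ _ ((A j * T j) `^ b)).
        have [->|xn0] := eqVneq (A j * T j) 0.
          by rewrite !powR0// gt_eqF//; lra.
        apply: ger_powR; last by rewrite lerDr.
        by rewrite lt0r xn0 x0 x1.
      apply: (@le_trans _ _ ((D i j)^-1 `^ b * (B i * g i) `^ b)).
        rewrite -powRM ?invr_ge0 ?(ltW y0)//.
        apply: ler_powR_base => //; first exact: ltW.
        by rewrite ler_pdivlMl.
      rewrite ler_wpM2r ?powR_ge0//.
      have DV : 1 <= (D i j)^-1 by rewrite invf_ge1.
      by rewrite -[leRHS]powRr1 ?invr_ge0//; apply: ler_powR.
    have -> : l j * (K0 * T j `^ (k + b) * g i `^ (1 - b)) =
       K0 * g i * ((l j * A j `^ (- (k + b)) * B i `^ b) *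
       ((A j * T j) `^ (k + b) * (B i * g i) `^ (- b))).
      by rewrite -[K0 * _ * _]mulrA Bgb; ring.
    have -> : K0 * eta * (s i * g i) * D i j =
       K0 * g i * (eta * s i * (D i j * D i j) * (D i j)^-1).
      by field; rewrite gt_eqF.
    rewrite ler_wpM2l ?mulr_ge0//; apply: ler_pM => //.
    - by rewrite !mulr_ge0 ?powR_ge0// ltW.
    - by rewrite mulr_ge0 ?powR_ge0.
    - apply: le_trans gain_b _; rewrite powRD//.
      by rewrite gt_eqF// addr_gt0.
  have : \sum_(j < n) l j * L i j <= K0 * eta * (s i * g i) * \sum_(j < n) D i j.
    by rewrite mulr_sumr ler_sum.
  have sgi0 : 0 < s i * g i by rewrite mulr_gt0.
  have : K0 * eta * (s i * g i) * \sum_(j < n) D i j <=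
         K0 * eta * (s i * g i) * (2 / (1 - 2^-1 `^ d)).
    by rewrite ler_wpM2l ?sumDj// !mulr_ge0// ltW.
  have : 2 * K0 * eta * (2 / (1 - 2^-1 `^ d)) * (s i * g i) < s i * g i.
    by rewrite gtr_pMl.
  have := sg i; lra.
apply: (@le_trans _ _ (\sum_(i < m) \sum_(j < n) D i j * (A j * T j))).
  by apply: ler_sum => i _; exact: key.
rewrite exchange_big/= mulr_sumr ler_sum// => j _.
by rewrite -mulr_suml ler_wpM2r.
Qed.

End pigeonhole.

(** * Young functions with the doubling condition *)

Section young_real.
Context {R : realType}.
Implicit Types Phi Psi : R -> \bar R.

(** Finiteness holds near 0, where Phi tends to 0, and the doubling condition
    carries it from r / 2^k to r. *)
Lemma young_fin_num Phi r : young_function Phi -> Delta2 Phi -> 0 <= r ->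
  Phi r \is a fin_num.
Proof.
move=> yPhi [C C1 D2]; rewrite le_eqVlt => /predU1P[<-|r0].
  by rewrite (young0 yPhi).
have C0 : 0 < C by lra.
have : \forall x \near 0^'+, (Phi x < 1%:E)%E.
  have n1 : nbhs (0 : \bar R)%E [set y | (y < 1%:E)%E].
    by apply: open_ereal_lt'; rewrite lte_fin.
  exact: (young_cvg0 yPhi n1).
move=> [e /= e0 small].
have [k rk] : exists k : nat, r / 2 ^+ k < e.
  have [k hk] : exists k : nat, r / e < 2 ^+ k.
    by exists (Num.bound (r / e)); apply: lt_exp2_bound; rewrite divr_ge0 ?ltW.
  by exists k; rewrite ltr_pdivrMr ?exprn_gt0// mulrC -ltr_pdivrMr.
have s0 : 0 < r / 2 ^+ k by rewrite divr_gt0// exprn_gt0.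
have fin j : Phi (2 ^+ j * (r / 2 ^+ k)) \is a fin_num.
  elim: j => [|j IH].
    rewrite expr0 mul1r ge0_fin_numE ?(young_ge0 yPhi) ?(ltW s0)//.
    rewrite (@lt_trans _ _ 1%E) ?ltry//; apply: small => //=.
    by rewrite sub0r normrN gtr0_norm.
  have sj : 0 < 2 ^+ j * (r / 2 ^+ k) by rewrite mulr_gt0// exprn_gt0.
  rewrite exprS -mulrA ge0_fin_numE; last first.
    by apply: (young_ge0 yPhi); rewrite mulr_ge0 ?ltW.
  apply: le_lt_trans (D2 _ sj) _.
  by rewrite -(fineK IH) -EFinM ltry.
by have := fin k; rewrite mulrCA mulfV ?mulr1// expf_neq0.
Qed.

(** Convexity on the segment from 0 to r, as Phi 0 = 0. *)
Lemma young_convex0 Phi r t : young_function Phi -> Delta2 Phi ->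
  0 <= r -> 0 <= t <= 1 -> fine (Phi (t * r)) <= t * fine (Phi r).
Proof.
move=> yPhi D2 r0 /andP[t0 t1].
have := young_convex yPhi r0 (lexx 0) (t := t); rewrite t0 t1 => /(_ isT).
rewrite mulr0 addr0 (young0 yPhi) mule0 adde0.
have f1 := young_fin_num yPhi D2 r0.
have f2 := young_fin_num yPhi D2 (mulr_ge0 t0 r0).
by rewrite -(fineK f1) -(fineK f2) -EFinM lee_fin.
Qed.

(** If Phi vanished at r, the doubling condition would make it vanish at all
    the 2^j r, although it tends to infinity. *)
Lemma young_gt0 Phi r : young_function Phi -> Delta2 Phi -> 0 < r ->
  0 < fine (Phi r).
Proof.
move=> yPhi D2 r0; rewrite lt0r fine_ge0 ?(young_ge0 yPhi) ?ltW// andbT.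
apply/negP => /eqP Phir0.
have : \forall x \near +oo, (1%:E < Phi x)%E.
  by move: (young_cvgy yPhi) => /cvgey_gt; exact.
move=> [M [Mr big]].
pose x := Num.max M r + r.
have Mx : M < x.
  by apply: (@le_lt_trans _ _ (Num.max M r)); rewrite ?ltrDl// le_max lexx.
have rx : r <= x.
  by rewrite lerDr le_max (ltW r0) orbT.
have [k xk] : exists k : nat, x / r <= 2 ^+ k.
  exists (Num.bound (x / r)); apply/ltW/lt_exp2_bound.
  by rewrite divr_ge0// ?(ltW r0)//; lra.
have zero j : Phi (2 ^+ j * r) = 0%E.
  elim: j => [|j IH].
    by rewrite expr0 mul1r -(fineK (young_fin_num yPhi D2 (ltW r0))) Phir0.
  have [C C1 D2C] := D2.
  have sj : 0 < 2 ^+ j * r by rewrite mulr_gt0// exprn_gt0.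
  apply/eqP; rewrite eq_le (young_ge0 yPhi) ?andbT; last first.
    by rewrite mulr_ge0// ?(ltW r0)// exprn_ge0.
  by have := D2C _ sj; rewrite IH mule0 exprS mulrA.
have /big : M < 2 ^+ k * r.
  by apply: lt_le_trans Mx _; rewrite -ler_pdivrMr.
by rewrite zero lte_fin ltr10.
Qed.

Lemma young_increasing Phi r s : young_function Phi -> Delta2 Phi ->
  0 <= r -> r < s -> fine (Phi r) < fine (Phi s).
Proof.
move=> yPhi D2 r0 rs; have s0 : 0 < s by lra.
have t01 : 0 <= r / s <= 1.
  by rewrite divr_ge0 ?(ltW s0)//= ler_pdivrMr// mul1r ltW.
have := young_convex0 yPhi D2 (ltW s0) t01.
rewrite divfK ?gt_eqF// => /le_lt_trans; apply.
by rewrite gtr_pMl ?ltr_pdivrMr ?mul1r// young_gt0.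
Qed.

Lemma young_nondecreasing Phi r s : young_function Phi -> Delta2 Phi ->
  0 <= r -> r <= s -> fine (Phi r) <= fine (Phi s).
Proof.
move=> yPhi D2 r0; rewrite le_eqVlt => /predU1P[->//|rs].
by rewrite ltW// young_increasing.
Qed.

Lemma young_double Phi r : young_function Phi -> Delta2 Phi -> 0 <= r ->
  2 * fine (Phi r) <= fine (Phi (2 * r)).
Proof.
move=> yPhi D2 r0; have half : 0 <= (2^-1 : R) <= 1.
  by rewrite invr_ge0 ler0n/= invf_le1// ler1n.
have r2 : 0 <= 2 * r by rewrite mulr_ge0.
have := young_convex0 yPhi D2 r2 half; rewrite mulKf// ler_pdivlMl//.
Qed.

(** The inequality between the inverses, read off at the level of the
    functions: if an infimum is smaller than a number, so is some element of
    the set. The factor 2 provides the strict inequality. *)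
Lemma young_inv_transfer Phi Psi (k C B t : R) :
  0 < C -> 0 < B -> 0 < t ->
  ((B `^ (- k))%:E * young_inv Phi B%:E <= C%:E * young_inv Psi B%:E)%E ->
  (B%:E < Psi t)%E ->
  exists2 r, 0 <= r < 2 * C * B `^ k * t & (B%:E < Phi r)%E.
Proof.
move=> C0 B0 t0 H BPsi.
have Bk : 0 < B `^ k by rewrite powR_gt0.
have : (young_inv Psi B%:E <= t%:E)%E.
  by apply: ereal_inf_lbound => /=; exists t => //; rewrite ltW.
move=> /(lee_wpmul2l (_ : (0 <= C%:E)%E)) => /(_ (ltW C0 : (0 <= C%:E)%E)).
move=> /(le_trans H); rewrite powRN lee_pdivrMl// -!EFinM => H1.
have : (young_inv Phi B%:E < (2 * C * B `^ k * t)%:E)%E.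
  apply: le_lt_trans H1 _; rewrite lte_fin.
  have : 0 < B `^ k * (C * t) by rewrite !mulr_gt0.
  by rewrite -!mulrA (mulrCA C); lra.
move=> /ereal_inf_lt[_ [r [r0 Br] <-]]; rewrite lte_fin => rt.
by exists r => //; rewrite r0.
Qed.

End young_real.

(** * Cubes and their measure *)

Section cubes.
Context {R : realType} {n : nat}.
Local Notation mu := (lebesgue_measure_n n : set Rn[R]_n -> \bar R).
Implicit Types (a : 'I_n -> R) (h : R).

(** Half-open, so that the 2^n subcubes of half the side form a partition. *)
Definition cube a h : set Rn[R]_n :=
  [set t | forall i, a i <= tnth t i < a i + h].

Lemma measurable_coordinate_box (A : 'I_n -> set (measurableTypeR R)) :
  (forall i, measurable (A i)) ->
  measurable [set t : Rn[R]_n | forall i, A i (tnth t i)].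
Proof.
move=> mA; rewrite [X in measurable X](_ : _ = \bigcap_(i in [set: 'I_n])
   (fun t : Rn[R]_n => tnth t i) @^-1` A i).
  apply: fin_bigcap_measurable => // i _; rewrite -[X in measurable X]setTI.
  exact: (@measurable_tnth _ (measurableTypeR R)).
by apply/seteqP; split => t /= H i => [_|]; exact: H.
Qed.

Lemma cubeE a h : cube a h =
  [set t | forall i, [set` `[a i, a i + h[] (tnth t i)].
Proof. by apply/seteqP; split => t /= H i; have := H i; rewrite in_itv. Qed.

Lemma measurable_cube a h : measurable (cube a h).
Proof.
rewrite cubeE; apply: (@measurable_coordinate_box (fun i => [set` `[a i, a i + h[])).
by move=> i; exact: measurable_itv.
Qed.

Lemma prod_EFin (I : finType) (F : I -> R) :
  (\prod_i (F i)%:E)%E = (\prod_i F i)%:E.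
Proof. by elim/big_ind2 : _ => // x1 x2 y1 y2 -> ->; rewrite EFinM. Qed.

Lemma mu_interval_box (c d : 'I_n -> R) : (forall i, c i <= d i) ->
  mu [set t | forall i, [set` `[c i, d i[] (tnth t i)] =
  (\prod_i (d i - c i))%:E.
Proof.
move=> cd; rewrite (@lebesgue_measure_n_box R n (fun i => [set` `[c i, d i[])); last first.
  by move=> i; exact: measurable_itv.
rewrite -prod_EFin; apply: eq_bigr => i _.
rewrite lebesgue_measure_itv/= lte_fin.
by case: ltP => // dc; rewrite (_ : d i = c i) ?subrr//; apply/eqP; rewrite eq_le dc cd.
Qed.

Lemma mu_cube a h : 0 <= h -> mu (cube a h) = (h ^+ n)%:E.
Proof.
move=> h0; rewrite cubeE mu_interval_box; last by move=> i; rewrite lerDl.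
by under eq_bigr do rewrite addrC addKr; rewrite prodr_const card_ord.
Qed.

Definition half_cell a (h : R) (s : {ffun 'I_n -> bool}) : 'I_n -> R :=
  fun i => a i + (if s i then h / 2 else 0).

Lemma cube_half_cells a h : 0 <= h ->
  cube a h = \big[setU/set0]_(s : {ffun 'I_n -> bool}) cube (half_cell a h s) (h / 2).
Proof.
move=> h0; apply/seteqP; split => t; rewrite -bigcup_seq/=.
  move=> ta; exists [ffun i => a i + h / 2 <= tnth t i].
    by rewrite /= mem_index_enum.
  move=> i; have /andP[ai tia] := ta i; rewrite /half_cell ffunE.
  by case: (leP (a i + h / 2) (tnth t i)) => cut; apply/andP; split; lra.
move=> [s _ ts] i; have /andP[] := ts i; rewrite /half_cell.
by case: (s i) => lo hi; apply/andP; split; lra.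
Qed.

Lemma trivIset_half_cells a h : 0 <= h ->
  trivIset setT (fun s : {ffun 'I_n -> bool} => cube (half_cell a h s) (h / 2)).
Proof.
move=> h0 s s' _ _ [t [ts ts']]; apply/ffunP => i.
have /andP[] := ts i; have /andP[] := ts' i; rewrite /half_cell.
by case: (s i); case: (s' i) => //; rewrite ?addr0 => ? ? ? ?; exfalso; lra.
Qed.

Lemma Rintegral_half_cells a h (A : set Rn[R]_n) (g : Rn[R]_n -> R) :
  0 <= h -> measurable A -> mu.-integrable (cube a h) (EFin \o g) ->
  \int[mu]_(x in cube a h `&` A) g x =
  \sum_(s : {ffun 'I_n -> bool})
     \int[mu]_(x in cube (half_cell a h s) (h / 2) `&` A) g x.
Proof.
move=> h0 mA ig; pose F s := cube (half_cell a h s) (h / 2) `&` A.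
have FE : cube a h `&` A = \big[setU/set0]_(s : {ffun 'I_n -> bool}) F s.
  by rewrite cube_half_cells// -!bigcup_seq/= setI_bigcupl.
have mF s : measurable (F s) by apply: measurableI => //; exact: measurable_cube.
have igF s : mu.-integrable (F s) (EFin \o g).
  apply: integrableS ig => //; first exact: measurable_cube.
  move=> x [xs _]; rewrite cube_half_cells// -bigcup_seq/=.
  by exists s => //=; rewrite mem_index_enum.
rewrite /Rintegral FE integral_bigsetU_EFin//.
- rewrite -sum_fine// => s _; exact: integrable_fin_num.
- exact: index_enum_uniq.
- move=> s s' _ _ [t [[ts _] [ts' _]]].
  by apply: (@trivIset_half_cells a h h0) => //; exists t.
- rewrite -FE; apply: (measurable_funS (measurable_cube a h) (@subIsetl _ _ _)).
  exact: measurable_int ig.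
Qed.

End cubes.

(** * Dyadic cells *)

Section dyadic_cells.
Context {R : realType} {n : nat}.
Local Notation mu := (lebesgue_measure_n n : set Rn[R]_n -> \bar R).
Local Notation node := (('I_n -> R) * nat)%type.
Variable h0 : R.
Hypothesis h0_gt0 : 0 < h0.

(** A node is a corner together with a generation; the length of the side is a
    function of the generation, so that going to a child halves it. *)
Definition side (k : nat) : R := h0 / 2 ^+ k.
Definition cell (Q : node) : set Rn[R]_n := cube Q.1 (side Q.2).
Definition subcell (Q : node) (s : {ffun 'I_n -> bool}) : node :=
  (half_cell Q.1 (side Q.2) s, Q.2.+1).

Lemma side_gt0 k : 0 < side k. Proof. by rewrite divr_gt0// exprn_gt0. Qed.

Lemma sideS k : side k.+1 = side k / 2.
Proof. by rewrite /side exprS invfM mulrCA mulrC. Qed.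

Lemma measurable_cell Q : measurable (cell Q).
Proof. exact: measurable_cube. Qed.

Lemma measurable_cellI Q A : measurable A -> measurable (cell Q `&` A).
Proof. by move=> mA; apply: measurableI => //; exact: measurable_cell. Qed.

Lemma mu_cell Q : mu (cell Q) = (side Q.2 ^+ n)%:E.
Proof. by rewrite mu_cube// ltW// side_gt0. Qed.

Lemma mu_cell_lty Q : (mu (cell Q) < +oo)%E.
Proof. by rewrite mu_cell ltry. Qed.

Lemma mu_cellI_fin Q A : measurable A -> mu (cell Q `&` A) \is a fin_num.
Proof.
move=> mA; rewrite ge0_fin_numE//; apply: (@le_lt_trans _ _ (mu (cell Q))).
  by apply: measureIl => //; exact: measurable_cell.
by rewrite mu_cell ltry.
Qed.

Lemma card_subcells : #|{ffun 'I_n -> bool}| = (2 ^ n)%N.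
Proof. by rewrite card_ffun card_bool card_ord. Qed.

Lemma cell_subcell Q s : cell (subcell Q s) `<=` cell Q.
Proof.
move=> t ts; rewrite /cell cube_half_cells ?(ltW (side_gt0 _))//.
by rewrite -bigcup_seq; exists s; rewrite /= ?mem_index_enum// -sideS.
Qed.

Lemma Rintegral_subcells Q A (g : Rn[R]_n -> R) : measurable A ->
  mu.-integrable (cell Q) (EFin \o g) ->
  \int[mu]_(x in cell Q `&` A) g x =
  \sum_s \int[mu]_(x in cell (subcell Q s) `&` A) g x.
Proof.
move=> mA ig; rewrite /cell (Rintegral_half_cells (ltW (side_gt0 _)) mA ig).
by apply: eq_bigr => s _; rewrite -sideS.
Qed.

Lemma mu_subcells Q A : measurable A ->
  fine (mu (cell Q `&` A)) = \sum_s fine (mu (cell (subcell Q s) `&` A)).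
Proof.
move=> mA.
have i1 : mu.-integrable (cell Q) (EFin \o (fun _ => 1 : R)).
  apply: measurable_bounded_integrable => //; first exact: measurable_cell.
    exact: mu_cell_lty.
  by exists 1; split; rewrite ?num_real// => x x1 y _; rewrite normr1 ltW.
have := Rintegral_subcells mA i1.
rewrite Rintegral_cst; last exact: measurable_cellI.
rewrite mul1r => ->; apply: eq_bigr => s _; rewrite Rintegral_cst ?mul1r//.
exact: measurable_cellI.
Qed.

(** On the cell Q, the set A is a union of cells of the k-th generation. The
    recursion is that of leaf_exp, which allows proofs by induction along the
    tree. *)
Fixpoint cell_union (k : nat) (Q : node) (A : set Rn[R]_n) : Prop :=
  if k is k'.+1 then forall s, cell_union k' (subcell Q s) A
  else cell Q `<=` A \/ cell Q `<=` ~` A.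

Lemma cell_unionS k Q A : cell_union k Q A -> cell_union k.+1 Q A.
Proof.
elim: k Q => [|k IH] Q /= H s; last exact: (IH (subcell Q s)).
by case: H => [QA|QA]; [left|right] => t /cell_subcell; exact: QA.
Qed.

Lemma cell_union_le k l Q A : (k <= l)%N -> cell_union k Q A -> cell_union l Q A.
Proof.
move=> /subnK <- kA; elim: (l - k)%N => [//|m IH]; rewrite addSn.
exact: cell_unionS.
Qed.

Lemma cell_unionC k Q A : cell_union k Q A -> cell_union k Q (~` A).
Proof.
elim: k Q => [|k IH] Q /= H; last by move=> s; exact: IH.
by case: H; [right; rewrite setCK|left].
Qed.

Lemma cell_unionU k Q A B : cell_union k Q A -> cell_union k Q B ->
  cell_union k Q (A `|` B).
Proof.
elim: k Q => [|k IH] Q /= HA HB; last by move=> s; exact: IH.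
case: HA => [QA|QA]; first by left => t /QA; left.
case: HB => [QB|QB]; first by left => t /QB; right.
by right => t Qt [/(QA _ Qt)|/(QB _ Qt)].
Qed.

(** Half-spaces bounded by a hyperplane of the grid of generation j are the
    basic unions of cells. *)
Lemma cell_union_grid j (Q : node) i (p : int) :
  cell_union j Q
    [set t | Q.1 i + side Q.2 * p%:~R / 2 ^+ j <= tnth t i].
Proof.
elim: j Q p => [|j IH] Q p /=.
  rewrite expr0 divr1; have [p0|p1] := leP p 0.
    left => t /(_ i)/andP[lo _] /=; apply: le_trans lo; rewrite gerDl.
    by rewrite mulr_ge0_le0 ?(ltW (side_gt0 _))// lerz0.
  right => t /(_ i)/andP[_ hi] /=; apply/negP; rewrite -ltNge.
  apply: lt_le_trans hi _; rewrite lerD2l ler_peMr ?(ltW (side_gt0 _))//.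
  by rewrite ler1z.
move=> s.
have <- : (subcell Q s).1 i + side (subcell Q s).2 *
    (if s i then p - (2 ^ j)%N%:Z else p)%:~R / 2 ^+ j =
  Q.1 i + side Q.2 * p%:~R / 2 ^+ j.+1; last exact: IH.
have e2 : 2 ^+ j != 0 :> R by rewrite expf_neq0.
rewrite /= sideS /half_cell exprS; case: (s i); last by field.
rewrite rmorphB/= (_ : (2 ^ j)%N%:~R = 2 ^+ j :> R); last by rewrite -natrX.
by field.
Qed.

End dyadic_cells.

(** * Approximation of Borel sets by unions of cells *)

Section cell_approximation.
Context {R : realType} {n : nat}.
Local Notation mu := (lebesgue_measure_n n : set Rn[R]_n -> \bar R).
Variable h0 : R.
Hypothesis h0_gt0 : 0 < h0.
Local Notation cell := (cell (n := n) h0).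
Local Notation side := (side h0).
Local Notation cell_union := (cell_union (n := n) h0).
Local Open Scope ereal_scope.

Definition symdiff (A B : set Rn[R]_n) := (A `\` B) `|` (B `\` A).

Lemma measurable_symdiff A B :
  measurable A -> measurable B -> measurable (symdiff A B).
Proof. by move=> mA mB; apply: measurableU; exact: measurableD. Qed.

Definition cell_approximable Q (A : set Rn[R]_n) := measurable A /\
  forall e : R, (0 < e)%R -> exists k B,
    [/\ measurable B, cell_union k Q B & mu (cell Q `&` symdiff A B) < e%:E].

Lemma cell_approximableC Q A : cell_approximable Q A -> cell_approximable Q (~` A).
Proof.
move=> [mA appA]; split; first exact: measurableC.
move=> e /appA[k [B [mB kB AB]]]; exists k, (~` B); split.
- exact: measurableC.
- exact: cell_unionC.
- rewrite (_ : symdiff _ _ = symdiff A B)//.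
  by rewrite /symdiff !setDE !setCK setUC ![~` _ `&` _]setIC.
Qed.

Lemma mu_symdiff_sub Q A B C : measurable A -> measurable B -> measurable C ->
  A `<=` B `|` C ->
  mu (cell Q `&` A) <= mu (cell Q `&` B) + mu (cell Q `&` C).
Proof.
move=> mA mB mC ABC.
have mBC : measurable (cell Q `&` B `|` cell Q `&` C).
  by apply: measurableU; exact: measurable_cellI.
apply: (@le_trans _ _ (mu (cell Q `&` B `|` cell Q `&` C))).
  apply: le_measure; rewrite ?inE//; first exact: measurable_cellI.
  by rewrite -setIUr; exact: setIS.
by apply: measureU2; exact: measurable_cellI.
Qed.

Lemma cell_approximableU Q A B : cell_approximable Q A ->
  cell_approximable Q B -> cell_approximable Q (A `|` B).
Proof.
move=> [mA appA] [mB appB]; split; first exact: measurableU.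
move=> e e0; have e2 : (0 < e / 2)%R by rewrite divr_gt0.
have [k [A' [mA' kA' AA']]] := appA _ e2.
have [l [B' [mB' lB' BB']]] := appB _ e2.
exists (maxn k l), (A' `|` B'); split; first exact: measurableU.
- by apply: cell_unionU; [apply: (cell_union_le h0_gt0 _ kA'); exact: leq_maxl|
                          apply: (cell_union_le h0_gt0 _ lB'); exact: leq_maxr].
- rewrite (splitr e) EFinD.
  apply: le_lt_trans (lteD AA' BB'); apply: mu_symdiff_sub;
    [|exact: measurable_symdiff|exact: measurable_symdiff|].
    by apply: measurable_symdiff; exact: measurableU.
  move=> t [[[tA|tB] tN]|[[tA|tB] tN]].
  + by left; left; split=> // tA'; apply: tN; left.
  + by right; left; split=> // tB'; apply: tN; right.
  + by left; right; split=> // tA'; apply: tN; left.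
  + by right; right; split=> // tB'; apply: tN; right.
Qed.

Lemma cell_approximable0 Q : cell_approximable Q set0.
Proof.
split=> // e e0; exists 0%N, set0; split=> //; first by right => t _ [].
by rewrite /symdiff setDv setU0 setI0 measure0 lte_fin.
Qed.

(** Finite unions exhaust a countable one up to a small part of Q, by
    continuity from above of the measure, which is finite on Q. *)
Lemma cell_approximable_bigcup Q (F : (set Rn[R]_n)^nat) :
  (forall i, cell_approximable Q (F i)) ->
  cell_approximable Q (\bigcup_i F i).
Proof.
move=> appF; have mF i : measurable (F i) by have [] := appF i.
have mbF : measurable (\bigcup_i F i) by exact: bigcupT_measurable.
split=> // e e0; have e2 : (0 < e / 2)%R by rewrite divr_gt0.
pose U m := \big[setU/set0]_(i < m) F i.
have appU m : cell_approximable Q (U m).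
  rewrite /U; elim: m => [|m IH]; first by rewrite big_ord0; exact: cell_approximable0.
  by rewrite big_ord_recr/=; exact: cell_approximableU.
have mU m : measurable (U m) by have [] := appU m.
pose V m := cell Q `&` (\bigcup_i F i `\` U m).
have mV m : measurable (V m) by apply: measurable_cellI; exact: measurableD.
have V0 : \bigcap_m V m = set0.
  apply/seteqP; split=> // t Vt; have [_ [[i _ Fit] _]] := Vt 0%N I.
  have [_ [_]] := Vt i.+1 I; apply.
  by rewrite /U -bigcup_mkord; exists i => //=.
have niV : nonincreasing_seq V.
  move=> i j ij; apply/subsetPset => t [Qt [Ft nUt]]; split=> //; split=> // Ut.
  apply: nUt; move: Ut; rewrite /U -!bigcup_mkord => -[k /= ki Fk].
  by exists k => //=; exact: leq_trans ij.
have : mu \o V @ \oo --> mu (\bigcap_m V m).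
  apply: nonincreasing_cvg_mu => //; last by rewrite V0.
  apply: (@le_lt_trans _ _ (mu (cell Q))).
    apply: le_measure; rewrite ?inE//; [exact: measurable_cell|by move=> t []].
  exact: (mu_cell_lty h0_gt0).
rewrite V0 measure0 => V_cvg0.
have n0 : nbhs (0 : \bar R) [set y | y < (e / 2)%:E].
  by apply: open_ereal_lt'; rewrite lte_fin.
have [m _ /(_ m (leqnn m))/= Vm] := V_cvg0 _ n0.
have [k [B [mB kB UB]]] := (appU m).2 _ e2.
exists k, B; split=> //.
rewrite (splitr e) EFinD.
apply: le_lt_trans (lteD Vm UB); apply: mu_symdiff_sub => //;
  [exact: measurable_symdiff|exact: measurableD|exact: measurable_symdiff|].
move=> t [[Ft nBt]|[Bt nFt]].
  by have [Ut|nUt] := pselect (U m t); [right; left|left].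
right; right; split=> // Ut; apply: nFt; move: Ut.
by rewrite /U -bigcup_mkord => -[i _ Fi]; exists i.
Qed.

(** Rounding x down to the grid of generation j changes the half-space within
    Q by a slab of thickness side / 2^j. *)
Lemma cell_approximable_ray Q i (x : R) :
  cell_approximable Q [set t | x <= tnth t i]%R.
Proof.
have mray y : measurable [set t : Rn[R]_n | y <= tnth t i]%R.
  have := @measurable_tnth _ (measurableTypeR R) n i measurableT `[y, +oo[%classic.
  rewrite setTI (_ : _ @^-1` _ = [set t | y <= tnth t i]%R); first by apply; exact: measurable_itv.
  by apply/seteqP; split => t /=; rewrite in_itv/= andbT.
split=> // e e0.
have sn0 : (0 < side Q.2 ^+ n)%R by rewrite exprn_gt0// side_gt0.
have [j je] : exists j : nat, (side Q.2 ^+ n / 2 ^+ j < e)%R.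
  exists (Num.bound (side Q.2 ^+ n / e)); rewrite ltr_pdivrMr ?exprn_gt0//.
  by rewrite mulrC -ltr_pdivrMr//; apply: lt_exp2_bound; rewrite divr_ge0// ltW.
pose d := (side Q.2 / 2 ^+ j)%R.
have d0 : (0 < d)%R by rewrite divr_gt0 ?exprn_gt0// side_gt0.
pose p := Num.floor ((x - Q.1 i) / d).
pose y := (Q.1 i + side Q.2 * p%:~R / 2 ^+ j)%R.
have yE : y = (Q.1 i + p%:~R * d)%R by rewrite /y /d mulrAC (mulrC (side _ / _)%R).
have yx : (y <= x)%R.
  by rewrite yE -lerBrDl -ler_pdivlMr// floor_le_tmp.
have xy : (x < y + d)%R.
  have := floorD1_gt ((x - Q.1 i) / d); rewrite -/p intrD ltr_pdivrMr// yE.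
  by rewrite mulrDl mul1r; lra.
exists j, [set t | y <= tnth t i]%R; split=> //; first exact: (cell_union_grid h0_gt0).
pose c l := if l == i then y else Q.1 l.
pose c' l := if l == i then (y + d)%R else (Q.1 l + side Q.2)%R.
have cc' l : (c l <= c' l)%R.
  by rewrite /c /c'; case: ifP => _; rewrite lerDl ltW// side_gt0.
apply: (@le_lt_trans _ _ (mu [set t | forall l, [set` `[c l, c' l[] (tnth t l)])).
  apply: le_measure; rewrite ?inE//.
  - by apply: measurable_cellI; exact: measurable_symdiff.
  - apply: (@measurable_coordinate_box _ _ (fun l => [set` `[c l, c' l[])) => l.
    exact: measurable_itv.
  - move=> t [Qt [[/= xt yt]|[/= yt xt]]]; first by exfalso; apply: yt; exact: le_trans xt.
    move=> l; rewrite /= in_itv/= /c /c'; case: eqP => [->|_]; last exact: Qt.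
    rewrite yt/=; apply: lt_trans xy.
    by rewrite ltNge; apply/negP.
rewrite mu_interval_box// lte_fin; apply: le_lt_trans je.
rewrite [leLHS](_ : _ = (\prod_(l < n) side Q.2) *
    \prod_(l < n) (if l == i then (2 ^+ j)^-1 else 1))%R.
  by rewrite prodr_const card_ord -big_mkcond/= big_pred1_eq.
rewrite -big_split/=; apply: eq_bigr => l _; rewrite /c /c'.
by case: eqP => _; rewrite addrC addKr// mulr1.
Qed.

(** The approximable sets form a sigma-algebra that contains the half-spaces,
    which generate the Borel sets. *)
Lemma cell_approximable_measurable Q A : measurable A -> cell_approximable Q A.
Proof.
have sig : sigma_algebra [set: Rn[R]_n] (cell_approximable Q).
  split; first exact: cell_approximable0.
    by move=> B; rewrite setTD; exact: cell_approximableC.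
  exact: cell_approximable_bigcup.
move: A; apply: smallest_sub => //.
have coord i (Y : set (measurableTypeR R)) : measurable Y ->
    cell_approximable Q ((fun t : Rn[R]_n => tnth t i) @^-1` Y).
  move=> mY; have {mY} : ((measurable_realfun.RGenCInfty.G (R := R)).-sigma.-measurable) Y.
    by rewrite -measurable_realfun.RGenCInfty.measurableE.
  move: Y; apply: smallest_sub.
    split; first by rewrite preimage_set0; exact: cell_approximable0.
      by move=> B; rewrite /= setTD preimage_setC; exact: cell_approximableC.
    by move=> F; rewrite /= preimage_bigcup; exact: cell_approximable_bigcup.
  move=> _ [x ->] /=.
  have := cell_approximable_ray Q i x.
  congr (cell_approximable _ _); apply/seteqP; split => t /=.
    by rewrite in_itv/= andbT.
  by rewrite in_itv/= andbT.
move=> B; rewrite -bigcup_seq => -[i _ [Y mY <-]].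
by rewrite setTI; exact: coord.
Qed.

End cell_approximation.

(** * The John-Nirenberg inequality on measurable sets *)

Section john_nirenberg.
Context {R : realType} {n : nat}.
Local Notation mu := (lebesgue_measure_n n : set Rn[R]_n -> \bar R).
Variable h0 : R.
Hypothesis h0_gt0 : 0 < h0.
Local Notation cell := (cell (n := n) h0).
Local Notation side := (side h0).
Local Notation subcell := (subcell (n := n) h0).
Local Notation cell_union := (cell_union (n := n) h0).
Local Notation node := (('I_n -> R) * nat)%type.
Variable b : Rn[R]_n -> R.
Hypothesis int_b : forall Q : node, mu.-integrable (cell Q) (EFin \o b).

Definition cell_avg (Q : node) : R :=
  (side Q.2 ^+ n)^-1 * \int[mu]_(x in cell Q) b x.
Definition cell_dev (Q : node) (v : R) : R :=
  (side Q.2 ^+ n)^-1 * \int[mu]_(x in cell Q) `|b x - v|.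

Hypothesis osc_b : forall Q, cell_dev Q (cell_avg Q) <= 1.

Let sn_gt0 k : 0 < side k ^+ n.
Proof. by rewrite exprn_gt0// side_gt0. Qed.

Lemma integrable_cst_cell Q (v : R) : mu.-integrable (cell Q) (EFin \o (fun=> v)).
Proof.
apply: measurable_bounded_integrable => //; first exact: measurable_cell.
  exact: (mu_cell_lty h0_gt0).
by exists `|v|; split; rewrite ?num_real// => x vx y _; rewrite ltW.
Qed.

Lemma integrable_dev Q (v : R) :
  mu.-integrable (cell Q) (EFin \o (fun x => b x - v)).
Proof.
have := integrableB (measurable_cell h0 Q) (int_b Q) (integrable_cst_cell Q v).
by apply: eq_integrable => //; exact: measurable_cell.
Qed.

Lemma integrable_norm_dev Q (v : R) :
  mu.-integrable (cell Q) (EFin \o (fun x => `|b x - v|)).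
Proof. exact: integrable_norm (integrable_dev Q v). Qed.

Lemma Rintegral_dev Q v :
  \int[mu]_(x in cell Q) (b x - v) = side Q.2 ^+ n * (cell_avg Q - v).
Proof.
rewrite RintegralB//; [|exact: measurable_cell|exact: integrable_cst_cell].
rewrite Rintegral_cst; last exact: measurable_cell.
rewrite /= (mu_cell h0_gt0)/= mulrBr /cell_avg mulVKf ?gt_eqF//.
by rewrite (mulrC v).
Qed.

Lemma cell_avg_dev Q v : `|cell_avg Q - v| <= cell_dev Q v.
Proof.
rewrite /cell_dev ler_pdivlMl// -[X in X * _]gtr0_norm// -normrM -Rintegral_dev.
apply: le_normr_Rintegral; first exact: measurable_cell.
exact: integrable_dev.
Qed.

Lemma cell_dev_subcells Q v : cell_dev Q v =
  #|{ffun 'I_n -> bool}|%:R^-1 * \sum_s cell_dev (subcell Q s) v.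
Proof.
rewrite card_subcells /cell_dev.
have := Rintegral_subcells h0_gt0 measurableT (integrable_norm_dev Q v).
rewrite setIT => ->.
under [in LHS]eq_bigr do rewrite setIT.
rewrite /= -mulr_sumr mulrA; congr (_ * _).
rewrite sideS natrX (expr_div_n (side Q.2)) invfM invrK mulrCA mulVf ?mulr1//.
Qed.

(** On a single cell this is u <= (d * exp (c |u|) - ln d) / c, a form of
    Young's inequality with a free parameter d, applied to the mean u of
    b - v; both sides are additive over the subcells. *)
Lemma cell_union_integral_le k Q A (v c d : R) : 0 < c -> 0 < d ->
  measurable A -> cell_union k Q A ->
  \int[mu]_(x in cell Q `&` A) (b x - v) <=
  c^-1 * (d * side Q.2 ^+ n * leaf_exp subcell cell_avg c k Q v
          - ln d * fine (mu (cell Q `&` A))).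
Proof.
move=> c0 d0 mA; elim: k Q => [|k IH] Q /= HA.
  case: HA => [QA|QA].
    have -> : cell Q `&` A = cell Q by apply/setIidPl.
    rewrite Rintegral_dev (mu_cell h0_gt0)/= ler_pdivlMl//.
    set u := cell_avg Q - v; rewrite -[leRHS](_ : side Q.2 ^+ n *
      (d * expR (c * `|u|) - ln d) = _); last by ring.
    rewrite mulrCA ler_pM2l//.
    have : 1 + (c * `|u| + ln d) <= expR (c * `|u| + ln d) by exact: expR_ge1Dx.
    rewrite expRD lnK ?posrE// (mulrC _ d).
    have : c * u <= c * `|u| by rewrite ler_pM2l// ler_norm.
    lra.
  have -> : cell Q `&` A = set0.
    by apply/seteqP; split=> // t [/QA].
  rewrite Rintegral_set0 measure0/= mulr0 subr0 mulr_ge0 ?invr_ge0 ?(ltW c0)//.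
  by rewrite !mulr_ge0 ?expR_ge0// ltW.
rewrite (Rintegral_subcells h0_gt0 mA (integrable_dev Q v)).
rewrite (mu_subcells h0_gt0 Q mA).
apply: le_trans (ler_sum _ (fun s _ => IH (subcell Q s) (HA s))) _.
rewrite /= -mulr_sumr ler_pM2l ?invr_gt0// sumrB -!mulr_sumr lerD2r.
rewrite sideS expr_div_n card_subcells natrX !mulrA.
by rewrite (mulrAC d).
Qed.

(** Both sides depend continuously on A for the measure of symmetric
    differences within Q, by absolute continuity of the integral, so that the
    bound for unions of cells extends to all measurable sets. *)
Lemma cell_integral_le Q A (v c d : R) : 0 < c -> 0 < d ->
  (forall k, leaf_exp subcell cell_avg c k Q v <= 6) ->
  measurable A ->
  \int[mu]_(x in cell Q `&` A) (b x - v) <=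
  c^-1 * (6 * d * side Q.2 ^+ n - ln d * fine (mu (cell Q `&` A))).
Proof.
move=> c0 d0 S6 mA.
have mcell := measurable_cell h0 Q.
pose f := (fun x => b x - v) \_ (cell Q).
have intf : mu.-integrable setT (EFin \o f).
  have /(integrable_mkcond (fun x => (b x - v)%:E) mcell) := integrable_dev Q v.
  by rewrite restrict_EFin.
have fE B : B `<=` cell Q ->
    \int[mu]_(x in B) f x = \int[mu]_(x in B) (b x - v).
  by move=> BQ; apply: eq_Rintegral => x /set_mem/BQ Qx; rewrite /f patchT ?inE.
apply/ler_addgt0Pr => e e0.
(* The approximation error is at most K times e / K: two integrals over the
   symmetric difference, and |ln d| / c times its measure. *)
pose K := 2 + `|ln d| / c.
have K0 : 0 < K by rewrite ltr_pwDl// divr_ge0 ?(ltW c0).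
have e'0 : 0 < e / K by rewrite divr_gt0.
have [r [r0 small]] := integral_normr_continuous intf e'0.
have m0 : 0 < Num.min r (e / K) by rewrite lt_min r0.
have [_ /(_ _ m0)[k [B [mB kB AB]]]] := cell_approximable_measurable h0_gt0 Q mA.
have mI C : measurable C -> measurable (cell Q `&` C) by exact: measurable_cellI.
have finI C : measurable C -> mu (cell Q `&` C) \is a fin_num.
  exact: mu_cellI_fin.
have msd := measurable_symdiff mA mB.
have symle C : measurable C -> C `<=` symdiff A B ->
    (mu (cell Q `&` C) < (Num.min r (e / K))%:E)%E.
  move=> mC CAB; apply: le_lt_trans AB; apply: le_measure; rewrite ?inE//.
  - exact: mI.
  - exact: mI.
  - exact: setIS.
have split_set (g : Rn[R]_n -> R) C D : measurable C -> measurable D ->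
    mu.-integrable (cell Q) (EFin \o g) ->
    \int[mu]_(x in cell Q `&` C) g x =
    \int[mu]_(x in cell Q `&` (C `&` D)) g x + \int[mu]_(x in cell Q `&` (C `\` D)) g x.
  move=> mC mD ig; rewrite -Rintegral_setU.
  - by rewrite -setIUr setUIDK.
  - by apply: mI; exact: measurableI.
  - by apply: mI; exact: measurableD.
  - rewrite -setIUr setUIDK; apply: integrableS ig => //; exact: mI.
  - by apply/disj_setPS => t [[_ [_ Dt]] [_ [_]]].
have bnd C : measurable C -> C `<=` symdiff A B ->
    `|\int[mu]_(x in cell Q `&` C) (b x - v)| <= e / K.
  move=> mC CAB; rewrite -fE; last exact: subIsetl.
  apply: le_trans (ltW (small _ (mI _ mC) _)).
    apply: le_normr_Rintegral; first exact: mI.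
    by apply: integrableS intf => //; exact: mI.
  apply: lt_le_trans (symle _ mC CAB) _.
  by rewrite lee_fin ge_min lexx.
have mAB : measurable (A `\` B) by exact: measurableD.
have mBA : measurable (B `\` A) by exact: measurableD.
have bndAB := bnd _ mAB (@subsetUl _ _ _).
have bndBA := bnd _ mBA (@subsetUr _ _ _).
have IA := split_set _ A B mA mB (integrable_dev Q v).
have IB := split_set _ B A mB mA (integrable_dev Q v).
rewrite (setIC B A) in IB.
have muA := split_set _ A B mA mB (integrable_cst_cell Q 1).
have muB := split_set _ B A mB mA (integrable_cst_cell Q 1).
rewrite (setIC B A) in muB.
rewrite !Rintegral_cst ?mul1r in muA; try by [exact: mI|apply: mI; exact: measurableI].
rewrite !Rintegral_cst ?mul1r in muB; try by [exact: mI|apply: mI; exact: measurableI].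
rewrite /= in muA muB.
have mu_small C : measurable C -> C `<=` symdiff A B ->
    0 <= fine (mu (cell Q `&` C)) <= e / K.
  move=> mC CAB; rewrite fine_ge0//= -lee_fin fineK ?finI//.
  apply: le_trans (ltW (symle _ mC CAB)) _.
  by rewrite lee_fin ge_min lexx orbT.
have /andP[muAB0 muAB] := mu_small _ mAB (@subsetUl _ _ _).
have /andP[muBA0 muBA] := mu_small _ mBA (@subsetUr _ _ _).
have IBle := cell_union_integral_le v c0 d0 mB kB.
have lnK : - ln d * fine (mu (cell Q `&` B)) <=
    - ln d * fine (mu (cell Q `&` A)) + `|ln d| * (e / K).
  rewrite -lerBlDl -mulrBr; apply: le_trans (ler_norm _) _.
  rewrite normrM normrN ler_wpM2l// muA muB opprD addrACA subrr add0r ler_norml.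
  move: muAB0 muAB muBA0 muBA; clear.
  move: (fine _) (fine _) => x y ? ? ? ?; apply/andP; split; lra.
have S6k := S6 k.
have dS : d * side Q.2 ^+ n * leaf_exp subcell cell_avg c k Q v <=
    6 * d * side Q.2 ^+ n.
  by rewrite -[leRHS]mulrA [leRHS]mulrC; apply: ler_wpM2l => //;
     exact: mulr_ge0 (ltW d0) (ltW (sn_gt0 _)).
have bound : c^-1 * (d * side Q.2 ^+ n * leaf_exp subcell cell_avg c k Q v -
     ln d * fine (mu (cell Q `&` B))) <=
   c^-1 * (6 * d * side Q.2 ^+ n - ln d * fine (mu (cell Q `&` A))) +
   `|ln d| / c * (e / K).
  rewrite (_ : `|ln d| / c * (e / K) = c^-1 * (`|ln d| * (e / K))); last by ring.
  rewrite -mulrDr ler_pM2l ?invr_gt0// -addrA; apply: lerD; first exact: dS.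
  by move: lnK; rewrite !mulNr.
have eK : 2 * (e / K) + `|ln d| / c * (e / K) = e.
  by rewrite -mulrDl -/K mulrC divfK ?gt_eqF.
rewrite -[X in _ <= _ + X]eK IA.
move: (le_trans IBle bound) bndAB bndBA; rewrite IB !ler_norml.
clear; move: (c^-1 * (_ - _)) (`|ln d| / c * (e / K)) (e / K).
move: (Rintegral _ (_ `&` (A `&` B)) _) (Rintegral _ (_ `&` (A `\` B)) _).
move: (Rintegral _ (_ `&` (B `\` A)) _) => x y z s t u ? /andP[? ?] /andP[? ?].
lra.
Qed.

End john_nirenberg.

Section john_nirenberg_sets.
Context {R : realType} {n : nat}.
Local Notation mu := (lebesgue_measure_n n : set Rn[R]_n -> \bar R).
Implicit Types (a : 'I_n -> R) (h : R) (b : Rn[R]_n -> R).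

Definition cube_avg b a h : R := (h ^+ n)^-1 * \int[mu]_(x in cube a h) b x.

(** Integrability is part of the definition because the real-valued integral
    of a non-integrable function is a default value. *)
Definition cube_bmo b (M : R) := forall a h, 0 < h ->
  mu.-integrable (cube a h) (EFin \o b) /\
  \int[mu]_(x in cube a h) `|b x - cube_avg b a h| <= M * h ^+ n.

Lemma mu_cube_lty a h : 0 < h -> (mu (cube a h) < +oo)%E.
Proof. by move=> h0; rewrite mu_cube ?ltry// ltW. Qed.

Lemma integrable_cst_cube a h (v : R) : 0 < h ->
  mu.-integrable (cube a h) (EFin \o (fun=> v)).
Proof.
move=> h0; apply: measurable_bounded_integrable => //; first exact: measurable_cube.
  exact: mu_cube_lty.
by exists `|v|; split; rewrite ?num_real// => x vx y _; rewrite ltW.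
Qed.

Lemma integrable_sub_cube b a h (v : R) : 0 < h ->
  mu.-integrable (cube a h) (EFin \o b) ->
  mu.-integrable (cube a h) (EFin \o (fun x => b x - v)).
Proof.
move=> h0 ib; have mQ := measurable_cube a h.
have := integrableB mQ ib (integrable_cst_cube a v h0).
exact: eq_integrable.
Qed.

Lemma cube_bmoN b M : cube_bmo b M -> cube_bmo (fun x => - b x) M.
Proof.
move=> bM a h h0; have [ib ob] := bM a h h0.
have -> : cube_avg (fun x => - b x) a h = - cube_avg b a h.
  rewrite /cube_avg -mulrN; congr (_ * _).
  under eq_Rintegral do rewrite -mulN1r.
  by rewrite RintegralZl ?mulN1r//; exact: measurable_cube.
split; last by under eq_Rintegral do rewrite -opprD normrN.
have := integrableN ib.
by apply: eq_integrable => //; exact: measurable_cube.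
Qed.

Lemma cube_bmoZ b M : 0 < M -> cube_bmo b M -> cube_bmo (fun x => M^-1 * b x) 1.
Proof.
move=> M0 bM a h h0; have [ib ob] := bM a h h0.
have -> : cube_avg (fun x => M^-1 * b x) a h = M^-1 * cube_avg b a h.
  by rewrite /cube_avg RintegralZl 1?mulrCA//; exact: measurable_cube.
have mQ := measurable_cube a h.
have Mi0 : 0 <= M^-1 by rewrite invr_ge0 ltW.
split.
  by have := integrableZl mQ M^-1 ib; apply: eq_integrable.
have iD : mu.-integrable (cube a h) (EFin \o (fun x => `|b x - cube_avg b a h|)).
  exact: integrable_norm (integrable_sub_cube _ h0 ib).
under eq_Rintegral do rewrite -mulrBr normrM (ger0_norm Mi0).
by rewrite RintegralZl// mul1r ler_pdivrMl.
Qed.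

Let C1 : R := #|{ffun 'I_n -> bool}|%:R + 2.
(* The largest rate that leaf_exp_le allows for a tree in which every node has
   2^n children. *)
Let c : R := ln (3 / 2) / C1.
Let C1_gt0 : 0 < C1. Proof. by rewrite ltr_wpDl. Qed.
Let c_gt0 : 0 < c.
Proof. by rewrite divr_gt0// ln_gt0//; lra. Qed.

(** The exponential moments of leaf_exp_avg, applied to the tree of dyadic
    subcubes of the cube. *)
Lemma normalized_oscillation_le b a h A (d : R) : cube_bmo b 1 ->
  0 < h -> 0 < d -> measurable A ->
  \int[mu]_(x in cube a h `&` A) (b x - cube_avg b a h) <=
  c^-1 * (6 * d * h ^+ n - ln d * fine (mu (cube a h `&` A))).
Proof.
move=> b1 h0 d0 mA; pose Q : ('I_n -> R) * nat := (a, 0%N).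
have ib (P : ('I_n -> R) * nat) : mu.-integrable (cell h P) (EFin \o b).
  by have [] := b1 P.1 _ (side_gt0 h0 P.2).
have ob (P : ('I_n -> R) * nat) : cell_dev h b P (cell_avg h b P) <= 1.
  have s0 := side_gt0 h0 P.2.
  rewrite /cell_dev ler_pdivrMl ?exprn_gt0// mulrC.
  by have [] := b1 P.1 _ s0.
have s0 : side h 0 = h by rewrite /side expr0 divr1.
have cC : expR (c * C1) <= 3 / 2 :> R.
  by rewrite /c divfK ?gt_eqF// lnK// posrE; lra.
have S6 k : leaf_exp (subcell h) (cell_avg h b) c k Q (cell_avg h b Q) <= 6.
  apply: (@leaf_exp_avg _ _ _ _ _ (cell_dev h b)) => //.
  - by rewrite card_subcells expn_gt0.
  - exact: cell_avg_dev.
  - exact: cell_dev_subcells.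
  - exact: ltW.
have := cell_integral_le h0 ib c_gt0 d0 S6 mA.
by rewrite /cell_avg /cell /= s0.
Qed.

(** John-Nirenberg inequality for subsets of a cube. With d equal to the
    density u of A in the cube, normalized_oscillation_le gives a multiple of
    |Q| * u * (1 - ln u), and u * ln u^-1 is at most a multiple of u^t when
    t < 1. The parts of A where b lies above and below its average are treated
    separately, replacing b by its opposite on the second one. *)
Lemma oscillation_le b M a h A (t : R) : 0 < M -> cube_bmo b M ->
  0 < h -> 0 < t < 1 -> measurable A ->
  \int[mu]_(x in cube a h `&` A) `|b x - cube_avg b a h| <=
  2 * (c^-1 * (6 + (1 - t)^-1)) * M * h ^+ n *
    (fine (mu (cube a h `&` A)) / h ^+ n) `^ t.
Proof.
move=> M0 bM h0 /andP[t0 t1] mA.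
have hn0 : 0 < h ^+ n by rewrite exprn_gt0.
have mQ := measurable_cube a h.
have [ib _] := bM a h h0.
set v := cube_avg b a h; set u := _ / h ^+ n.
have finQ B : measurable B -> mu (cube a h `&` B) \is a fin_num.
  move=> mB; rewrite ge0_fin_numE//; apply: (@le_lt_trans _ _ (mu (cube a h))).
    exact: measureIl.
  by rewrite mu_cube ?ltry// ltW.
have mu_mono B D : measurable B -> measurable D -> B `<=` D ->
    fine (mu (cube a h `&` B)) <= fine (mu (cube a h `&` D)).
  move=> mB mD BD; apply: fine_le; [exact: finQ|exact: finQ|].
  by apply: le_measure; rewrite ?inE; [exact: measurableI|exact: measurableI|exact: setIS].
have u0 : 0 <= u by rewrite divr_ge0 ?fine_ge0// ltW.
have u1 : u <= 1.
  rewrite ler_pdivrMr// mul1r; have := mu_mono _ _ mA measurableT (@subsetT _ _).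
  by rewrite setIT mu_cube// ltW.
have iD := integrable_sub_cube v h0 ib.
have mQI B : measurable B -> measurable (cube a h `&` B) by exact: measurableI.
have iDI B : measurable B -> mu.-integrable (cube a h `&` B) (EFin \o (fun x => b x - v)).
  by move=> mB; apply: integrableS iD => //; exact: mQI.
have [u_eq0|u_neq0] := eqVneq u 0.
  have QA0 : mu (cube a h `&` A) = 0%E.
    apply/eqP; rewrite -(fineK (finQ _ mA)) eqe; move/eqP: u_eq0.
    by rewrite /u mulf_eq0 invr_eq0 (gt_eqF hn0) orbF.
  rewrite /Rintegral null_set_integral//; last first.
  - exact: measurable_int (integrable_norm (iDI _ mA)).
  - exact: mQI.
  rewrite !mulr_ge0 ?powR_ge0 ?invr_ge0 ?(ltW c_gt0) ?(ltW M0) ?(ltW hn0)//.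
  by rewrite addr_ge0// invr_ge0; lra.
have u_gt0 : 0 < u by rewrite lt0r u_neq0.
have lnu : - ln u * u <= (1 - t)^-1 * u `^ t.
  have s0 : 0 < 1 - t by lra.
  rewrite ler_pdivlMl// mulrA; have up : 0 < u `^ (- (1 - t)) by rewrite powR_gt0.
  have := ltW (ln_sublinear up); rewrite ln_powR mulrN -mulNr => lnle.
  apply: (@le_trans _ _ (u `^ (- (1 - t)) * u)).
    by rewrite ler_wpM2r ?(ltW u_gt0)// mulrN -mulNr.
  rewrite -{2}[u]powRr1 ?(ltW u_gt0)// -powRD ?(gt_eqF u_gt0) ?implybT//.
  by rewrite opprB subrK.
have ut : u <= u `^ t.
  rewrite -{1}[u]powRr1 ?(ltW u_gt0)//; apply: ger_powR; last exact: ltW.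
  by rewrite u_gt0.
have uE : fine (mu (cube a h `&` A)) = u * h ^+ n by rewrite /u divfK ?gt_eqF.
have half b' B : cube_bmo b' M -> measurable B -> B `<=` A ->
    \int[mu]_(x in cube a h `&` B) (b' x - cube_avg b' a h) <=
    c^-1 * (6 + (1 - t)^-1) * M * h ^+ n * u `^ t.
  move=> b'M mB BA; have [ib' _] := b'M a h h0.
  have := normalized_oscillation_le a (cube_bmoZ M0 b'M) h0 u_gt0 mB.
  have -> : cube_avg (fun x => M^-1 * b' x) a h = M^-1 * cube_avg b' a h.
    by rewrite /cube_avg RintegralZl 1?mulrCA.
  under eq_Rintegral do rewrite -mulrBr.
  rewrite RintegralZl//; [|exact: mQI|]; last first.
    apply: (@integrableS _ _ _ _ (cube a h)) => //; first exact: mQI.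
    exact: integrable_sub_cube.
  rewrite ler_pdivrMl// => /le_trans; apply.
  have lnu0 : 0 <= - ln u by rewrite oppr_ge0 ln_le0.
  have mBu : - ln u * fine (mu (cube a h `&` B)) <= - ln u * u * h ^+ n.
    by rewrite -mulrA -uE ler_wpM2l// mu_mono.
  have -> : c^-1 * (6 + (1 - t)^-1) * M * h ^+ n * u `^ t =
      M * (c^-1 * (6 * u `^ t * h ^+ n + (1 - t)^-1 * u `^ t * h ^+ n)) by ring.
  rewrite ler_pM2l// ler_pM2l ?invr_gt0//.
  rewrite -mulNr; apply: lerD; last first.
    by apply: le_trans mBu _; apply: ler_wpM2r => //; exact: ltW.
  by apply: ler_wpM2r; [exact: ltW|rewrite ler_pM2l].
pose P := cube a h `&` [set x | v <= b x].
have mP : measurable P.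
  have /measurable_EFinP mb := measurable_int _ ib.
  have := mb mQ `[v, +oo[%classic (measurable_itv _).
  congr (measurable _); apply/seteqP; split=> x [Qx /=].
    by rewrite in_itv/= andbT.
  by move=> vb; split=> //=; rewrite in_itv/= andbT.
have mAP : measurable (A `&` P) by exact: measurableI.
have mAD : measurable (A `\` P) by exact: measurableD.
have QAE : cube a h `&` A = cube a h `&` (A `&` P) `|` cube a h `&` (A `\` P).
  by rewrite -setIUr setUIDK.
rewrite QAE Rintegral_setU; last 4 first.
- exact: mQI.
- exact: mQI.
- by rewrite -QAE; apply: integrable_norm; exact: iDI.
- by apply/disj_setPS => x [[_ [_ Px]] [_ [_]]].
have H1 := half _ _ bM mAP (@subIsetl _ _ _).
have H2 := half _ _ (cube_bmoN bM) mAD (@subDsetl _ _ _).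
have -> : \int[mu]_(x in cube a h `&` (A `&` P)) `|b x - v| =
    \int[mu]_(x in cube a h `&` (A `&` P)) (b x - cube_avg b a h).
  apply: eq_Rintegral => x /set_mem[_ [_ [_ /= vb]]].
  by rewrite ger0_norm// subr_ge0.
have -> : \int[mu]_(x in cube a h `&` (A `\` P)) `|b x - v| =
    \int[mu]_(x in cube a h `&` (A `\` P)) (- b x - cube_avg (fun x => - b x) a h).
  have avgN : cube_avg (fun x => - b x) a h = - v.
    rewrite /v /cube_avg -mulrN; congr (_ * _).
    under eq_Rintegral do rewrite -mulN1r.
    by rewrite RintegralZl ?mulN1r.
  apply: eq_Rintegral => x /set_mem[Qx [_ nPx]]; rewrite avgN.
  have bv : b x <= v.
    by rewrite leNgt; apply/negP => vb; apply: nPx; split=> //=; exact: ltW.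
  by rewrite ler0_norm ?subr_le0// opprB opprK addrC.
by rewrite -!mulrA mulr_natl mulr2n !mulrA; exact: lerD.
Qed.

End john_nirenberg_sets.

(** * The kernel of the commutator *)

Section kernel_measurability.
Context {R : realType} {n : nat}.
Local Notation T := (Rn[R]_n).
Local Notation mu := (lebesgue_measure_n n : set T -> \bar R).

Definition kern (b : T -> R) (alpha : R) (x y : T) : R :=
  `|b x - b y| / eucl_dist x y `^ (n%:R - alpha).

Lemma kern_ge0 b alpha x y : 0 <= kern b alpha x y.
Proof. by rewrite divr_ge0 ?powR_ge0. Qed.

Lemma eucl_dist_ge0 (x y : T) : 0 <= eucl_dist x y.
Proof. exact: sqrtr_ge0. Qed.

Lemma coordinate_le_eucl_dist (x y : T) i :
  `|tnth x i - tnth y i| <= eucl_dist x y.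
Proof.
rewrite -sqrtr_sqr ler_wsqrtr// (bigD1 i)//= lerDl sumr_ge0// => j _.
exact: sqr_ge0.
Qed.

Lemma eucl_dist_eq0 (x y : T) : eucl_dist x y = 0 -> x = y.
Proof.
move=> d0; apply: eq_from_tnth => i; apply/eqP; rewrite -subr_eq0 -normr_le0.
by rewrite -d0 coordinate_le_eucl_dist.
Qed.

Context {d : measure_display} {X : measurableType d}.

Lemma measurable_coordinate (g : X -> T) i : measurable_fun setT g ->
  measurable_fun setT (fun z => tnth (g z) i : R).
Proof.
move=> mg; exact: (measurableT_comp (@measurable_tnth _ (measurableTypeR R) n i) mg).
Qed.

Lemma measurable_eucl_dist (g1 g2 : X -> T) :
  measurable_fun setT g1 -> measurable_fun setT g2 ->
  measurable_fun setT (fun z => eucl_dist (g1 z) (g2 z)).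
Proof.
move=> m1 m2.
rewrite (_ : (fun _ => _) = (fun z => (\sum_(i < n)
   (tnth (g1 z) i - tnth (g2 z) i) ^+ 2) `^ 2^-1)); last first.
  apply/funext => z; rewrite powR12_sqrt// sumr_ge0// => i _; exact: sqr_ge0.
have ms : measurable_fun setT (fun z : X =>
    \sum_(i < n) (tnth (g1 z) i - tnth (g2 z) i) ^+ 2 : R).
  apply: measurable_sum => i; apply: measurable_funX; apply: measurable_funB;
    exact: measurable_coordinate.
exact: (measurableT_comp (measurable_powR 2^-1) ms).
Qed.

Lemma measurable_eucl_dist_powRV (g1 g2 : X -> T) (s : R) :
  measurable_fun setT g1 -> measurable_fun setT g2 ->
  measurable_fun setT (fun z => (eucl_dist (g1 z) (g2 z) `^ s)^-1).
Proof.
move=> m1 m2; under eq_fun do rewrite -powRN.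
exact: (measurableT_comp (measurable_powR _) (measurable_eucl_dist m1 m2)).
Qed.

Lemma measurable_superlevel (f : X -> R) s : measurable_fun setT f ->
  measurable [set z | s <= f z].
Proof.
move=> mf; have := mf measurableT `[s, +oo[%classic (measurable_itv _).
rewrite setTI; congr (measurable _).
by apply/seteqP; split => z /=; rewrite in_itv/= andbT.
Qed.

Lemma measurable_kern (b : T -> R) alpha (g1 g2 : X -> T) :
  measurable_fun setT b ->
  measurable_fun setT g1 -> measurable_fun setT g2 ->
  measurable_fun setT (fun z => kern b alpha (g1 z) (g2 z)).
Proof.
move=> mb m1 m2; apply: measurable_funM.
  apply: (measurableT_comp (f := fun u : R => `|u|)) => //.
  by apply: measurable_funB; exact: measurableT_comp.
exact: measurable_eucl_dist_powRV.
Qed.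

Lemma measurable_indic_comp (A : set T) (g : X -> T) : measurable A ->
  measurable_fun setT g -> measurable_fun setT (fun z => \1_A (g z) : R).
Proof.
move=> mA mg; apply: (measurableT_comp (f := \1_A : T -> R)) => //.
Qed.

Lemma measurable_near (g1 g2 : X -> T) (r : R) :
  measurable_fun setT g1 -> measurable_fun setT g2 ->
  measurable [set z | forall i, `|tnth (g1 z) i - tnth (g2 z) i| < r].
Proof.
move=> m1 m2; rewrite [X in measurable X](_ : _ = \bigcap_(i in [set: 'I_n])
   [set z | `|tnth (g1 z) i - tnth (g2 z) i| < r]); last first.
  by apply/seteqP; split => z /= H i => [_|]; exact: H.
apply: fin_bigcap_measurable => // i _.
rewrite -[X in measurable X]setTI.
have mf : measurable_fun setT (fun z => `|tnth (g1 z) i - tnth (g2 z) i| : R).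
  apply: (measurableT_comp (f := fun u : R => `|u|)) => //.
  by apply: measurable_funB; exact: measurable_coordinate.
have := mf measurableT `]-oo, r[%classic (measurable_itv _).
by congr (measurable _).
Qed.

Definition centred_cube (r : R) (z : T) : set T :=
  cube (fun i => tnth z i - r) (2 * r).

Lemma centred_cubeP r z x : centred_cube r z x <->
  forall i, - r <= tnth x i - tnth z i < r.
Proof.
by split => H i; have /andP[] := H i => ? ?; apply/andP; split; lra.
Qed.

Lemma measurable_in_centred_cube (g1 g2 : X -> T) (r : R) :
  measurable_fun setT g1 -> measurable_fun setT g2 ->
  measurable [set z | centred_cube r (g1 z) (g2 z)].
Proof.
move=> m1 m2; rewrite [X in measurable X](_ : _ = \bigcap_(i in [set: 'I_n])
   [set z | - r <= tnth (g2 z) i - tnth (g1 z) i < r]); last first.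
  apply/seteqP; split => z /=; first by move=> /centred_cubeP H i _; exact: H.
  by move=> H; apply/centred_cubeP => i; exact: H.
apply: fin_bigcap_measurable => // i _.
rewrite -[X in measurable X]setTI.
have mf : measurable_fun setT (fun z => tnth (g2 z) i - tnth (g1 z) i : R).
  by apply: measurable_funB; exact: measurable_coordinate.
have := mf measurableT `[- r, r[%classic (measurable_itv _).
by congr (measurable _).
Qed.

End kernel_measurability.

(** * Oscillation over the pairs of points of a cube *)

Section pair_numeric.
Context {R : realType}.

Lemma powR_ge_self (u t : R) : 0 <= u <= 1 -> 0 < t <= 1 -> u <= u `^ t.
Proof.
move=> /andP[u0 u1] /andP[t0 t1].
have [->|un0] := eqVneq u 0; first by rewrite powR0// gt_eqF.
by apply: ger1_powR => //; rewrite lt0r un0 u0.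
Qed.

Lemma powR_anti (u s t : R) : 0 <= u <= 1 -> 0 < s -> s <= t -> u `^ t <= u `^ s.
Proof.
move=> /andP[u0 u1] s0 st.
have [->|un0] := eqVneq u 0.
  by rewrite !powR0// gt_eqF//; exact: lt_le_trans st.
by apply: ger_powR => //; rewrite lt0r un0 u0.
Qed.

Lemma weighted_amgm (x y a : R) : 0 <= x -> 0 <= y -> 0 < a < 1 ->
  x `^ a * y `^ (1 - a) <= a * x + (1 - a) * y.
Proof.
move=> x0 y0 /andP[a0 a1]; have a1' : 0 < 1 - a by lra.
have := @conjugate_powR R (x `^ a) (y `^ (1 - a)) a^-1 (1 - a)^-1.
rewrite !powR_ge0 !invr_gt0 a0 a1' !invrK addrC subrK -!powRrM.
rewrite !mulfV ?gt_eqF// !powRr1// (mulrC x) (mulrC y).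
by apply.
Qed.

(** Here u and v are the densities in a cube of volume Q of two sets of
    measures U and V. The weighted inequality of arithmetic and geometric
    means makes the bound linear in u and v, so that it can be integrated over
    the position of the cube; the part of the exponent t in excess of 1 - a,
    used on v <= V / Q, is kept as a decay for large cubes. *)
Lemma pair_numeric (u v U V Q a t : R) : 0 <= u <= 1 -> 0 <= v <= 1 ->
  0 < U -> 0 < V -> 0 < Q -> v <= V / Q -> 0 < a < 1 -> a <= t -> 1 - a < t ->
  t <= 1 ->
  u `^ t * v + v `^ t * u <= 2 * Num.min 1 (V / Q) `^ (t - 1 + a) *
    (U `^ a * V `^ (1 - a)) * (a * (u / U) + (1 - a) * (v / V)).
Proof.
move=> u01 v01 U0 V0 Q0 vVQ a01 at_ at' t1.
have /andP[u0 u1] := u01; have /andP[v0 v1] := v01; have /andP[a0 a1] := a01.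
have t0 : 0 < t by lra.
have t01 : 0 < t <= 1 by rewrite t0.
apply: (@le_trans _ _ (2 * (u `^ t * v `^ t))).
  have := powR_ge_self u01 t01; have := powR_ge_self v01 t01.
  have := powR_ge0 u t; have := powR_ge0 v t; nra.
rewrite -!mulrA ler_pM2l//.
have vt : v `^ t <= Num.min 1 (V / Q) `^ (t - 1 + a) * v `^ (1 - a).
  have -> : v `^ t = v `^ (t - 1 + a) * v `^ (1 - a).
    rewrite -powRD; last by rewrite (_ : _ == 0 = false)//; apply/eqP; lra.
    by congr (_ `^ _); ring.
  rewrite ler_wpM2r ?powR_ge0//; apply: ge0_ler_powR; rewrite ?nnegrE//.
  - by lra.
  - by rewrite le_min ler01 divr_ge0 ?ltW.
  - by rewrite le_min v1.
have ut : u `^ t <= u `^ a by exact: powR_anti.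
have am := weighted_amgm (divr_ge0 u0 (ltW U0)) (divr_ge0 v0 (ltW V0)) a01.
apply: (@le_trans _ _ (u `^ a * (Num.min 1 (V / Q) `^ (t - 1 + a) * v `^ (1 - a)))).
  by apply: ler_pM; rewrite ?powR_ge0.
rewrite mulrCA ler_wpM2l ?powR_ge0//.
have uE : u `^ a = U `^ a * (u / U) `^ a.
  by rewrite -powRM ?divr_ge0 ?(ltW U0)// mulrC divfK ?gt_eqF.
have vE : v `^ (1 - a) = V `^ (1 - a) * (v / V) `^ (1 - a).
  by rewrite -powRM ?divr_ge0 ?(ltW V0)// mulrC divfK ?gt_eqF.
rewrite uE vE.
have -> : U `^ a * (u / U) `^ a * (V `^ (1 - a) * (v / V) `^ (1 - a)) =
  U `^ a * (V `^ (1 - a) * ((u / U) `^ a * (v / V) `^ (1 - a))) by ring.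
by rewrite ler_wpM2l ?powR_ge0// ler_wpM2l ?powR_ge0.
Qed.

End pair_numeric.

Section indicator_integrals.
Context {d1 d2} {X : measurableType d1} {Y : measurableType d2} {R : realType}.
Local Open Scope ereal_scope.

Lemma integral_indic_mul (m : {measure set Y -> \bar R}) (A : set Y) (f : Y -> \bar R) :
  \int[m]_y ((\1_A y)%:E * f y) = \int[m]_(y in A) f y.
Proof.
rewrite [RHS]integral_mkcond; apply: eq_integral => y _.
by rewrite patchE indicE; case: (y \in A); rewrite ?mul1e ?mul0e.
Qed.

Lemma measurable_integral_section (m : {sigma_finite_measure set Y -> \bar R})
    (A : set Y) (f : X * Y -> \bar R) : measurable A ->
  measurable_fun setT f -> (forall z, 0 <= f z) ->
  measurable_fun setT (fun x => \int[m]_(y in A) f (x, y)).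
Proof.
move=> mA mf f0; under eq_fun do rewrite -integral_indic_mul.
apply: (measurable_fun_fubini_tonelli_F (fun z => (\1_A z.2)%:E * f z)).
  apply: emeasurable_funM => //; apply/measurable_EFinP.
  by apply: (measurableT_comp (f := \1_A : Y -> R)) => //; exact: measurable_indic.
by move=> z; rewrite mule_ge0// lee_fin.
Qed.

End indicator_integrals.

Section cube_pair.
Context {R : realType} {n : nat}.
Local Notation T := (Rn[R]_n).
Local Notation mu := (lebesgue_measure_n n : set T -> \bar R).
Implicit Types (a : 'I_n -> R) (h : R) (b : T -> R).

Definition density (A : set T) a h : R := fine (mu (cube a h `&` A)) / h ^+ n.

(** The constant of oscillation_le. *)
Definition jn_const (t : R) : R :=
  2 * ((ln (3 / 2) / (#|{ffun 'I_n -> bool}|%:R + 2))^-1 * (6 + (1 - t)^-1)).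

Lemma jn_const_ge0 t : t < 1 -> 0 <= jn_const t.
Proof.
move=> t1; apply: mulr_ge0 => //; apply: mulr_ge0; last first.
  by apply: addr_ge0 => //; rewrite invr_ge0; lra.
rewrite invr_ge0; apply: divr_ge0; last exact: addr_ge0.
by apply: ln_ge0; lra.
Qed.

Lemma oscillation_integral_lee b M a h A t : 0 < M -> cube_bmo b M ->
  0 < h -> 0 < t < 1 -> measurable A ->
  (\int[mu]_(x in cube a h `&` A) (`|b x - cube_avg b a h|)%:E <=
  (jn_const t * M * h ^+ n * (fine (mu (cube a h `&` A)) / h ^+ n) `^ t)%:E)%E.
Proof.
move=> M0 bM h0 t01 mA; have := oscillation_le a M0 bM h0 t01 mA.
rewrite -/(jn_const t) -lee_fin; apply: le_trans.
have [ib _] := bM a h h0.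
rewrite /Rintegral fineK//; apply: integrable_fin_num.
  by apply: measurableI => //; exact: measurable_cube.
apply: integrable_norm; apply: integrableS (integrable_sub_cube _ h0 ib) => //.
- exact: measurable_cube.
- by apply: measurableI => //; exact: measurable_cube.
Qed.

(** Compare b x and b y to the average of b on the cube: each of the two terms
    is an oscillation over one of the sets, times the measure of the other. *)
Lemma cube_pair_integral_le b M a h (G F : set T) t :
  measurable_fun setT b -> 0 < M -> cube_bmo b M ->
  0 < h -> 0 < t < 1 -> measurable G -> measurable F ->
  (\int[mu]_(x in cube a h `&` G) \int[mu]_(y in cube a h `&` F)
     (`|b x - b y|)%:E <=
   (jn_const t * M * h ^+ n * h ^+ n *
    (density G a h `^ t * density F a h + density F a h `^ t * density G a h))%:E)%E.
Proof.
move=> mb M0 bM h0 t01 mG mF; set u := density G a h; set v := density F a h.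
have hn0 : 0 < h ^+ n by rewrite exprn_gt0.
have mQ := measurable_cube a h.
have mQG : measurable (cube a h `&` G) by exact: measurableI.
have mQF : measurable (cube a h `&` F) by exact: measurableI.
set c := cube_avg b a h.
have fin A : measurable A -> mu (cube a h `&` A) = (h ^+ n * density A a h)%:E.
  move=> mA; rewrite /density mulrC divfK ?gt_eqF// fineK//.
  rewrite ge0_fin_numE//; apply: (@le_lt_trans _ _ (mu (cube a h))).
    exact: measureIl.
  exact: mu_cube_lty.
have mdev D : measurable_fun D (fun x => (`|b x - c|)%:E).
  apply/measurable_EFinP; apply: (measurableT_comp (f := fun u : R => `|u|)) => //.
  by apply: measurable_funB => //; exact: measurable_funTS.
pose KF := jn_const t * M * h ^+ n * v `^ t.
pose KG := jn_const t * M * h ^+ n * u `^ t.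
have bF : (\int[mu]_(x in cube a h `&` F) (`|b x - c|)%:E <= KF%:E)%E.
  exact: (oscillation_integral_lee a M0 bM h0 t01 mF).
have bG : (\int[mu]_(x in cube a h `&` G) (`|b x - c|)%:E <= KG%:E)%E.
  exact: (oscillation_integral_lee a M0 bM h0 t01 mG).
have KF0 : 0 <= KF.
  have j0 : 0 <= jn_const t by apply: jn_const_ge0; case/andP: t01.
  exact: mulr_ge0 (mulr_ge0 (mulr_ge0 j0 (ltW M0)) (ltW hn0)) (powR_ge0 _ _).
have v0 : 0 <= v by rewrite divr_ge0 ?fine_ge0 ?(ltW hn0).
have inner x : (\int[mu]_(y in cube a h `&` F) (`|b x - b y|)%:E <=
    (h ^+ n * v)%:E * (`|b x - c|)%:E + KF%:E)%E.
  apply: (@le_trans _ _ (\int[mu]_(y in cube a h `&` F)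
      ((`|b x - c|)%:E + (`|b y - c|)%:E))%E).
    apply: ge0_le_integral => //.
    - apply/measurable_EFinP; apply: (measurableT_comp (f := fun u : R => `|u|)) => //.
      by apply: measurable_funB => //; exact: measurable_funTS.
    - by apply: emeasurable_funD => //; exact: measurable_cst.
    - by move=> y _; rewrite -EFinD lee_fin (distrC (b y)); exact: ler_distD.
  rewrite (ge0_integralD _ mQF)//.
  rewrite integral_cst// muleC [X in (X * _)%E](fin _ mF).
  exact: leeD.
apply: (@le_trans _ _ (\int[mu]_(x in cube a h `&` G)
    ((h ^+ n * v)%:E * (`|b x - c|)%:E + KF%:E))%E).
  apply: ge0_le_integral => //.
  - by move=> x _; apply: integral_ge0 => y _; rewrite lee_fin.
  - apply: measurable_funTS.
    apply: (@measurable_integral_section _ _ T T R (lebesgue_measure_n n) _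
      (fun z => (`|b z.1 - b z.2|)%:E)) => //.
    apply/measurable_EFinP; apply: (measurableT_comp (f := fun u : R => `|u|)) => //.
    by apply: measurable_funB; exact: measurableT_comp.
  - apply: emeasurable_funD; last exact: measurable_cst.
    by apply: emeasurable_funM => //; exact: measurable_cst.
have hv0 : (0 <= h ^+ n * v)%R by rewrite mulr_ge0// ltW.
have f10 x : (0 <= (h ^+ n * v)%:E * (`|b x - c|)%:E)%E.
  by rewrite mule_ge0// lee_fin.
have mf1 : measurable_fun (cube a h `&` G)
    (fun x => ((h ^+ n * v)%:E * (`|b x - c|)%:E)%E).
  by apply: emeasurable_funM => //; exact: measurable_cst.
rewrite (ge0_integralD _ mQG)//.
rewrite (ge0_integralZl_EFin _ mQG)// integral_cst// [X in (_ + _ * X)%E](fin _ mG).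
have -> : (jn_const t * M * h ^+ n * h ^+ n * (u `^ t * v + v `^ t * u))%:E =
    ((h ^+ n * v)%:E * KG%:E + KF%:E * (h ^+ n * u)%:E)%E.
  by rewrite -!EFinM -EFinD /KG /KF; congr EFin; ring.
by rewrite leeD2r// lee_wpmul2l.
Qed.

End cube_pair.

(** * Pairs of points at one scale *)

Section scale_bound.
Context {R : realType} {n : nat}.
Local Notation T := (Rn[R]_n).
Local Notation mu := (lebesgue_measure_n n : set T -> \bar R).
Local Open Scope ereal_scope.

Definition near (r : R) (x y : T) : Prop :=
  forall i, (`|tnth x i - tnth y i| < r)%R.

Lemma mu_centred_cube (r : R) z : (0 <= r)%R ->
  mu (centred_cube r z) = ((2 * r) ^+ n)%:E.
Proof. by move=> r0; rewrite mu_cube// mulr_ge0. Qed.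

(** If z is within r of x, the cube of side 4 r centred at z contains x and
    y. *)
Lemma near_common_cubes_mass (r : R) x y : (0 < r)%R -> near r x y ->
  ((2 * r) ^+ n)%:E <=
  mu [set z | centred_cube (2 * r) z x /\ centred_cube (2 * r) z y].
Proof.
move=> r0 xy; rewrite -(mu_centred_cube x (ltW r0)); apply: le_measure; rewrite ?inE.
- exact: measurable_cube.
- rewrite (_ : mkset _ = [set z | centred_cube (2 * r) z x] `&`
     [set z | centred_cube (2 * r) z y])//.
  by apply: measurableI; apply: measurable_in_centred_cube => //; exact: measurable_cst.
- move=> z /centred_cubeP zx; split; apply/centred_cubeP => i.
    by have /andP[] := zx i => ? ?; apply/andP; split; lra.
  have /andP[] := zx i; have := xy i; rewrite ltr_norml => /andP[? ?] ? ?.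
  by apply/andP; split; lra.
Qed.

(** The centres of the cubes that contain x form the reflected cube, half-open
    on the other side; enlarging it avoids a separate treatment of the
    boundary. *)
Lemma cubes_around_mass (r : R) x : (0 < r)%R ->
  mu [set z | centred_cube (2 * r) z x] <= ((6 * r) ^+ n)%:E.
Proof.
move=> r0; have -> : (6 * r = 2 * (3 * r))%R by ring.
rewrite -(mu_centred_cube x); last by rewrite mulr_ge0// ltW.
apply: le_measure; rewrite ?inE.
- by apply: measurable_in_centred_cube => //; exact: measurable_cst.
- exact: measurable_cube.
- move=> z /centred_cubeP zx; apply/centred_cubeP => i.
  by have /andP[] := zx i => ? ?; apply/andP; split; lra.
Qed.

Lemma integral_cube_mass_le (r : R) G : (0 < r)%R -> measurable G ->
  \int[mu]_z mu (centred_cube (2 * r) z `&` G) <= ((6 * r) ^+ n)%:E * mu G.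
Proof.
move=> r0 mG.
pose E := [set p : T * T | centred_cube (2 * r) p.1 p.2].
have mE : measurable E.
  by apply: measurable_in_centred_cube; [exact: measurable_fst|exact: measurable_snd].
pose f (p : T * T) : \bar R := (\1_G p.2 * \1_E p)%:E.
have mf : measurable_fun setT f.
  apply/measurable_EFinP; apply: measurable_funM.
    by apply: measurable_indic_comp => //; exact: measurable_snd.
  exact: measurable_indic.
have f0 p : 0 <= f p by rewrite lee_fin mulr_ge0.
have -> : \int[mu]_z mu (centred_cube (2 * r) z `&` G) =
    \int[mu]_z \int[mu]_x f (z, x).
  apply: eq_integral => z _.
  transitivity (\int[mu]_x (\1_(centred_cube (2 * r) z `&` G) x)%:E).
    by rewrite integral_indic ?setIT//; apply: measurableI => //; exact: measurable_cube.
  by apply: eq_integral => x _; rewrite /f indicI/= mulrC.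
rewrite (fubini_tonelli f)//.
apply: (@le_trans _ _ (\int[mu]_x (((6 * r) ^+ n)%:E * (\1_G x)%:E))).
  apply: ge0_le_integral => //.
  - by move=> x _; apply: integral_ge0.
  - exact: measurable_fun_fubini_tonelli_G.
  - by apply: emeasurable_funM;
       [exact: measurable_cst|apply/measurable_EFinP; exact: measurable_indic].
  - move=> x _.
    have m1 : measurable [set z | centred_cube (2 * r) z x].
      by apply: measurable_in_centred_cube => //; exact: measurable_cst.
    have -> : \int[mu]_z f (z, x) = (\1_G x)%:E * mu [set z | centred_cube (2 * r) z x].
      rewrite -[X in _ * mu X]setIT -integral_indic// -ge0_integralZl_EFin//.
      + by apply/measurable_EFinP; exact: measurable_indic.
    rewrite muleC lee_wpmul2r ?lee_fin//; exact: cubes_around_mass.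
rewrite ge0_integralZl_EFin//.
- by rewrite integral_indic ?setIT.
- by apply/measurable_EFinP; exact: measurable_indic.
- by rewrite exprn_ge0// mulr_ge0// ltW.
Qed.

Definition pair_const (M a t r U V : R) : R :=
  (2 * jn_const (n := n) t * M * (2 * (2 * r)) ^+ n *
    Num.min 1 (V / (2 * (2 * r)) ^+ n) `^ (t - 1 + a) * (U `^ a * V `^ (1 - a)))%R.

Lemma cubes_integral_le b M a t r (G F : set T) (U V : R) z :
  measurable_fun setT b -> (0 < M)%R -> cube_bmo b M ->
  (0 < a < 1)%R -> (a <= t)%R -> (1 - a < t)%R -> (t < 1)%R -> (0 < r)%R ->
  measurable G -> measurable F -> mu G = U%:E -> mu F = V%:E ->
  (0 < U)%R -> (0 < V)%R ->
  \int[mu]_(x in centred_cube (2 * r) z `&` G)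
    \int[mu]_(y in centred_cube (2 * r) z `&` F) (`|b x - b y|)%:E <=
  (pair_const M a t r U V * (a / U))%:E * mu (centred_cube (2 * r) z `&` G) +
  (pair_const M a t r U V * ((1 - a) / V))%:E * mu (centred_cube (2 * r) z `&` F).
Proof.
move=> mb M0 bM a01 at_ at' t1 r0 mG mF GU FV U0 V0; pose h : R := (2 * (2 * r))%R.
have h0 : (0 < h)%R by rewrite !mulr_gt0.
have hn0 : (0 < h ^+ n)%R by rewrite exprn_gt0.
have t01 : (0 < t < 1)%R by apply/andP; split; lra.
set c := (fun i => tnth z i - 2 * r)%R.
apply: le_trans (cube_pair_integral_le c mb M0 bM h0 t01 mG mF) _.
have fin A W : measurable A -> mu A = W%:E ->
    mu (cube c h `&` A) = (h ^+ n * density A c h)%:E /\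
    (0 <= density A c h <= 1)%R /\ (density A c h <= W / h ^+ n)%R.
  move=> mA AW; have mQ := measurable_cube c h.
  have mQA : measurable (cube c h `&` A) by exact: measurableI.
  have leQ : mu (cube c h `&` A) <= (h ^+ n)%:E.
    by rewrite -(mu_cube c (ltW h0)); exact: measureIl.
  have leA : mu (cube c h `&` A) <= W%:E by rewrite -AW; exact: measureIr.
  have fQ : mu (cube c h `&` A) \is a fin_num.
    by rewrite ge0_fin_numE// (le_lt_trans leQ)// ltry.
  rewrite /density mulrC divfK ?gt_eqF// fineK//; split=> //.
  rewrite divr_ge0 ?fine_ge0 ?(ltW hn0)//= ler_pdivrMr// mul1r.
  rewrite ler_pM2r ?invr_gt0//.
  by rewrite -!lee_fin fineK.
have [-> [u01 _]] := fin _ _ mG GU; have [-> [v01 vV]] := fin _ _ mF FV.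
rewrite -!EFinM -EFinD lee_fin.
have := pair_numeric u01 v01 U0 V0 hn0 vV a01 at_ at' (ltW t1).
have J0 : (0 <= jn_const (n := n) t * M * h ^+ n * h ^+ n)%R.
  exact: mulr_ge0 (mulr_ge0 (mulr_ge0 (jn_const_ge0 t1) (ltW M0)) (ltW hn0)) (ltW hn0).
move=> /(ler_wpM2l J0)/le_trans; apply; rewrite le_eqVlt; apply/predU1P; left.
by rewrite /pair_const -/h; ring.
Qed.

Lemma pair_const_ge0 M a t r U V : (0 < M)%R -> (t < 1)%R -> (0 < r)%R ->
  (0 <= pair_const M a t r U V)%R.
Proof.
move=> M0 t1 r0; have J0 := jn_const_ge0 (n := n) t1.
have h0 : (0 <= 2 * (2 * r))%R by lra.
have hn0 : (0 <= (2 * (2 * r)) ^+ n)%R by exact: exprn_ge0.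
apply: mulr_ge0; last by rewrite mulr_ge0 ?powR_ge0.
apply: mulr_ge0; last exact: powR_ge0.
exact: (mulr_ge0 (mulr_ge0 (mulr_ge0 (ler0n R 2) J0) (ltW M0)) hn0).
Qed.

(** The factors (6 r)^n, from the measure of the set of centres, (4 r)^n, from
    the volume of the cubes, and (2 r)^-n, from near_common_cubes_mass,
    combine into (12 r)^n. *)
Lemma pair_const_rescale M a t r U V (I : \bar R) : (0 < r)%R ->
  ((2 * r) ^+ n)%:E * I <= ((6 * r) ^+ n * pair_const M a t r U V)%:E ->
  I <= (2 * jn_const (n := n) t * M * (12 * r) ^+ n *
    Num.min 1 (V / (4 * r) ^+ n) `^ (t - 1 + a) * (U `^ a * V `^ (1 - a)))%:E.
Proof.
move=> r0; have rn0 : (0 < (2 * r) ^+ n)%R by rewrite exprn_gt0// mulr_gt0.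
rewrite muleC -lee_pdivlMr// -EFinM => /le_trans; apply.
rewrite lee_fin /pair_const.
have -> : (2 * (2 * r) = 4 * r)%R by ring.
have -> : (6 * r = 3 * (2 * r))%R by ring.
have -> : (12 * r = 3 * (4 * r))%R by ring.
rewrite ![((3 * _) ^+ n)%R]exprMn le_eqVlt; apply/predU1P; left.
move: rn0; set q := ((2 * r) ^+ n)%R => q0; clearbody q.
by field; rewrite gt_eqF.
Qed.

Lemma measurable_cube_mass (r : R) G : measurable G ->
  measurable_fun setT (fun z => mu (centred_cube r z `&` G)).
Proof.
move=> mG.
have := @measurable_integral_section _ _ T T R (lebesgue_measure_n n) G
  (fun p => (\1_[set p : T * T | centred_cube r p.1 p.2] p)%:E) mG.
have mE : measurable [set p : T * T | centred_cube r p.1 p.2].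
  by apply: measurable_in_centred_cube; [exact: measurable_fst|exact: measurable_snd].
move=> H; have {H} := H _ _.
rewrite (_ : (fun x : T => _) = (fun z => mu (centred_cube r z `&` G))); last first.
  apply/funext => z; transitivity (\int[mu]_(x in G) (\1_(centred_cube r z) x)%:E) => //.
  by rewrite integral_indic//; exact: measurable_cube.
apply; last by move=> z; rewrite lee_fin.
by apply/measurable_EFinP; exact: measurable_indic.
Qed.

Lemma integral_two_masses_le (r k1 k2 U V : R) G F : (0 < r)%R ->
  (0 <= k1)%R -> (0 <= k2)%R -> measurable G -> measurable F ->
  mu G = U%:E -> mu F = V%:E ->
  \int[mu]_z (k1%:E * mu (centred_cube (2 * r) z `&` G) +
              k2%:E * mu (centred_cube (2 * r) z `&` F)) <=
  ((6 * r) ^+ n * (k1 * U + k2 * V))%:E.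
Proof.
move=> r0 k10 k20 mG mF GU FV.
have mk k A : measurable A ->
    measurable_fun setT (fun z => k%:E * mu (centred_cube (2 * r) z `&` A)).
  move=> mA; apply: emeasurable_funM; first exact: measurable_cst.
  exact: measurable_cube_mass.
rewrite ge0_integralD//; last 4 first.
- by move=> z _; rewrite mule_ge0.
- exact: mk.
- by move=> z _; rewrite mule_ge0.
- exact: mk.
rewrite !ge0_integralZl_EFin//; [|exact: measurable_cube_mass|exact: measurable_cube_mass].
rewrite mulrDr EFinD mulrCA (mulrCA _ k2) !(EFinM k1) !(EFinM k2); apply: leeD.
  by apply: lee_wpmul2l; rewrite ?lee_fin// EFinM -GU; exact: integral_cube_mass_le.
by apply: lee_wpmul2l; rewrite ?lee_fin// EFinM -FV; exact: integral_cube_mass_le.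
Qed.

Lemma integral_cube_pairs (r : R) (v : T -> T -> R) G F z :
  measurable G -> measurable F -> (forall x y, (0 <= v x y)%R) ->
  (forall x, measurable_fun setT (v x)) ->
  \int[mu]_x \int[mu]_y (\1_G x * \1_F y * v x y *
     (\1_[set p : T * T | centred_cube r p.1 p.2] (z, x) *
      \1_[set p : T * T | centred_cube r p.1 p.2] (z, y)))%:E =
  \int[mu]_(x in centred_cube r z `&` G)
    \int[mu]_(y in centred_cube r z `&` F) (v x y)%:E.
Proof.
move=> mG mF v0 mv; rewrite -[RHS]integral_indic_mul; apply: eq_integral => x _.
have mQF : measurable (centred_cube r z `&` F).
  by apply: measurableI => //; exact: measurable_cube.
rewrite -[X in _ = _ * X]integral_indic_mul -ge0_integralZl_EFin//.
- apply: eq_integral => y _; rewrite -!EFinM !indicI /=; congr EFin.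
  rewrite (_ : \1_[set p | centred_cube r p.1 p.2] (z, x) = \1_(centred_cube r z) x :> R)//.
  rewrite (_ : \1_[set p | centred_cube r p.1 p.2] (z, y) = \1_(centred_cube r z) y :> R)//.
  by ring.
- by move=> y _; rewrite -EFinM lee_fin mulr_ge0.
- by apply: emeasurable_funM; apply/measurable_EFinP => //; exact: measurable_indic.
Qed.

(** Two points at distance less than r lie in a common cube of side 4 r, for a
    set of centres of measure at least (2 r)^n. The estimate on a single cube,
    integrated over its centre, therefore controls all these pairs; its
    right-hand side is linear in the masses of G and F in the cube, so
    Tonelli's theorem evaluates its integral. *)
Lemma scale_bound b M a t r (G F : set T) (U V : R) :
  measurable_fun setT b -> (0 < M)%R -> cube_bmo b M ->
  (0 < a < 1)%R -> (a <= t)%R -> (1 - a < t)%R -> (t < 1)%R -> (0 < r)%R ->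
  measurable G -> measurable F -> mu G = U%:E -> mu F = V%:E ->
  (0 < U)%R -> (0 < V)%R ->
  \int[mu]_x \int[mu]_y (\1_G x * \1_F y *
     (\1_[set p | near r p.1 p.2] (x, y) * `|b x - b y|))%:E <=
  (2 * jn_const (n := n) t * M * (12 * r) ^+ n *
    Num.min 1 (V / (4 * r) ^+ n) `^ (t - 1 + a) * (U `^ a * V `^ (1 - a)))%:E.
Proof.
move=> mb M0 bM a01 at_ at' t1 r0 mG mF GU FV U0 V0.
pose w x y : R := (\1_G x * \1_F y * `|b x - b y|)%R.
pose E := [set p : T * T | centred_cube (2 * r) p.1 p.2].
pose D := [set p : T * T | near r p.1 p.2].
have mE : measurable E.
  by apply: measurable_in_centred_cube; [exact: measurable_fst|exact: measurable_snd].
have mD : measurable D.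
  by apply: measurable_near; [exact: measurable_fst|exact: measurable_snd].
have w0 x y : (0 <= w x y)%R by rewrite !mulr_ge0.
have mw d (X : measurableType d) (g1 g2 : X -> T) : measurable_fun setT g1 ->
    measurable_fun setT g2 -> measurable_fun setT (fun q => w (g1 q) (g2 q)).
  move=> m1 m2; apply: measurable_funM.
    by apply: measurable_funM; exact: measurable_indic_comp.
  apply: (measurableT_comp (f := fun u : R => `|u|)%R) => //.
  by apply: measurable_funB; exact: measurableT_comp.
pose g x y z : \bar R := (w x y * (\1_E (z, x) * \1_E (z, y)))%:E.
have g0 x y z : 0 <= g x y z by rewrite lee_fin mulr_ge0.
have mg d (X : measurableType d) (g1 g2 g3 : X -> T) : measurable_fun setT g1 ->
    measurable_fun setT g2 -> measurable_fun setT g3 ->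
    measurable_fun setT (fun q => g (g1 q) (g2 q) (g3 q)).
  move=> m1 m2 m3; apply/measurable_EFinP; apply: measurable_funM; first exact: mw.
  apply: measurable_funM;
    apply: (measurableT_comp (f := \1_E : T * T -> R)) => //;
    try exact: measurable_indic; exact: measurable_fun_pair.
have mf1 : measurable_fun setT (fst : T * T -> T) by exact: measurable_fst.
have mf2 : measurable_fun setT (snd : T * T -> T) by exact: measurable_snd.
have m11 : measurable_fun setT (fun q : (T * T) * T => q.1.1).
  exact: measurableT_comp measurable_fst.
have m12 : measurable_fun setT (fun q : (T * T) * T => q.1.2).
  exact: measurableT_comp measurable_fst.
pose I := \int[mu]_x \int[mu]_y (w x y * \1_D (x, y))%:E.
have -> : \int[mu]_x \int[mu]_y (\1_G x * \1_F y *
     (\1_[set p | near r p.1 p.2] (x, y) * `|b x - b y|))%:E = I.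
  apply: eq_integral => x _; apply: eq_integral => y _; congr EFin.
  by rewrite /w -/D; ring.
have mI : measurable_fun setT (fun p : T * T => (w p.1 p.2 * \1_D p)%:E).
  apply/measurable_EFinP; apply: measurable_funM; first exact: mw.
  exact: measurable_indic.
have step1 : ((2 * r) ^+ n)%:E * I <= \int[mu]_x \int[mu]_y \int[mu]_z g x y z.
  have rn0 : (0 <= (2 * r) ^+ n)%R by rewrite exprn_ge0// mulr_ge0// ltW.
  pose P : set (T * T) -> \bar R := product_measure1 mu mu.
  pose H2 (p : T * T) := \int[mu]_z g p.1 p.2 z.
  have mH2 : measurable_fun setT H2.
    apply: (measurable_fun_fubini_tonelli_F
      (fun q : (T * T) * T => g q.1.1 q.1.2 q.2)) => //.
    by apply: mg => //; exact: measurable_snd.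
  have H20 p : 0 <= H2 p by apply: integral_ge0.
  have -> : \int[mu]_x \int[mu]_y \int[mu]_z g x y z = \int[P]_p H2 p.
    by rewrite (fubini_tonelli1 H2).
  have -> : I = \int[P]_p (w p.1 p.2 * \1_D p)%:E.
    rewrite (fubini_tonelli1 (fun p : T * T => (w p.1 p.2 * \1_D p)%:E))//.
    by move=> p; rewrite lee_fin mulr_ge0.
  rewrite -ge0_integralZl_EFin//; last first.
    by move=> p _; rewrite lee_fin mulr_ge0.
  apply: ge0_le_integral => //.
  - by move=> p _; rewrite mule_ge0// lee_fin// mulr_ge0.
  - by apply: emeasurable_funM => //; exact: measurable_cst.
  move=> [x y] _.
  have mS : measurable [set z | centred_cube (2 * r) z x /\ centred_cube (2 * r) z y].
    rewrite (_ : mkset _ = [set z | centred_cube (2 * r) z x] `&`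
       [set z | centred_cube (2 * r) z y])//.
    by apply: measurableI; apply: measurable_in_centred_cube => //; exact: measurable_cst.
  have -> : H2 (x, y) = (w x y)%:E *
      mu [set z | centred_cube (2 * r) z x /\ centred_cube (2 * r) z y].
    rewrite -[X in _ * mu X]setIT -integral_indic// -ge0_integralZl_EFin//.
    - apply: eq_integral => z _; rewrite /g EFinM; congr (_ * _%:E).
      rewrite (_ : mkset _ = [set z | centred_cube (2 * r) z x] `&`
        [set z | centred_cube (2 * r) z y])//.
      by rewrite indicI.
    - by apply/measurable_EFinP; exact: measurable_indic.
  rewrite EFinM muleCA lee_wpmul2l ?lee_fin//.
  have [xy|nxy] := pselect (near r x y).
    by rewrite indicE mem_set// mule1; exact: near_common_cubes_mass.
  by rewrite indicE memNset// mule0.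
have swap : \int[mu]_x \int[mu]_y \int[mu]_z g x y z =
    \int[mu]_z \int[mu]_x \int[mu]_y g x y z.
  transitivity (\int[mu]_x \int[mu]_z \int[mu]_y g x y z).
    apply: eq_integral => x _.
    apply: (fubini_tonelli (fun p : T * T => g x p.1 p.2)) => //.
    by apply: mg => //; exact: measurable_cst.
  apply: (fubini_tonelli (fun p : T * T => \int[mu]_y g p.1 y p.2)).
    apply: (measurable_fun_fubini_tonelli_F
      (fun q : (T * T) * T => g q.1.1 q.2 q.1.2)) => //.
    by apply: mg => //; exact: measurable_snd.
  by move=> p; apply: integral_ge0.
have J0 z : \int[mu]_x \int[mu]_y g x y z =
    \int[mu]_(x in centred_cube (2 * r) z `&` G)
      \int[mu]_(y in centred_cube (2 * r) z `&` F) (`|b x - b y|)%:E.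
  have mv x : measurable_fun setT (fun y => `|b x - b y|)%R.
    apply: (measurableT_comp (f := fun u : R => `|u|)%R); first exact: normr_measurable.
    by apply: measurable_funB; [exact: measurable_cst|exact: mb].
  exact: (integral_cube_pairs (2 * r) z mG mF (fun x y => normr_ge0 (b x - b y)%R) mv).
have K0 := pair_const_ge0 a U V M0 t1 r0.
have a0 : (0 <= a / U)%R by case/andP: a01 => a0 _; exact: divr_ge0 (ltW a0) (ltW U0).
have a1 : (0 <= (1 - a) / V)%R.
  by case/andP: a01 => _ a1; apply: divr_ge0; [rewrite subr_ge0|]; exact: ltW.
have step2 : \int[mu]_z \int[mu]_x \int[mu]_y g x y z <=
    ((6 * r) ^+ n * pair_const M a t r U V)%:E.
  set K := pair_const M a t r U V in K0 *.
  have -> : ((6 * r) ^+ n * K = (6 * r) ^+ n *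
      (K * (a / U) * U + K * ((1 - a) / V) * V))%R.
    by congr (_ * _)%R; field; rewrite !gt_eqF.
  apply: le_trans (integral_two_masses_le r0 (mulr_ge0 K0 a0) (mulr_ge0 K0 a1) mG mF GU FV).
    apply: ge0_le_integral.
    - exact: measurableT.
    - by move=> z _; apply: integral_ge0 => x _; apply: integral_ge0 => y _; exact: g0.
    - apply: (measurable_fun_fubini_tonelli_F (fun p : T * T => \int[mu]_y g p.2 y p.1)).
        apply: (measurable_fun_fubini_tonelli_F
          (fun q : (T * T) * T => g q.1.2 q.2 q.1.1)); last by move=> q; exact: g0.
        by apply: mg; [exact: m12|exact: measurable_snd|exact: m11].
      by move=> p; apply: integral_ge0 => y _; exact: g0.
    - apply: emeasurable_funD; (apply: emeasurable_funM; first exact: measurable_cst);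
        exact: measurable_cube_mass.
    - move=> z _; rewrite J0.
      exact: (cubes_integral_le z mb M0 bM a01 at_ at' t1 r0 mG mF GU FV U0 V0).
rewrite swap in step1; exact: (pair_const_rescale r0 (le_trans step1 step2)).
Qed.

End scale_bound.

(** * Summation over scales and restricted bounds *)

Section exhaustion.
Context {d} {X : measurableType d} {R : realType}.
Local Open Scope ereal_scope.

Lemma integral_le_exhaustion (m : {measure set X -> \bar R}) (E : (set X)^nat)
    (f : X -> \bar R) (C : \bar R) :
  (forall N, measurable (E N)) -> nondecreasing_seq E ->
  \bigcup_N E N = setT -> measurable_fun setT f -> (forall x, 0 <= f x) ->
  (forall N, \int[m]_(x in E N) f x <= C) -> \int[m]_x f x <= C.
Proof.
move=> mE ndE ET mf f0 leC.
have cvg := @ge0_nondecreasing_set_cvg_integral _ _ _ E f m ndE mE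
  (fun i => measurable_funTS mf) (fun i x _ => f0 x).
rewrite ET in cvg; rewrite -(cvg_lim _ cvg)//; apply: lime_le.
  by apply/cvg_ex; exists (\int[m]_x f x).
by near=> N; exact: leC.
Unshelve. all: by end_near. Qed.

End exhaustion.

Section restricted_bound.
Context {R : realType} {n : nat}.
Local Notation T := (Rn[R]_n).
Local Notation mu := (lebesgue_measure_n n : set T -> \bar R).

(** The factor s^k is small for small s; for large s it is compensated by the
    exponent e > k of s^-1. *)
Lemma two_sided_decay (s k e d : R) : 0 < s -> 0 < d -> d <= k -> d <= e - k ->
  s `^ k * Num.min 1 s^-1 `^ e <= Num.min s s^-1 `^ d.
Proof.
move=> s0 d0 dk dek; have [s1|/ltW s1] := leP s 1.
  have sV : 1 <= s^-1 by rewrite invf_ge1.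
  have -> : Num.min 1 s^-1 = 1 by apply/min_idPl.
  have -> : Num.min s s^-1 = s by apply/min_idPl; exact: le_trans sV.
  by rewrite powR1 mulr1; apply: ger_powR => //; rewrite s0.
have sV : s^-1 <= 1 by rewrite invf_le1.
have -> : Num.min 1 s^-1 = s^-1 by apply/min_idPr.
have -> : Num.min s s^-1 = s^-1 by apply/min_idPr; exact: le_trans s1.
have -> : s `^ k * s^-1 `^ e = s^-1 `^ (e - k).
  have [x ->] : exists x, s = expR x by exists (ln s); rewrite lnK.
  by rewrite -!expRN -!expRM -expRD; congr expR; ring.
by apply: ger_powR => //; rewrite invr_gt0 s0.
Qed.

(** The pair (x, y) belongs to one dyadic shell r / 2 <= |x - y| < r, and
    there the singular factor is comparable to r^(alpha - n); the other terms
    of the sum are nonnegative. *)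
Lemma kern_le_shells b (alpha e : R) K (x y : T) : 0 < e -> alpha < n%:R ->
  e <= eucl_dist x y < e * 2 ^+ K ->
  kern b alpha x y <= \sum_(k < K) 2 `^ (n%:R - alpha) *
    (e * 2 ^+ k.+1) `^ (alpha - n%:R) *
    (\1_[set p | near (e * 2 ^+ k.+1) p.1 p.2] (x, y) * `|b x - b y|).
Proof.
move=> e0 an /andP[ed dK]; set d := eucl_dist x y in ed dK *.
have d0 : 0 < d by exact: lt_le_trans ed.
have two1 : 1 < 2 :> R by rewrite ltr1n.
have de1 : 1 <= d / e by rewrite ler_pdivlMr// mul1r.
have [k /andP[lo hi]] := exprn_bracket two1 de1.
have kK : (k < K)%N.
  rewrite -(@ltr_eXn2l R 2)//; apply: le_lt_trans lo _.
  by rewrite ltr_pdivrMr// mulrC.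
rewrite (bigD1 (Ordinal kK))//=.
set r := e * 2 ^+ k.+1.
have r0 : 0 < r by rewrite mulr_gt0// exprn_gt0.
have dr : d < r by rewrite /r mulrC -ltr_pdivrMr.
have rd : r <= 2 * d by rewrite /r exprS mulrCA ler_pM2l// mulrC -ler_pdivlMr.
have xyr : near r x y.
  by move=> i; apply: le_lt_trans dr; exact: coordinate_le_eucl_dist.
rewrite indicE mem_set// mul1r -[leLHS]addr0; apply: lerD; last first.
  by apply: sumr_ge0 => j _; rewrite !mulr_ge0 ?powR_ge0.
rewrite /kern -/d mulrC ler_wpM2r//.
have -> : alpha - n%:R = - (n%:R - alpha) by rewrite opprB.
rewrite powRN ler_pdivlMr ?powR_gt0// mulrC ler_pdivrMr ?powR_gt0//.
rewrite -powRM ?(ltW d0)//.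
by apply: ler_powR_base; rewrite ?subr_ge0 ?(ltW an) ?(ltW r0).
Qed.

(** In terms of s = (4 r)^n / V, the summand is a multiple of V^(alpha / n) *
    s^(alpha / n) * min (1, s^-1)^eps, which decays geometrically away from
    s = 1. *)
Lemma scales_sum_le (alpha e V eps : R) K : (0 < n)%N -> 0 < alpha ->
  alpha / n%:R < eps -> 0 < e -> 0 < V ->
  \sum_(k < K) (e * 2 ^+ k.+1) `^ alpha *
     Num.min 1 (V / (4 * (e * 2 ^+ k.+1)) ^+ n) `^ eps <=
  2 / (1 - 2^-1 `^ Num.min (alpha / n%:R) (eps - alpha / n%:R)) *
    V `^ (alpha / n%:R).
Proof.
move=> n0 al0 keps e0 V0; set k0 := alpha / n%:R; set d := Num.min _ _.
have nR0 : 0 < n%:R :> R by rewrite ltr0n.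
have k00 : 0 < k0 by rewrite divr_gt0.
have d0 : 0 < d by rewrite lt_min k00 subr_gt0.
pose s (k : nat) := (4 * (e * 2 ^+ k.+1)) ^+ n / V.
have r0 k : 0 < e * 2 ^+ k.+1 by rewrite mulr_gt0// exprn_gt0.
have s0 k : 0 < s k by rewrite divr_gt0// exprn_gt0// mulr_gt0.
rewrite mulrC -ler_pdivrMl ?powR_gt0// mulr_sumr.
apply: le_trans (@geometric_two_sided _ d s K d0 s0 _); last first.
  move=> k; rewrite /s mulrA ler_pM2r ?invr_gt0//.
  have -> : 4 * (e * 2 ^+ k.+2) = 2 * (4 * (e * 2 ^+ k.+1)) by rewrite [2 ^+ k.+2]exprS; ring.
  rewrite [leRHS]exprMn ler_pM2r; last by rewrite exprn_gt0// mulr_gt0.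
  by rewrite -[leLHS]expr1 ler_weXn2l// ler1n.
apply: ler_sum => k _; set r := e * _.
have := @two_sided_decay (s k) k0 eps d (s0 k) d0.
rewrite !ge_min !lexx orbT => /(_ isT isT); apply: le_trans.
rewrite mulrA /s invf_div ler_wpM2r ?powR_ge0//.
rewrite ler_pdivrMl ?powR_gt0// -powRM ?(ltW V0) ?(ltW (s0 k))//.
rewrite (mulrC V) divfK ?gt_eqF//.
have r40 : 0 <= 4 * r by rewrite mulr_ge0// ltW// r0.
have -> : ((4 * r) ^+ n) `^ k0 = (4 * r) `^ alpha.
  by rewrite -powR_mulrn// -powRrM /k0 (mulrCA n%:R) mulfV ?mulr1// gt_eqF.
apply: ler_powR_base; [exact: ltW|exact: ltW (r0 k)|].
by rewrite ler_peMl ?ler1n// ltW// r0.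
Qed.

End restricted_bound.

Section restricted_estimate.
Context {R : realType} {n : nat}.
Local Notation T := (Rn[R]_n).
Local Notation mu := (lebesgue_measure_n n : set T -> \bar R).
Local Notation P := (product_measure1 (lebesgue_measure_n n : set T -> \bar R)
  (lebesgue_measure_n n : set T -> \bar R)).

Definition restricted_const (M a t alpha : R) : R :=
  2 `^ (n%:R - alpha) * (2 * jn_const (n := n) t * M * 12 ^+ n) *
  (2 / (1 - 2^-1 `^ Num.min (alpha / n%:R) (t - 1 + a - alpha / n%:R))).

Lemma shell_integrals_sum_le b M a t alpha (G F : set T) (U V : R) (e : R) K :
  measurable_fun setT b -> 0 < M -> cube_bmo b M ->
  0 < alpha < n%:R -> 0 < a < 1 -> a <= t -> t < 1 ->
  alpha / n%:R < t - 1 + a -> 0 < e ->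
  measurable G -> measurable F -> mu G = U%:E -> mu F = V%:E ->
  0 < U -> 0 < V ->
  (\sum_(k < K) (2 `^ (n%:R - alpha) * (e * 2 ^+ k.+1) `^ (alpha - n%:R))%:E *
    (\int[mu]_x \int[mu]_y (\1_G x * \1_F y *
       (\1_[set p | near (e * 2 ^+ k.+1) p.1 p.2] (x, y) * `|b x - b y|))%:E) <=
  (restricted_const M a t alpha * (U `^ a * V `^ (1 - a) * V `^ (alpha / n%:R)))%:E)%E.
Proof.
move=> mb M0 bM /andP[al0 aln] a01 at_ t1 keps e0 mG mF GU FV U0 V0.
have nR0 : 0 < n%:R :> R by exact: lt_trans aln.
have n0 : (0 < n)%N by rewrite -(ltr0n R).
have at' : 1 - a < t.
  have : 0 < alpha / n%:R by rewrite divr_gt0.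
  by move: keps; lra.
set c := 2 `^ (n%:R - alpha); have c0 : 0 <= c by rewrite powR_ge0.
set D := 2 * jn_const (n := n) t * M.
have D0 : 0 <= D.
  exact: mulr_ge0 (mulr_ge0 (ler0n R 2) (jn_const_ge0 t1)) (ltW M0).
set W := U `^ a * V `^ (1 - a); have W0 : 0 <= W by rewrite mulr_ge0 ?powR_ge0.
have r0 k : 0 < e * 2 ^+ k.+1 by rewrite mulr_gt0// exprn_gt0.
apply: (@le_trans _ _ (\sum_(k < K) (c * (D * 12 ^+ n) * W *
  ((e * 2 ^+ k.+1) `^ alpha *
   Num.min 1 (V / (4 * (e * 2 ^+ k.+1)) ^+ n) `^ (t - 1 + a)))%:E)%E).
  apply: lee_sum => k _; set r := e * _.
  apply: le_trans (lee_wpmul2l _ (scale_bound mb M0 bM a01 at_ at' t1 (r0 k) mG mF GU FV U0 V0)) _.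
    by rewrite lee_fin mulr_ge0 ?powR_ge0.
  rewrite -EFinM lee_fin -/D -/W -/r le_eqVlt; apply/predU1P; left.
  have -> : r `^ alpha = r `^ (alpha - n%:R) * r ^+ n.
    by rewrite -powR_mulrn ?(ltW (r0 k))// -powRD ?subrK// (gt_eqF (r0 k)) implybT.
  by rewrite exprMn; ring.
rewrite sumEFin lee_fin -mulr_sumr.
have := @scales_sum_le R n alpha e V (t - 1 + a) K n0 al0 keps e0 V0.
have cDW0 : 0 <= c * (D * 12 ^+ n) * W.
  exact: mulr_ge0 (mulr_ge0 c0 (mulr_ge0 D0 (exprn_ge0 n (ler0n R 12)))) W0.
move=> /(ler_wpM2l cDW0)/le_trans; apply.
rewrite le_eqVlt; apply/predU1P; left; rewrite /restricted_const -/c -/D.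
by ring.
Qed.

(** The pairs whose distance is positive are exhausted by dyadic windows, in
    which the shells are finitely many; at distance 0 the kernel vanishes. *)
Lemma restricted_estimate_pos b M a t alpha (G F : set T) (U V : R) :
  measurable_fun setT b -> 0 < M -> cube_bmo b M ->
  0 < alpha < n%:R -> 0 < a < 1 -> a <= t -> t < 1 ->
  alpha / n%:R < t - 1 + a ->
  measurable G -> measurable F -> mu G = U%:E -> mu F = V%:E ->
  0 < U -> 0 < V ->
  (\int[mu]_x \int[mu]_y (\1_G x * \1_F y * kern b alpha x y)%:E <=
  (restricted_const M a t alpha * (U `^ a * V `^ (1 - a) * V `^ (alpha / n%:R)))%:E)%E.
Proof.
move=> mb M0 bM alP a01 at_ t1 keps mG mF GU FV U0 V0.
have mf1 : measurable_fun setT (fst : T * T -> T) by exact: measurable_fst.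
have mf2 : measurable_fun setT (snd : T * T -> T) by exact: measurable_snd.
have mGF : measurable_fun setT (fun p : T * T => \1_G p.1 * \1_F p.2 : R).
  by apply: measurable_funM; exact: measurable_indic_comp.
have GF0 (p : T * T) : 0 <= \1_G p.1 * \1_F p.2 :> R by rewrite mulr_ge0.
pose f (p : T * T) := (\1_G p.1 * \1_F p.2 * kern b alpha p.1 p.2)%:E.
have mf : measurable_fun setT f.
  apply/measurable_EFinP; apply: measurable_funM; first exact: mGF.
  exact: measurable_kern.
have f0 p : (0 <= f p)%E.
  by rewrite lee_fin; apply: mulr_ge0; [exact: GF0|exact: kern_ge0].
rewrite [leLHS](_ : _ = \int[P]_p f p)%E; last by rewrite (fubini_tonelli1 f).
pose E N := [set p : T * T | eucl_dist p.1 p.2 = 0 \/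
   2 ^- N <= eucl_dist p.1 p.2 < 2 ^- N * 2 ^+ (N + N)].
have md : measurable_fun setT (fun p : T * T => eucl_dist p.1 p.2).
  exact: measurable_eucl_dist.
have mE N : measurable (E N).
  rewrite (_ : E N = ((fun p : T * T => eucl_dist p.1 p.2) @^-1` [set 0]) `|`
    ((fun p : T * T => eucl_dist p.1 p.2) @^-1` `[2 ^- N, 2 ^- N * 2 ^+ (N + N)[)).
    apply: measurableU; rewrite -[X in measurable X]setTI; apply: md => //.
  by apply/seteqP; split => p /=; rewrite in_itv.
apply: (integral_le_exhaustion (E := E)) => //.
- move=> N N' NN; apply/subsetPset => p [p0|pN]; first by left.
  by right; exact: dyadic_window_nondecreasing pN.
- apply/seteqP; split => // p _; have := eucl_dist_ge0 p.1 p.2.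
  rewrite le_eqVlt => /predU1P[d0|/dyadic_window_exists[N dN]].
    by exists 0%N => //; left.
  by exists N => //; right.
move=> N; set e : R := 2 ^- N.
have e0 : 0 < e by rewrite invr_gt0 exprn_gt0.
pose r k : R := e * 2 ^+ k.+1.
pose h k (p : T * T) := (\1_G p.1 * \1_F p.2 *
   (\1_[set p : T * T | near (r k) p.1 p.2] p * `|b p.1 - b p.2|))%:E.
pose c k := (2 `^ (n%:R - alpha) * r k `^ (alpha - n%:R))%:E.
have c0 k : (0 <= c k)%E by rewrite lee_fin mulr_ge0 ?powR_ge0.
have h0 k p : (0 <= h k p)%E.
  rewrite lee_fin; apply: mulr_ge0; first exact: GF0.
  by apply: mulr_ge0; [rewrite indicE|exact: normr_ge0].
have mnear k : measurable [set p : T * T | near (r k) p.1 p.2].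
  exact: measurable_near.
have mh k : measurable_fun setT (h k).
  apply/measurable_EFinP; apply: measurable_funM; first exact: mGF.
  apply: measurable_funM; first exact: measurable_indic.
  apply: (measurableT_comp (f := fun u : R => `|u|)); first exact: normr_measurable.
  by apply: measurable_funB; exact: measurableT_comp.
have mch k : measurable_fun setT (fun p => c k * h k p)%E.
  by apply: emeasurable_funM; [exact: measurable_cst|exact: mh].
have ch0 k p : (0 <= c k * h k p)%E by exact: mule_ge0.
have msum : measurable_fun setT (fun p => \sum_(k < N + N) c k * h k p)%E.
  by apply: emeasurable_sum.
have sum0 p : (0 <= \sum_(k < N + N) c k * h k p)%E by apply: sume_ge0.
apply: (@le_trans _ _ (\int[P]_p (\sum_(k < N + N) c k * h k p)))%E.
  apply: (@le_trans _ _ (\int[P]_(p in E N) (\sum_(k < N + N) c k * h k p)))%E.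
    apply: ge0_le_integral => //.
    - exact: measurable_funTS.
    - exact: measurable_funTS.
    move=> p [p0|pN].
      by rewrite /f /kern (eucl_dist_eq0 p0) subrr normr0 mul0r mulr0.
    rewrite /f (eq_bigr (fun k : 'I_(N + N) => (\1_G p.1 * \1_F p.2 *
      (2 `^ (n%:R - alpha) * r k `^ (alpha - n%:R) *
      (\1_[set p : T * T | near (r k) p.1 p.2] p * `|b p.1 - b p.2|)))%:E)); last first.
      by move=> k _; rewrite -EFinM; congr EFin; ring.
    rewrite sumEFin lee_fin -mulr_sumr; apply: ler_wpM2l; first exact: GF0.
    case: p pN => x y /= pN; case/andP: alP => _ aln.
    exact: (kern_le_shells b e0 aln pN).
  exact: ge0_subset_integral.
rewrite ge0_integral_sum//.
apply: le_trans (shell_integrals_sum_le (N + N) mb M0 bM alP a01 at_ t1 keps e0 mG mF GU FV U0 V0).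
apply: lee_sum => k _; rewrite ge0_integralZl_EFin//; last by rewrite mulr_ge0 ?powR_ge0.
by rewrite (fubini_tonelli1 (h k)).
Qed.

(** The exponent t of the John-Nirenberg inequality is taken so close to 1
    that alpha / n < t - 1 + a. Sets of measure 0 are set apart because
    restricted_estimate_pos normalises by the measures. *)
Lemma restricted_estimate b M alpha a : measurable_fun setT b -> 0 < M ->
  cube_bmo b M -> 0 < alpha < n%:R -> alpha / n%:R < a < 1 ->
  exists2 C : R, 0 <= C & forall (G F : set T) (U V : R),
    measurable G -> measurable F -> mu G = U%:E -> mu F = V%:E ->
    (\int[mu]_x \int[mu]_y (\1_G x * \1_F y * kern b alpha x y)%:E <=
     (C * V `^ (alpha / n%:R + (1 - a)) * U `^ a)%:E)%E.
Proof.
move=> mb M0 bM alP /andP[ka a1]; have /andP[al0 aln] := alP.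
have nR0 : 0 < n%:R :> R by exact: lt_trans aln.
set k := alpha / n%:R in ka *; have k0 : 0 < k by rewrite divr_gt0.
pose t := Num.max a (1 - (a - k) / 2).
have at_ : a <= t by rewrite le_max lexx.
have t1 : t < 1 by rewrite gt_max a1/=; lra.
have tk : 1 - (a - k) / 2 <= t by rewrite le_max lexx orbT.
have a01 : 0 < a < 1 by apply/andP; split; lra.
have keps : k < t - 1 + a by lra.
exists `|restricted_const M a t alpha| => // G F U V mG mF GU FV.
have U0 : 0 <= U by rewrite -lee_fin -GU.
have V0 : 0 <= V by rewrite -lee_fin -FV.
have rhs0 : (0 <= (`|restricted_const M a t alpha| * V `^ (k + (1 - a)) * U `^ a)%:E)%E.
  by rewrite lee_fin; apply: mulr_ge0 (powR_ge0 _ _); apply: mulr_ge0 (powR_ge0 _ _).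
have ker_m x : measurable_fun setT (kern b alpha x).
  by apply: measurable_kern => //; exact: measurable_cst.
have fyE x : (\int[mu]_y (\1_G x * \1_F y * kern b alpha x y)%:E =
    (\1_G x)%:E * \int[mu]_(y in F) (kern b alpha x y)%:E)%E.
  rewrite -[X in _ = (_ * X)%E]integral_indic_mul -ge0_integralZl_EFin//.
  - by apply: eq_integral => y _; rewrite -!EFinM mulrA.
  - by move=> y _; rewrite -EFinM lee_fin mulr_ge0 ?kern_ge0.
  - by apply: emeasurable_funM; apply/measurable_EFinP => //; exact: measurable_indic.
have [U_eq0|U_neq0] := eqVneq U 0.
  under eq_integral do rewrite fyE.
  rewrite integral_indic_mul null_set_integral//; last by rewrite /= GU U_eq0.
  apply: measurable_funTS.
  apply: (@measurable_integral_section _ _ T T R (lebesgue_measure_n n) F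
    (fun p : T * T => (kern b alpha p.1 p.2)%:E)) => //.
    by apply/measurable_EFinP; apply: measurable_kern.
  by move=> p; rewrite lee_fin kern_ge0.
have [V_eq0|V_neq0] := eqVneq V 0.
  rewrite integral0_eq// => x _; rewrite fyE null_set_integral ?mule0//.
    by apply/measurable_EFinP; exact: measurable_funTS.
  by rewrite /= FV V_eq0.
have U_gt0 : 0 < U by rewrite lt0r U_neq0.
have V_gt0 : 0 < V by rewrite lt0r V_neq0.
apply: le_trans (restricted_estimate_pos mb M0 bM alP a01 at_ t1 keps mG mF GU FV U_gt0 V_gt0) _.
rewrite lee_fin -/k [V `^ (k + (1 - a))]powRD; last by rewrite (gt_eqF V_gt0) implybT.
have -> : `|restricted_const M a t alpha| * (V `^ k * V `^ (1 - a)) * U `^ a =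
  `|restricted_const M a t alpha| * (U `^ a * V `^ (1 - a) * V `^ k) by ring.
apply: ler_wpM2r; last exact: ler_norm.
by apply: mulr_ge0 (powR_ge0 _ _); apply: mulr_ge0 (powR_ge0 _ _); exact: powR_ge0.
Qed.

End restricted_estimate.

(** * Dyadic layers of a function and of its potential *)

Section truncated_modular.
Context {R : realType} {n : nat}.
Local Notation T := (Rn[R]_n).
Local Notation mu := (lebesgue_measure_n n : set T -> \bar R).
Implicit Types (f b : T -> R) (Phi Psi : R -> \bar R).

(** For f >= 0, a majorant of the commutator that is monotone in f. *)
Definition potential b alpha f (x : T) : \bar R :=
  (\int[mu]_y (kern b alpha x y * f y)%:E)%E.

Definition dyadic_range e K f := forall y, f y = 0 \/ e <= f y < e * 2 ^+ K.

Lemma dyadic_layers_ge e K f y : 0 < e -> dyadic_range e K f -> 0 <= f y ->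
  f y <= 2 * \sum_(j < K) e * 2 ^+ j * \1_[set y | e * 2 ^+ j <= f y] y.
Proof.
move=> e0 fK fy0.
have l0 j : 0 < e * 2 ^+ j by rewrite mulr_gt0// exprn_gt0.
have [->|/andP[ef fe]] := fK y.
  by rewrite mulr_ge0// sumr_ge0// => j _; rewrite mulr_ge0 ?(ltW (l0 j)).
have two1 : 1 < 2 :> R by rewrite ltr1n.
have fe1 : 1 <= f y / e by rewrite ler_pdivlMr// mul1r.
have [k /andP[lo hi]] := exprn_bracket two1 fe1.
have kK : (k < K)%N.
  rewrite -(@ltr_eXn2l R 2)//; apply: le_lt_trans lo _.
  by rewrite ltr_pdivrMr// mulrC.
have fk : e * 2 ^+ k <= f y by rewrite mulrC -ler_pdivlMr.
rewrite (bigD1 (Ordinal kK))//= indicE mem_set// mulr1 mulrDr.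
rewrite -[leLHS]addr0; apply: lerD.
  by rewrite mulrCA -exprS mulrC -ler_pdivrMr// ltW.
by rewrite mulr_ge0// sumr_ge0// => j _; rewrite mulr_ge0 ?(ltW (l0 j)).
Qed.

(** As phi at least doubles from one level to the next, the sum over the
    levels up to t is at most twice its last term. *)
Lemma doubling_layers_le (phi : R -> R) e K (t : R) : 0 < e -> 0 <= t ->
  (forall r, 0 <= r -> 0 <= phi r) ->
  (forall r s, 0 <= r -> r <= s -> phi r <= phi s) ->
  (forall r, 0 <= r -> 2 * phi r <= phi (2 * r)) ->
  \sum_(j < K) phi (e * 2 ^+ j) * (e * 2 ^+ j <= t)%R%:R <= 2 * phi t.
Proof.
move=> e0 t0 phi0 phi_nd dbl.
have l0 j : 0 <= e * 2 ^+ j by rewrite mulr_ge0 ?exprn_ge0 ?ltW.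
have partial m : \sum_(j < m) phi (e * 2 ^+ j) <= phi (e * 2 ^+ m).
  elim: m => [|m IH]; first by rewrite big_ord0 phi0.
  rewrite big_ord_recr/=; apply: le_trans (_ : 2 * phi (e * 2 ^+ m) <= _).
    by move: IH; lra.
  by rewrite exprS mulrCA dbl.
elim: K => [|K IH]; first by rewrite big_ord0 mulr_ge0 ?phi0.
rewrite big_ord_recr/=; have [lt|gt] := boolP (e * 2 ^+ K <= t); last first.
  by rewrite mulr0 addr0.
rewrite mulr1; apply: le_trans (_ : 2 * phi (e * 2 ^+ K) <= _).
  have : \sum_(j < K) phi (e * 2 ^+ j) * (e * 2 ^+ j <= t)%R%:R <= phi (e * 2 ^+ K).
    apply: le_trans (partial K); apply: ler_sum => j _.
    by rewrite ler_piMr ?phi0// lern1 leq_b1.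
  lra.
by rewrite ler_pM2l// phi_nd.
Qed.

Lemma measurable_potential b alpha f : measurable_fun setT b ->
  measurable_fun setT f -> (forall y, 0 <= f y) ->
  measurable_fun setT (potential b alpha f).
Proof.
move=> mb mf f0.
apply: (measurable_fun_fubini_tonelli_F
  (fun p : T * T => (kern b alpha p.1 p.2 * f p.2)%:E)).
  apply/measurable_EFinP; apply: measurable_funM.
    by apply: measurable_kern; [exact: mb|exact: measurable_fst|exact: measurable_snd].
  exact: measurableT_comp mf measurable_snd.
by move=> p; rewrite lee_fin mulr_ge0 ?kern_ge0.
Qed.

Lemma potential_ge0 b alpha f x : (forall y, 0 <= f y) ->
  (0 <= potential b alpha f x)%E.
Proof.
by move=> f0; apply: integral_ge0 => y _; rewrite lee_fin mulr_ge0 ?kern_ge0.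
Qed.

(** Integrate s <= potential b alpha f over G, after bounding f by twice the
    sum of its dyadic layers. *)
Lemma superlevel_pairing_le b alpha f e K (G : set T) (s U : R) :
  measurable_fun setT b -> measurable_fun setT f -> (forall y, 0 <= f y) ->
  0 < e -> dyadic_range e K f -> 0 <= s ->
  measurable G -> mu G = U%:E ->
  (forall x, G x -> (s%:E <= potential b alpha f x)%E) ->
  ((s * U)%:E <= 2%:E * \sum_(j < K) (e * 2 ^+ j)%:E *
    \int[mu]_x \int[mu]_y (\1_G x * \1_[set y | e * 2 ^+ j <= f y]%R y *
      kern b alpha x y)%:E)%E.
Proof.
move=> mb mf f0 e0 fK s0 mG GU hG.
pose F j := [set y | e * 2 ^+ j <= f y].
have mF j : measurable (F j) by exact: measurable_superlevel.
have mk x : measurable_fun setT (fun y => kern b alpha x y).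
  by apply: measurable_kern => //; exact: measurable_cst.
have l0 j : 0 <= e * 2 ^+ j by rewrite mulr_ge0 ?exprn_ge0 ?ltW.
have mFk j x : measurable_fun setT (fun y => (\1_(F j) y * kern b alpha x y)%:E).
  by apply/measurable_EFinP; apply: measurable_funM; [exact: measurable_indic|exact: mk].
have Fk0 j x y : (0 <= (\1_(F j) y * kern b alpha x y)%:E)%E.
  by rewrite lee_fin mulr_ge0 ?kern_ge0.
have pot_le x : (potential b alpha f x <=
    2%:E * \sum_(j < K) (e * 2 ^+ j)%:E *
       \int[mu]_y (\1_(F j) y * kern b alpha x y)%:E)%E.
  have -> : (2%:E * \sum_(j < K) (e * 2 ^+ j)%:E *
       \int[mu]_y (\1_(F j) y * kern b alpha x y)%:E =
     \int[mu]_y (2%:E * \sum_(j < K) (e * 2 ^+ j)%:E * (\1_(F j) y * kern b alpha x y)%:E))%E.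
    rewrite ge0_integralZl_EFin//; last 2 first.
    - by move=> y _; apply: sume_ge0 => j _; rewrite mule_ge0// lee_fin.
    - by apply: emeasurable_sum => j; apply: emeasurable_funM => //; exact: measurable_cst.
    congr (_ * _)%E; rewrite ge0_integral_sum//.
    - by apply: eq_bigr => j _; rewrite ge0_integralZl_EFin.
    - by move=> j; apply: emeasurable_funM => //; exact: measurable_cst.
    - by move=> j y _; rewrite mule_ge0// lee_fin.
  apply: ge0_le_integral => //.
  - by move=> y _; rewrite lee_fin mulr_ge0 ?kern_ge0.
  - by apply/measurable_EFinP; apply: measurable_funM; [exact: mk|].
  - apply: emeasurable_funM; first exact: measurable_cst.
    by apply: emeasurable_sum => j; apply: emeasurable_funM => //; exact: measurable_cst.
  move=> y _; under eq_bigr do rewrite -EFinM.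
  rewrite sumEFin -EFinM lee_fin mulrC.
  apply: le_trans (ler_wpM2r (kern_ge0 b alpha x y) (dyadic_layers_ge e0 fK (f0 y))) _.
  rewrite -mulrA mulr_suml.
  rewrite ler_pM2l// le_eqVlt; apply/predU1P; left.
  by apply: eq_bigr => j _; rewrite -[LHS]mulrA.

have mH j : measurable_fun setT (fun x => \int[mu]_y (\1_(F j) y * kern b alpha x y)%:E)%E.
  apply: (measurable_fun_fubini_tonelli_F
    (fun p : T * T => (\1_(F j) p.2 * kern b alpha p.1 p.2)%:E)).
    apply/measurable_EFinP; apply: measurable_funM.
      by apply: measurable_indic_comp => //; exact: measurable_snd.
    by apply: measurable_kern; [exact: mb|exact: measurable_fst|exact: measurable_snd].
  by move=> p; rewrite lee_fin mulr_ge0 ?kern_ge0.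
have H0 j x : (0 <= \int[mu]_y (\1_(F j) y * kern b alpha x y)%:E)%E.
  by apply: integral_ge0 => y _; exact: Fk0.
have lH0 j x : (0 <= (e * 2 ^+ j)%:E * \int[mu]_y (\1_(F j) y * kern b alpha x y)%:E)%E.
  by rewrite mule_ge0// lee_fin.
have mlH j : measurable_fun setT
    (fun x => (e * 2 ^+ j)%:E * \int[mu]_y (\1_(F j) y * kern b alpha x y)%:E)%E.
  by apply: emeasurable_funM; [exact: measurable_cst|exact: mH].
have msum : measurable_fun setT (fun x => \sum_(j < K) (e * 2 ^+ j)%:E *
    \int[mu]_y (\1_(F j) y * kern b alpha x y)%:E)%E by exact: emeasurable_sum.
have sum0 x : (0 <= \sum_(j < K) (e * 2 ^+ j)%:E *
    \int[mu]_y (\1_(F j) y * kern b alpha x y)%:E)%E by exact: sume_ge0.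
rewrite EFinM -GU -integral_cst//.
apply: (@le_trans _ _ (\int[mu]_(x in G) (2%:E * \sum_(j < K) (e * 2 ^+ j)%:E *
    \int[mu]_y (\1_(F j) y * kern b alpha x y)%:E)))%E.
  apply: ge0_le_integral.
  - exact: mG.
  - by move=> x _; rewrite lee_fin.
  - exact: measurable_cst.
  - apply: measurable_funTS; apply: emeasurable_funM => //; exact: measurable_cst.
  - by move=> x Gx; apply: le_trans (hG x Gx) _; exact: pot_le.
rewrite ge0_integralZl_EFin//; last exact: measurable_funTS.
rewrite ge0_integral_sum//; last by move=> j; exact: measurable_funTS.
rewrite le_eqVlt; apply/predU1P; left; congr (_ * _)%E.
apply: eq_bigr => j _; rewrite ge0_integralZl_EFin;
  [|exact: mG|by move=> x _; exact: H0|exact: measurable_funTS|exact: l0].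
congr (_ * _)%E; rewrite -[LHS]integral_indic_mul; apply: eq_integral => x _.
rewrite -ge0_integralZl_EFin//.
by apply: eq_integral => y _; rewrite -EFinM mulrA.
Qed.

End truncated_modular.

(** * The modular inequality for truncated functions *)

Section truncated_modular_bound.
Context {R : realType} {n : nat}.
Local Notation T := (Rn[R]_n).
Local Notation mu := (lebesgue_measure_n n : set T -> \bar R).
Implicit Types (f b : T -> R) (Phi Psi : R -> \bar R).

Definition young_inv_dominated (k : R) Phi Psi :=
  exists2 C : R, 0 < C & forall r : R, 0 < r ->
    ((r `^ (- k))%:E * young_inv Phi r%:E <= C%:E * young_inv Psi r%:E)%E.

(** exponent_gain for Young functions: the nabla_2 condition on Phi gives the
    lower type and the Delta_2 condition on Psi the upper type. *)
Lemma young_gain Phi Psi (k : R) : 0 < k < 1 ->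
  young_function Phi -> young_function Psi -> Delta2 Phi -> nabla2 Phi ->
  Delta2 Psi ->
  young_inv_dominated k Phi Psi ->
  exists b0 b1 d K : R,
    [/\ 0 < b0 < 1 - k, 0 < b1 < 1 - k, 0 < d, 0 < K &
      forall l s, 0 < l -> 0 < s -> exists2 b, b = b0 \/ b = b1 &
        l * fine (Phi l) `^ (- (k + b)) * fine (Psi s) `^ b <=
        K * s * Num.min (fine (Phi l) / fine (Psi s))
                        (fine (Psi s) / fine (Phi l)) `^ d].
Proof.
move=> k01 yPhi yPsi D2Phi [cn cn1 nab] D2Psi [C C0 H].
have phi_nd r s : 0 <= r -> r <= s -> fine (Phi r) <= fine (Phi s).
  exact: young_nondecreasing.
have psi_nd r s : 0 <= r -> r <= s -> fine (Psi r) <= fine (Psi s).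
  exact: young_nondecreasing.
have phi_ge0 r : 0 <= r -> 0 <= fine (Phi r).
  by move=> r0; rewrite fine_ge0// (young_ge0 yPhi).
have psi_ge0 r : 0 <= r -> 0 <= fine (Psi r).
  by move=> r0; rewrite fine_ge0// (young_ge0 yPsi).
have [p p1 [a a0 low]] : exists2 p : R, 1 < p & exists2 a : R, 0 < a &
    forall r s, 0 < r -> r <= s ->
      a * (s / r) `^ p * fine (Phi r) <= fine (Phi s).
  apply: (nabla2_lower_type cn1 phi_ge0 phi_nd) => r r0.
  have cr0 : 0 <= cn * r by rewrite mulr_ge0// ltW// (lt_trans _ cn1).
  have := nab r r0.
  by rewrite -(fineK (young_fin_num yPhi D2Phi r0))
    -(fineK (young_fin_num yPhi D2Phi cr0)) -EFinM lee_fin.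
have [Cq Cq1 D2C] := D2Psi.
have [q q0 upp] : exists2 q : R, 0 < q &
    forall r s, 0 < r -> r <= s ->
      fine (Psi s) <= Cq * (s / r) `^ q * fine (Psi r).
  apply: (Delta2_upper_type Cq1 psi_ge0 psi_nd) => r r0.
  have r20 : 0 <= 2 * r by rewrite mulr_ge0// ltW.
  have := D2C r r0.
  by rewrite -(fineK (young_fin_num yPsi D2Psi (ltW r0)))
    -(fineK (young_fin_num yPsi D2Psi r20)) -EFinM lee_fin.
apply: (@exponent_gain _ (fine \o Phi) (fine \o Psi) k a p Cq q (2 * C)) => //=.
- by move=> r r0; exact: young_gt0.
- by move=> r r0; exact: young_gt0.
- by move=> r s r0 rs; exact: young_increasing.
- by move=> r s r0 rs; exact: young_increasing.
- exact: lt_trans Cq1.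
- exact: mulr_gt0.
- move=> B t B0 t0 BPsi.
  have BPsi' : (B%:E < Psi t)%E.
    by rewrite -(fineK (young_fin_num yPsi D2Psi (ltW t0))) lte_fin.
  have [r /andP[r0 rt] Br] := young_inv_transfer C0 B0 t0 (H B B0) BPsi'.
  rewrite -lte_fin; apply: (lt_le_trans Br).
  rewrite -(fineK (young_fin_num yPhi D2Phi r0)) lee_fin.
  by apply: phi_nd => //; exact: ltW.
Qed.

Lemma measurable_young Phi d (X : measurableType d) (f : X -> R) :
  young_function Phi -> Delta2 Phi ->
  measurable_fun setT f -> (forall y, 0 <= f y) ->
  measurable_fun setT (fun y => fine (Phi (f y))).
Proof.
move=> yPhi D2 mf f0.
pose g (r : R) := fine (Phi (Num.max r 0)).
rewrite (_ : (fun _ => _) = g \o f); last first.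
  by apply/funext => y /=; rewrite /g; congr (fine (Phi _)); apply/esym/max_idPl.
apply: measurableT_comp mf; apply: nondecreasing_measurable => // r s rs.
apply: young_nondecreasing => //; first by rewrite le_max lexx orbT.
by rewrite ge_max !le_max rs lexx orbT.
Qed.

Lemma measurable_young_ereal Phi d (X : measurableType d) (f : X -> R) :
  young_function Phi -> Delta2 Phi ->
  measurable_fun setT f -> (forall y, 0 <= f y) ->
  measurable_fun setT (fun y => Phi (f y)).
Proof.
move=> yPhi D2 mf f0.
rewrite (_ : (fun _ => _) = (fun y => (fine (Phi (f y)))%:E)); last first.
  by apply/funext => y; rewrite fineK//; exact: young_fin_num.
by apply/measurable_EFinP; exact: measurable_young.
Qed.

Lemma young_layers_modular_le Phi f e K : young_function Phi -> Delta2 Phi ->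
  measurable_fun setT f -> (forall y, 0 <= f y) -> 0 < e ->
  (\int[mu]_y Phi (f y) <= 1)%E ->
  (forall j, ((fine (Phi (e * 2 ^+ j)))%:E *
     mu [set y | (e * 2 ^+ j <= f y)%R] <= 1)%E) /\
  (\sum_(j < K) (fine (Phi (e * 2 ^+ j)))%:E *
     mu [set y | (e * 2 ^+ j <= f y)%R] <= 2%:E)%E.
Proof.
move=> yPhi D2 mf f0 e0 Phi1.
have l0 j : 0 <= e * 2 ^+ j by rewrite mulr_ge0 ?exprn_ge0 ?ltW.
have phi_nd r s : 0 <= r -> r <= s -> fine (Phi r) <= fine (Phi s).
  exact: young_nondecreasing.
have phi_ge0 r : 0 <= r -> 0 <= fine (Phi r).
  by move=> r0; rewrite fine_ge0// (young_ge0 yPhi).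
have PhiE y : Phi (f y) = (fine (Phi (f y)))%:E.
  by rewrite fineK// young_fin_num.
have mPhi : measurable_fun setT (fun y => Phi (f y)).
  exact: measurable_young_ereal.
have mF j : measurable [set y | (e * 2 ^+ j <= f y)%R] by exact: measurable_superlevel.
have massE j : ((fine (Phi (e * 2 ^+ j)))%:E * mu [set y | (e * 2 ^+ j <= f y)%R] =
    \int[mu]_y (fine (Phi (e * 2 ^+ j)) * (e * 2 ^+ j <= f y)%R%:R)%:E)%E.
  rewrite -[X in (_ * mu X)%E]setIT -integral_indic// -ge0_integralZl_EFin//.
  - apply: eq_integral => y _; rewrite -EFinM; congr (_ * _)%:E.
    rewrite indicE; congr (nat_of_bool _)%:R.
    by apply/idP/idP => [/set_mem|H]; rewrite ?inE.
  - by apply/measurable_EFinP; exact: measurable_indic.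
  - exact: phi_ge0.
have mlayer j : measurable_fun setT
    (fun y => (fine (Phi (e * 2 ^+ j)) * (e * 2 ^+ j <= f y)%R%:R)%:E : \bar R).
  apply/measurable_EFinP; apply: measurable_funM; first exact: measurable_cst.
  rewrite (_ : (fun _ => _) = (\1_[set y | (e * 2 ^+ j <= f y)%R] : T -> R)).
    exact: measurable_indic.
  apply/funext => y; rewrite indicE; congr (nat_of_bool _)%:R.
  by apply/idP/idP => [H|/set_mem]; rewrite ?inE.
have layer0 j y : (0 <= (fine (Phi (e * 2 ^+ j)) * (e * 2 ^+ j <= f y)%R%:R)%:E)%E.
  by rewrite lee_fin mulr_ge0 ?phi_ge0.
split=> [j|].
  rewrite massE; apply: le_trans Phi1; apply: ge0_le_integral => // y _.
  rewrite PhiE lee_fin; case: (boolP (e * 2 ^+ j <= f y)) => [le|_].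
    by rewrite mulr1 phi_nd.
  by rewrite mulr0 phi_ge0.
under eq_bigr do rewrite massE.
rewrite -ge0_integral_sum//.
apply: (@le_trans _ _ (\int[mu]_y (2%:E * Phi (f y)))%E).
  apply: ge0_le_integral => //.
  - by move=> y _; exact: sume_ge0.
  - exact: emeasurable_sum.
  - by apply: emeasurable_funM => //; exact: measurable_cst.
  move=> y _; rewrite sumEFin PhiE -EFinM lee_fin.
  apply: (@doubling_layers_le R (fine \o Phi)) => //.
  by move=> r r0; exact: young_double.
rewrite ge0_integralZl_EFin//; last by move=> y _; exact: (young_ge0 yPhi).
by rewrite -[leRHS]mule1; apply: lee_wpmul2l.
Qed.

(** The constants c and C1 do not depend on the range of f, on the levels nor
    on Om, which serve only to make all the sums and measures finite. *)
Lemma truncated_modular_bound b M alpha Phi Psi :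
  measurable_fun setT b -> 0 < M -> cube_bmo b M -> 0 < alpha < n%:R ->
  young_function Phi -> young_function Psi -> Delta2 Phi -> nabla2 Phi ->
  Delta2 Psi ->
  young_inv_dominated (alpha / n%:R) Phi Psi ->
  exists2 c : R, 0 < c & exists2 C1 : R, 0 <= C1 &
    forall e K f e' m (Om : set T), 0 < e -> 0 < e' ->
    measurable_fun setT f -> (forall y, 0 <= f y) -> dyadic_range e K f ->
    (\int[mu]_y Phi (f y) <= 1)%E -> measurable Om -> (mu Om < +oo)%E ->
    (\sum_(i < m) (fine (Psi (c * (e' * 2 ^+ i))))%:E *
       mu (Om `&` [set x | ((e' * 2 ^+ i)%:E < potential b alpha f x)%E]) <= C1%:E)%E.
Proof.
move=> mb M0 bM alP yPhi yPsi D2Phi nPhi D2Psi H.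
have /andP[al0 aln] := alP.
have nR0 : 0 < n%:R :> R by exact: lt_trans aln.
set k := alpha / n%:R in H; have k0 : 0 < k by rewrite divr_gt0.
have k1 : k < 1 by rewrite ltr_pdivrMr// mul1r.
have k01 : 0 < k < 1 by rewrite k0.
have [b0 [b1 [d [Kg [b0P b1P d0 Kg0 gain]]]]] :=
  young_gain k01 yPhi yPsi D2Phi nPhi D2Psi H.
have aP bb : 0 < bb < 1 - k -> k < 1 - bb < 1.
  by move=> /andP[? ?]; apply/andP; split; lra.
have [CA0 CA00 est0] := restricted_estimate mb M0 bM alP (aP _ b0P).
have [CA1 CA10 est1] := restricted_estimate mb M0 bM alP (aP _ b1P).
rewrite -/k in est0 est1.
pose K0 := CA0 + CA1; have K00 : 0 <= K0 by rewrite addr_ge0.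
have d20 : 0 < d / 2 by rewrite divr_gt0.
pose cg : R := 2 / (1 - 2^-1 `^ (d / 2)).
have cg0 : 0 <= cg.
  rewrite divr_ge0// subr_ge0 -[leRHS](_ : 1 `^ (d / 2) = 1); last by rewrite powR1.
  by apply: ler_powR_base; [exact: ltW|rewrite invr_ge0|rewrite invf_le1// ler1n].
(* The factor c multiplies the constant Kg of young_gain, and this value
   fulfils the smallness condition of summed_restricted_bounds. *)
pose c := (2 * K0 * Kg * cg + 1)^-1 / 2.
have D0 : 0 <= 2 * K0 * Kg * cg.
  exact: mulr_ge0 (mulr_ge0 (mulr_ge0 (ler0n R 2) K00) (ltW Kg0)) cg0.
have c0 : 0 < c by rewrite divr_gt0// invr_gt0; lra.
exists c => //; exists (cg * 2); first exact: mulr_ge0.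
move=> e K f e' m Om e0 e'0 mf f0 fK Phi1 mOm Omfin.
have [mass1 mass2] := young_layers_modular_le K yPhi D2Phi mf f0 e0 Phi1.
have l0 j : 0 < e * 2 ^+ j by rewrite mulr_gt0// exprn_gt0.
have s0 i : 0 < e' * 2 ^+ i by rewrite mulr_gt0// exprn_gt0.
have cs0 i : 0 < c * (e' * 2 ^+ i) by rewrite mulr_gt0.
have A0 j : 0 < fine (Phi (e * 2 ^+ j)) by exact: young_gt0.
have B0 i : 0 < fine (Psi (c * (e' * 2 ^+ i))) by exact: young_gt0.
pose F j := [set y | (e * 2 ^+ j <= f y)%R].
have mF j : measurable (F j) by exact: measurable_superlevel.
pose G i := Om `&` [set x | ((e' * 2 ^+ i)%:E < potential b alpha f x)%E].
have mpot := measurable_potential alpha mb mf f0.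
have mG i : measurable (G i).
  by apply: (measurable_lte mOm); [exact: measurable_cst|exact: measurable_funTS].
have finF j : mu (F j) \is a fin_num.
  rewrite ge0_fin_numE//; have := mass1 j; rewrite muleC -lee_pdivlMr//.
  by move=> /le_lt_trans; apply; rewrite mul1e ltry.
have finG i : mu (G i) \is a fin_num.
  rewrite ge0_fin_numE//; apply: le_lt_trans Omfin.
  by apply: le_measure; rewrite ?inE//; exact: subIsetl.
pose L i j := (\int[mu]_x \int[mu]_y (\1_(G i) x * \1_(F j) y * kern b alpha x y)%:E)%E.
have L0 i j : (0 <= L i j)%E.
  apply: integral_ge0 => x _; apply: integral_ge0 => y _.
  by rewrite lee_fin; apply: mulr_ge0 (kern_ge0 _ _ _ _); exact: mulr_ge0.
have Lle i j bb : bb = b0 \/ bb = b1 -> (L i j <= (K0 * fine (mu (F j)) `^ (k + bb) *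
    fine (mu (G i)) `^ (1 - bb))%:E)%E.
  have GU : mu (G i) = (fine (mu (G i)))%:E by rewrite fineK.
  have FV : mu (F j) = (fine (mu (F j)))%:E by rewrite fineK.
  have subK x : 1 - (1 - x) = x :> R by ring.
  case=> ->.
    have := est0 _ _ _ _ (mG i) (mF j) GU FV; rewrite subK => /le_trans; apply.
    by rewrite lee_fin -!mulrA ler_wpM2r ?mulr_ge0 ?powR_ge0// /K0 lerDl.
  have := est1 _ _ _ _ (mG i) (mF j) GU FV; rewrite subK => /le_trans; apply.
  by rewrite lee_fin -!mulrA ler_wpM2r ?mulr_ge0 ?powR_ge0// /K0 lerDr.
have finL i j : L i j \is a fin_num.
  by rewrite ge0_fin_numE//; apply: le_lt_trans (Lle i j b0 _) (ltry _); left.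
have main := @summed_restricted_bounds R k b0 b1 (d / 2) K0 (Kg * c) K m
  (fun j => e * 2 ^+ j) (fun j => fine (Phi (e * 2 ^+ j))) (fun j => fine (mu (F j)))
  (fun i => e' * 2 ^+ i) (fun i => fine (Psi (c * (e' * 2 ^+ i))))
  (fun i => fine (mu (G i))) (fun i j => fine (L i j)).
have concl : \sum_(i < m) fine (Psi (c * (e' * 2 ^+ i))) * fine (mu (G i)) <=
    cg * \sum_(j < K) fine (Phi (e * 2 ^+ j)) * fine (mu (F j)).
  apply: main.
  - exact: ltW.
  - by case/andP: b0P => -> ?; apply/ltW; lra.
  - by case/andP: b1P => -> ?; apply/ltW; lra.
  - exact: d20.
  - exact: K00.
  - exact: mulr_ge0 (ltW Kg0) (ltW c0).
  - exact: l0.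
  - exact: A0.
  - by move=> j; rewrite exprS (mulrCA e); apply: young_double => //; exact: ltW.
  - exact: B0.
  - move=> i; rewrite exprS (mulrCA e') (mulrCA c 2).
    by apply: young_double => //; exact: ltW.
  - exact: s0.
  - by move=> j; rewrite fine_ge0.
  - by move=> j; rewrite -lee_fin EFinM (fineK (finF j)); exact: mass1.
  - by move=> i; rewrite fine_ge0.
  - by move=> i j bb bbE; rewrite -lee_fin (fineK (finL i j)); exact: Lle.
  - move=> i; rewrite -lee_fin [(2 * _)%:E]EFinM -sumEFin.
    under eq_bigr do rewrite EFinM (fineK (finL _ _)).
    apply: (@superlevel_pairing_le R n b alpha f e K (G i)) => //.
    + exact: ltW.
    + by rewrite (fineK (finG i)).
    + by move=> x [_ /ltW].
  - move=> i j; have [bb bbE gb] := gain _ _ (l0 j) (cs0 i).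
    exists bb => //; apply: le_trans gb _.
    by rewrite -splitr (mulrA Kg) lexx.
  - rewrite -/cg /c.
    have -> : 2 * K0 * (Kg * ((2 * K0 * Kg * cg + 1)^-1 / 2)) * cg =
      (2 * K0 * Kg * cg) / (2 * K0 * Kg * cg + 1) / 2 by ring.
    move: (2 * K0 * Kg * cg) D0 => D D0.
    rewrite ltr_pdivrMr// mul1r ltr_pdivrMr; lra.
apply: (@le_trans _ _ (\sum_(i < m) fine (Psi (c * (e' * 2 ^+ i))) * fine (mu (G i)))%:E).
  by rewrite -sumEFin; apply: lee_sum => i _; rewrite [leRHS]EFinM (fineK (finG i)).
rewrite lee_fin; apply: (le_trans concl); apply: ler_wpM2l => //.
rewrite -lee_fin -sumEFin; apply: le_trans mass2.
by apply: lee_sum => j _; rewrite [leLHS]EFinM (fineK (finF j)).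
Qed.

End truncated_modular_bound.

(** * Removal of the truncations *)

Section modular_bound.
Context {R : realType} {n : nat}.
Local Notation T := (Rn[R]_n).
Local Notation mu := (lebesgue_measure_n n : set T -> \bar R).
Implicit Types (f b : T -> R) (Phi Psi : R -> \bar R).

(** The values of f in the dyadic window from 2^-N to 2^N, which satisfy
    dyadic_range. *)
Definition truncate f (N : nat) : T -> R :=
  fun y => if 2 ^- N <= f y < 2 ^- N * 2 ^+ (N + N) then f y else 0.

Lemma truncate_ge0 f N y : 0 <= f y -> 0 <= truncate f N y.
Proof. by rewrite /truncate; case: ifP. Qed.

Lemma truncate_le f N y : 0 <= f y -> truncate f N y <= f y.
Proof. by rewrite /truncate; case: ifP. Qed.

Lemma truncate_nondecreasing f y : 0 <= f y ->
  nondecreasing_seq (fun N => truncate f N y).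
Proof.
move=> f0 N N' NN; rewrite /truncate; case: ifPn => [w|_].
  by rewrite (dyadic_window_nondecreasing NN w).
by case: ifP.
Qed.

Lemma measurable_truncate f N : measurable_fun setT f ->
  measurable_fun setT (truncate f N).
Proof.
move=> mf; apply: measurable_fun_ifT => //.
by apply: measurable_and; [apply: measurable_fun_ler|apply: measurable_fun_ltr].
Qed.

Lemma potential_truncate_cvg b alpha f x : measurable_fun setT b ->
  measurable_fun setT f -> (forall y, 0 <= f y) ->
  potential b alpha (truncate f N) x @[N --> \oo] --> potential b alpha f x.
Proof.
move=> mb mf f0.
have mk : measurable_fun setT (kern b alpha x).
  by apply: measurable_kern => //; exact: measurable_cst.
have := @cvg_monotone_convergence _ T R (lebesgue_measure_n n) setT measurableT
  (fun N y => (kern b alpha x y * truncate f N y)%:E).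
have -> : (fun y => limn (fun N => (kern b alpha x y * truncate f N y)%:E)) =
    (fun y => (kern b alpha x y * f y)%:E).
  apply/funext => y; apply/cvg_lim => //.
  have [fy0|fyn0] := eqVneq (f y) 0.
    rewrite (_ : (fun N => _) = cst ((kern b alpha x y * f y)%:E)); first exact: cvg_cst.
    apply/funext => N; rewrite /truncate; case: ifP => //; by rewrite fy0.
  have fy_gt0 : 0 < f y by rewrite lt0r fyn0 f0.
  have [N0 w] := dyadic_window_exists fy_gt0.
  apply: cvg_near_cst; exists N0 => // N /= NN.
  by rewrite /truncate (dyadic_window_nondecreasing NN w).
apply.
- move=> N; apply/measurable_EFinP; apply: measurable_funM => //.
  exact: measurable_truncate.
- by move=> N y _; rewrite lee_fin mulr_ge0 ?kern_ge0 ?truncate_ge0.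
- move=> y _ N N' NN; rewrite lee_fin ler_wpM2l ?kern_ge0//.
  exact: truncate_nondecreasing.
Qed.

Lemma potential_le b alpha f g x : measurable_fun setT b ->
  measurable_fun setT f -> measurable_fun setT g ->
  (forall y, 0 <= f y) -> (forall y, f y <= g y) ->
  (potential b alpha f x <= potential b alpha g x)%E.
Proof.
move=> mb mf mg f0 fg.
have mk : measurable_fun setT (kern b alpha x).
  by apply: measurable_kern => //; exact: measurable_cst.
apply: ge0_le_integral => //.
- by move=> y _; rewrite lee_fin mulr_ge0 ?kern_ge0.
- by apply/measurable_EFinP; exact: measurable_funM.
- by apply/measurable_EFinP; exact: measurable_funM.
- by move=> y _; rewrite lee_fin ler_wpM2l ?kern_ge0.
Qed.

(** The superlevel sets of the potentials of the truncations increase to that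
    of the potential of f, because the inequality defining them is strict. *)
Lemma weighted_levels_limit b alpha f (w : nat -> R) (s : nat -> R) m (C : R)
    (Om : set T) : measurable_fun setT b -> measurable_fun setT f ->
  (forall y, 0 <= f y) -> (forall i, 0 <= w i) -> measurable Om ->
  (forall N, (\sum_(i < m) (w i)%:E *
     mu (Om `&` [set x | ((s i)%:E < potential b alpha (truncate f N) x)%E]) <= C%:E)%E) ->
  (\sum_(i < m) (w i)%:E *
     mu (Om `&` [set x | ((s i)%:E < potential b alpha f x)%E]) <= C%:E)%E.
Proof.
move=> mb mf f0 w0 mOm leC.
pose S i N := Om `&` [set x | ((s i)%:E < potential b alpha (truncate f N) x)%E].
have mpot N := measurable_potential alpha mb (measurable_truncate N mf)
  (fun y => truncate_ge0 N (f0 y)).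
have mS i N : measurable (S i N).
  by apply: (measurable_lte mOm); [exact: measurable_cst|exact: measurable_funTS].
have ndS i : nondecreasing_seq (S i).
  move=> N N' NN; apply/subsetPset => x [Omx /= sx]; split=> //=.
  apply: lt_le_trans sx _; apply: potential_le => //.
  - exact: measurable_truncate.
  - exact: measurable_truncate.
  - by move=> y; exact: truncate_ge0.
  - by move=> y; exact: truncate_nondecreasing.
have SE i : \bigcup_N S i N = Om `&` [set x | ((s i)%:E < potential b alpha f x)%E].
  apply/seteqP; split=> x.
    move=> [N _ [Omx /= sx]]; split=> //=; apply: lt_le_trans sx _.
    apply: potential_le => //; first exact: measurable_truncate.
      by move=> y; exact: truncate_ge0.
    by move=> y; exact: truncate_le.
  move=> [Omx /= sx].
  have := @potential_truncate_cvg b alpha f x mb mf f0 _ (open_ereal_gt' sx).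
  by move=> [N _ /(_ N (leqnn N)) /= sN]; exists N.
have cvgS : (\sum_(i < m) (w i)%:E * mu (S i N))%E @[N --> \oo] -->
    (\sum_(i < m) (w i)%:E * mu (Om `&` [set x | ((s i)%:E < potential b alpha f x)%E]))%E.
  apply: cvg_nnesum => [i _|i _].
    by near=> N; rewrite mule_ge0// lee_fin.
  apply: cvgeZl => //; rewrite -SE; apply: nondecreasing_cvg_mu => //.
  exact: bigcupT_measurable.
apply: cvge_to_le cvgS _.
by near=> N; exact: leC.
Unshelve. all: by end_near. Qed.

End modular_bound.

Section modular_inequality.
Context {R : realType} {n : nat}.
Local Notation T := (Rn[R]_n).
Local Notation mu := (lebesgue_measure_n n : set T -> \bar R).
Implicit Types (f g b : T -> R) (Phi Psi : R -> \bar R).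

Definition window (N : nat) : set T := cube (fun=> - 2 ^+ N) (2 * 2 ^+ N).

Lemma measurable_window N : measurable (window N).
Proof. exact: measurable_cube. Qed.

Lemma window_lty N : (mu (window N) < +oo)%E.
Proof. by apply: mu_cube_lty; rewrite mulr_gt0// exprn_gt0. Qed.

Lemma window_nondecreasing N N' : (N <= N')%N -> window N `<=` window N'.
Proof.
move=> NN x xN i; have /andP[lo hi] := xN i.
have : 2 ^+ N <= 2 ^+ N' :> R by rewrite ler_eXn2l// ltr1n.
by move=> ?; apply/andP; split; lra.
Qed.

Lemma window_cover x : exists N, window N x.
Proof.
pose B := \sum_(i < n) `|tnth x i|.
exists (Num.bound B) => i; have : `|tnth x i| < 2 ^+ Num.bound B.
  apply: (@le_lt_trans _ _ B).
    by rewrite /B (bigD1 i)//= lerDl sumr_ge0.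
  by apply: lt_exp2_bound; rewrite sumr_ge0.
by rewrite ltr_norml => /andP[? ?]; apply/andP; split; lra.
Qed.

(** A discrete form of the modular of c times the potential, uniformly in the
    starting level e' of the dyadic levels. *)
Definition weak_levels_bounded b alpha f Psi (c C1 : R) :=
  forall e' m (Om : set T), 0 < e' -> measurable Om -> (mu Om < +oo)%E ->
    (\sum_(i < m) (fine (Psi (c * (e' * 2 ^+ i))))%:E *
       mu (Om `&` [set x | ((e' * 2 ^+ i)%:E < potential b alpha f x)%E]) <= C1%:E)%E.

Lemma young_pow2_ge Psi (r : R) i : young_function Psi -> Delta2 Psi ->
  0 <= r -> 2 ^+ i * fine (Psi r) <= fine (Psi (r * 2 ^+ i)).
Proof.
move=> yPsi D2 r0; elim: i => [|i IH]; first by rewrite expr0 mul1r mulr1.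
have ri : 0 <= r * 2 ^+ i by rewrite mulr_ge0// exprn_ge0.
rewrite exprS mulrCA -mulrA; apply: le_trans (young_double yPsi D2 ri).
by rewrite ler_pM2l.
Qed.

(** The points where the potential is infinite belong to all its superlevel
    sets, whose measures are at most C1 / Psi (c * 2^i), while Psi
    (c * 2^i) >= 2^i * Psi (c). *)
Lemma potential_ae_finite b alpha f Psi (c C1 : R) :
  young_function Psi -> Delta2 Psi -> 0 < c -> 0 <= C1 ->
  measurable_fun setT b -> measurable_fun setT f -> (forall y, 0 <= f y) ->
  weak_levels_bounded b alpha f Psi c C1 ->
  {ae mu, forall x, (potential b alpha f x < +oo)%E}.
Proof.
move=> yPsi D2 c0 C10 mb mf f0 weak.
have mpot := measurable_potential alpha mb mf f0.
pose Z N := window N `&` [set x | potential b alpha f x = +oo%E].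
have mZ N : measurable (Z N).
  by apply: (measurable_eqe (measurable_window N));
    [exact: measurable_funTS|exact: measurable_cst].
have level_bound N i : ((2 ^+ i * fine (Psi c))%:E * mu (Z N) <= C1%:E)%E.
  have := weak 1 i.+1 (window N) ltr01 (measurable_window N) (window_lty N).
  apply: le_trans; rewrite big_ord_recr/= -[leLHS]add0e; apply: leeD.
    apply: sume_ge0 => j _; rewrite mule_ge0// lee_fin fine_ge0// (young_ge0 yPsi)//.
    by rewrite !mulr_ge0 ?exprn_ge0// ltW.
  apply: lee_pmul => //.
  - by rewrite lee_fin mulr_ge0 ?exprn_ge0 ?fine_ge0 ?(young_ge0 yPsi) ?ltW.
  - by rewrite lee_fin mul1r; apply: young_pow2_ge => //; exact: ltW.
  - apply: le_measure; rewrite ?inE//.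
      by apply: (measurable_lte (measurable_window N));
        [exact: measurable_cst|exact: measurable_funTS].
    by move=> x [xN xoo]; split=> //=; rewrite xoo ltry.
have Psic0 : 0 < fine (Psi c) by exact: young_gt0.
have Z0 N : mu (Z N) = 0%E.
  have finZ : mu (Z N) \is a fin_num.
    rewrite ge0_fin_numE//; apply: le_lt_trans (window_lty N).
    by apply: le_measure; rewrite ?inE//; [exact: measurable_window|exact: subIsetl].
  apply/eqP; rewrite -(fineK finZ) eqe; apply/eqP/le_anti.
  rewrite fine_ge0// andbT leNgt; apply/negP => z0.
  pose i := Num.bound (C1 / (fine (Psi c) * fine (mu (Z N)))).
  have := level_bound N i; rewrite -(fineK finZ) -EFinM lee_fin leNgt => /negP; apply.
  rewrite -mulrA -ltr_pdivrMr ?mulr_gt0//.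
  by apply: lt_exp2_bound; rewrite divr_ge0// ltW// mulr_gt0.
have negZ : negligible mu (\bigcup_N Z N).
  by apply: negligible_bigcup => N; exists (Z N); split => //; exact: Z0.
apply: negligibleS negZ => x /= /negP; rewrite -leNgt leye_eq => /eqP xoo.
by have [N xN] := window_cover x; exists N.
Qed.

(** On the layer where g is comparable to a dyadic level, Psi (c * g) is
    comparable to the value of Psi at the level, by the Delta_2 condition;
    restricting to windows in space and in the values of g makes the sum over
    levels finite. *)
Lemma modular_le_of_weak_levels b alpha f Psi (c C1 CD : R) g :
  young_function Psi -> Delta2 Psi -> 0 < c -> 0 <= C1 -> 0 <= CD ->
  (forall r, 0 < r -> fine (Psi (2 * r)) <= CD * fine (Psi r)) ->
  measurable_fun setT b -> measurable_fun setT f -> (forall y, 0 <= f y) ->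
  weak_levels_bounded b alpha f Psi c C1 ->
  measurable_fun setT g -> (forall x, 0 <= g x) ->
  (forall x, ((g x)%:E <= potential b alpha f x)%E) ->
  (\int[mu]_x Psi (c * g x)%R <= (CD * CD * C1)%:E)%E.
Proof.
move=> yPsi D2 c0 C10 CD0 DC mb mf f0 weak mg g0 gpot.
have mpot := measurable_potential alpha mb mf f0.
have cg0 x : 0 <= c * g x by rewrite mulr_ge0// ltW.
have mcg : measurable_fun setT (fun x => c * g x).
  by apply: measurable_funM => //; exact: measurable_cst.
have PsiE x : Psi (c * g x) = (fine (Psi (c * g x)))%:E.
  by rewrite fineK// young_fin_num.
under eq_integral do rewrite PsiE.
have mPsi : measurable_fun setT (fun x => (fine (Psi (c * g x)))%:E).
  by apply/measurable_EFinP; apply: (measurable_young (f := fun x => c * g x)).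
have Psi0 x : (0 <= (fine (Psi (c * g x)))%:E)%E.
  by rewrite lee_fin fine_ge0// (young_ge0 yPsi).
pose E N := window N `&` [set x | g x = 0 \/ 2 ^- N <= g x < 2 ^- N * 2 ^+ (N + N)].
have mE N : measurable (E N).
  apply: measurableI; first exact: measurable_window.
  rewrite (_ : [set x | _] = (g @^-1` [set 0]) `|`
    (g @^-1` `[2 ^- N, 2 ^- N * 2 ^+ (N + N)[)).
    by apply: measurableU; rewrite -[X in measurable X]setTI; apply: mg.
  by apply/seteqP; split => p /=; rewrite in_itv.
apply: (integral_le_exhaustion (E := E)) => //.
- move=> N N' NN; apply/subsetPset => x [xN [gx0|gN]]; split.
  + exact: window_nondecreasing NN _ xN.
  + by left.
  + exact: window_nondecreasing NN _ xN.
  + by right; exact: dyadic_window_nondecreasing gN.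
- apply/seteqP; split => // x _; have [N xN] := window_cover x.
  have [gx0|gxn0] := eqVneq (g x) 0; first by exists N => //; split=> //; left.
  have gx_gt0 : 0 < g x by rewrite lt0r gxn0 g0.
  have [N' gN'] := dyadic_window_exists gx_gt0.
  exists (maxn N N') => //; split.
    exact: window_nondecreasing (leq_maxl _ _) _ xN.
  by right; exact: dyadic_window_nondecreasing (leq_maxr _ _) gN'.
(* The levels start at half the lower end of the window: g x then lies between
   twice and four times a level, so that the potential exceeds the level
   strictly, at the cost of applying the doubling inequality twice. *)
move=> N; pose e' : R := 2 ^- N / 2.
have e'0 : 0 < e' by rewrite divr_gt0// invr_gt0 exprn_gt0.
pose s i : R := e' * 2 ^+ i; have s0 i : 0 < s i by rewrite mulr_gt0// exprn_gt0.
pose w i := fine (Psi (c * s i)).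
have w0 i : 0 <= w i by rewrite fine_ge0// (young_ge0 yPsi)// mulr_ge0 ?ltW.
pose A i := window N `&` [set x | ((s i)%:E < potential b alpha f x)%E].
have mA i : measurable (A i).
  by apply: (measurable_lte (measurable_window N));
    [exact: measurable_cst|exact: measurable_funTS].
have layers0 x : 0 <= \sum_(i < N + N) w i * \1_(A i) x.
  by apply: sumr_ge0 => i _; rewrite mulr_ge0.
have pointwise x : E N x ->
    fine (Psi (c * g x)) <= CD * CD * \sum_(i < N + N) w i * \1_(A i) x.
  move=> [xN [gx0|/andP[lo hi]]].
    by rewrite gx0 mulr0 (young0 yPsi)/=; exact: mulr_ge0 (mulr_ge0 CD0 CD0) (layers0 x).
  have two1 : 1 < 2 :> R by rewrite ltr1n.
  have e20 : 0 < 2 ^- N :> R by rewrite invr_gt0 exprn_gt0.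
  have t1 : 1 <= g x / 2 ^- N by rewrite ler_pdivlMr// mul1r.
  have [k /andP[klo khi]] := exprn_bracket two1 t1.
  have kN : (k < N + N)%N.
    rewrite -(@ltr_eXn2l R 2)//; apply: le_lt_trans klo _.
    by rewrite ltr_pdivrMr// mulrC.
  have sk2 : 2 * s k <= g x.
    have -> : 2 * s k = 2 ^+ k * 2 ^- N by rewrite /s /e'; field; rewrite expf_neq0.
    by rewrite -ler_pdivlMr.
  have gsk : g x <= 2 * (2 * s k).
    have -> : 2 * (2 * s k) = 2 ^+ k.+1 * 2 ^- N.
      by rewrite /s /e' exprS; field; rewrite expf_neq0.
    by rewrite -ler_pdivrMr// ltW.
  have csk : 0 < c * s k by rewrite mulr_gt0.
  have Ak : A k x.
    split=> //=; apply: lt_le_trans (gpot x); rewrite lte_fin.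
    by apply: lt_le_trans sk2; have := s0 k; lra.
  apply: (@le_trans _ _ (CD * CD * w k)).
    apply: (@le_trans _ _ (fine (Psi (2 * (2 * (c * s k)))))).
      apply: young_nondecreasing => //.
      have -> : 2 * (2 * (c * s k)) = c * (2 * (2 * s k)) by ring.
      by rewrite ler_pM2l.
    apply: le_trans (DC _ _) _; first by rewrite mulr_gt0.
    by rewrite -mulrA; apply: ler_wpM2l => //; exact: DC.
  apply: ler_wpM2l; first exact: mulr_ge0.
  rewrite (bigD1 (Ordinal kN))//= indicE mem_set// mulr1 lerDl.
  by apply: sumr_ge0 => i _; rewrite mulr_ge0.
have mind i : measurable_fun setT (fun x => (\1_(A i) x)%:E : \bar R).
  by apply/measurable_EFinP; exact: measurable_indic.
have mlayer i : measurable_fun setT (fun x => (w i)%:E * (\1_(A i) x)%:E)%E.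
  by apply: emeasurable_funM => //; exact: measurable_cst.
have layer0 i x : (0 <= (w i)%:E * (\1_(A i) x)%:E)%E by rewrite mule_ge0 ?lee_fin.
apply: (@le_trans _ _ (\int[mu]_(x in E N)
   ((CD * CD)%:E * \sum_(i < N + N) (w i)%:E * (\1_(A i) x)%:E))%E).
  apply: ge0_le_integral => //.
  - exact: measurable_funTS.
  - apply: measurable_funTS; apply: emeasurable_funM; first exact: measurable_cst.
    exact: emeasurable_sum.
  - move=> x xE; under eq_bigr do rewrite -EFinM.
    by rewrite sumEFin -EFinM lee_fin; exact: pointwise.
apply: (@le_trans _ _ (\int[mu]_x
   ((CD * CD)%:E * \sum_(i < N + N) (w i)%:E * (\1_(A i) x)%:E))%E).
  apply: ge0_subset_integral => //.
  - by apply: emeasurable_funM; [exact: measurable_cst|exact: emeasurable_sum].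
  - by move=> x _; rewrite mule_ge0 ?lee_fin ?mulr_ge0//; exact: sume_ge0.
rewrite ge0_integralZl_EFin//; last 3 first.
- by move=> x _; exact: sume_ge0.
- exact: emeasurable_sum.
- exact: mulr_ge0.
rewrite [leRHS]EFinM; apply: lee_wpmul2l; first by rewrite lee_fin mulr_ge0.
rewrite ge0_integral_sum//.
apply: le_trans (weak e' (N + N)%N (window N) e'0 (measurable_window N) (window_lty N)).
apply: lee_sum => i _; rewrite ge0_integralZl_EFin//.
by rewrite integral_indic ?setIT.
Qed.

End modular_inequality.

(** * Integrals of almost everywhere equal functions *)

Section integral_modification.
Context d (T : measurableType d) {R : realType} (mu : {measure set T -> \bar R}).
Local Open Scope ereal_scope.
Implicit Types (D N : set T) (f g : T -> \bar R).

(** The integral of a nonnegative function is a supremum over the simple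
    functions below it, so its monotonicity does not involve measurability. *)
Lemma ge0_integral_mono D f g :
  (forall x, D x -> 0 <= f x) -> (forall x, D x -> f x <= g x) ->
  \int[mu]_(x in D) f x <= \int[mu]_(x in D) g x.
Proof.
move=> f0 fg; rewrite !ge0_integralE//; last first.
  by move=> x Dx; exact: le_trans (f0 x Dx) (fg x Dx).
apply: le_ereal_sup => _ [h hf <-]; exists h => // x.
apply: le_trans (hf x) _; rewrite /patch; case: ifPn => // /set_mem.
exact: fg.
Qed.

(** The function f, possibly not measurable, lies between the measurable
    functions equal to 0 and to +oo on N and to g elsewhere, which have the
    same integral as g. *)
Lemma ge0_integral_modification D N f g :
  measurable D -> measurable_fun D g -> measurable N -> mu N = 0 ->
  (forall x, 0 <= f x) -> (forall x, 0 <= g x) ->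
  (forall x, D x -> ~ N x -> f x = g x) ->
  \int[mu]_(x in D) f x = \int[mu]_(x in D) g x.
Proof.
move=> mD mg mN N0 f0 g0 fg.
pose bracket (v : \bar R) x := if x \in N then v else g x.
have mb v : measurable_fun D (bracket v).
  apply: measurable_fun_if => //.
  - apply: (measurable_fun_bool true); apply: measurableI => //.
    by rewrite (_ : _ @^-1` _ = N)//; apply/seteqP; split => x /= => [/set_mem|/mem_set].
  - by apply: measurable_funS mg.
have bint v : 0 <= v -> \int[mu]_(x in D) bracket v x = \int[mu]_(x in D) g x.
  move=> v0; apply: ge0_ae_eq_integral => //.
  - by move=> x _; rewrite /bracket; case: ifP.
  - exists N; split => // x /= /not_implyP[Dx]; rewrite /bracket.
    by case: ifPn => // /set_mem.
apply/eqP; rewrite eq_le; apply/andP; split.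
  rewrite -(bint +oo)//; apply: ge0_integral_mono => // x Dx.
  rewrite /bracket; case: ifPn; first by rewrite leey.
  by move=> xN; rewrite fg//; move: xN; rewrite notin_setE.
rewrite -(bint 0)//; apply: ge0_integral_mono => x Dx.
  by rewrite /bracket; case: ifP.
rewrite /bracket; case: ifPn => // xN; rewrite fg//.
by move: xN; rewrite notin_setE.
Qed.

Lemma integral_modification D f g :
  measurable D -> measurable_fun D g -> ae_eq mu D f g ->
  \int[mu]_(x in D) f x = \int[mu]_(x in D) g x.
Proof.
move=> mD mg [N [mN N0 NS]]; rewrite [LHS]integralE [RHS]integralE.
have fg x : D x -> ~ N x -> f x = g x.
  by move=> Dx xN; apply: contrapT => fgx; apply: xN; apply: NS => /=; apply/not_implyP.
by congr (_ - _); apply: (ge0_integral_modification (N := N)) => //;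
  [exact: measurable_funepos| |exact: measurable_funeneg|];
  move=> x Dx xN; rewrite ?funeposE ?funenegE fg.
Qed.

End integral_modification.

(** * From mean oscillation on balls to cubes *)

Section bmo_on_cubes.
Context {R : realType} {n : nat}.
Local Notation T := (Rn[R]_n).
Local Notation mu := (lebesgue_measure_n n : set T -> \bar R).
Implicit Types (b : T -> R) (x : T).

Lemma measurable_eball x (r : R) : measurable (eball x r).
Proof.
have m := measurable_eucl_dist (measurable_cst x) (@measurable_id _ T setT).
have := m measurableT `]-oo, r[%classic (measurable_itv _); rewrite setTI.
by congr (measurable _); apply/seteqP; split => y /=; rewrite in_itv.
Qed.

Lemma cube_sub_eball (a : 'I_n -> R) h : 0 < h ->
  cube a h `<=` eball [tuple a i | i < n] (n.+1%:R * h).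
Proof.
move=> h0 y ya; rewrite /eball /= /eucl_dist.
have rh0 : 0 < n.+1%:R * h by rewrite mulr_gt0// ltr0n.
rewrite -[ltRHS]gtr0_norm// -sqrtr_sqr ltr_sqrt ?exprn_gt0//.
apply: (@le_lt_trans _ _ (\sum_(i < n) h ^+ 2)).
  apply: ler_sum => i _; rewrite tnth_mktuple -sqrrN opprB.
  have /andP[lo hi] := ya i.
  by rewrite lerXn2r ?nnegrE ?subr_ge0//; lra.
rewrite sumr_const card_ord -[ltLHS]mulr_natl exprMn ltr_pM2r ?exprn_gt0//.
by rewrite -natrX ltr_nat expnS expn1 mulSn leq_addr.
Qed.

Lemma eball_sub_cube x (r : R) :
  eball x r `<=` cube (fun i => tnth x i - r) (2 * r).
Proof.
move=> y xy i; have := le_lt_trans (coordinate_le_eucl_dist x y i) xy.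
by rewrite ltr_norml => /andP[? ?]; apply/andP; split; lra.
Qed.

Lemma mu_eball_le x (r : R) : 0 <= r -> (mu (eball x r) <= ((2 * r) ^+ n)%:E)%E.
Proof.
move=> r0; rewrite -(@mu_cube _ _ (fun i => tnth x i - r)) ?mulr_ge0//.
by apply: le_measure; rewrite ?inE;
  [exact: measurable_eball|exact: measurable_cube|exact: eball_sub_cube].
Qed.

(** Replacing the average by another constant changes the mean oscillation by
    at most a factor 2. *)
Lemma cube_oscillation_le b a h (c : R) : 0 < h ->
  mu.-integrable (cube a h) (EFin \o b) ->
  \int[mu]_(x in cube a h) `|b x - cube_avg b a h| <=
  2 * \int[mu]_(x in cube a h) `|b x - c|.
Proof.
move=> h0 ib; have mQ := measurable_cube a h.
have hn0 : 0 < h ^+ n by rewrite exprn_gt0.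
have iN v := integrable_norm (integrable_sub_cube v h0 ib).
have cE v : \int[mu]_(x in cube a h) v = v * h ^+ n.
  by rewrite Rintegral_cst//= mu_cube// ltW.
have avgE : cube_avg b a h - c = (h ^+ n)^-1 * \int[mu]_(x in cube a h) (b x - c).
  rewrite RintegralB//; last exact: integrable_cst_cube.
  by rewrite cE mulrBr -/(cube_avg b a h) [c * _]mulrC mulKf// gt_eqF.
set I := \int[mu]_(x in cube a h) `|b x - c|.
have avg_le : `|cube_avg b a h - c| * h ^+ n <= I.
  rewrite avgE normrM ger0_norm ?invr_ge0 ?(ltW hn0)//.
  rewrite mulrAC mulVf ?gt_eqF// mul1r.
  by apply: le_normr_Rintegral => //; exact: integrable_sub_cube.
apply: (@le_trans _ _ (\int[mu]_(x in cube a h) (`|b x - c| + `|cube_avg b a h - c|))).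
  apply: le_Rintegral => //; first exact: iN.
    have := integrableD mQ (iN c) (integrable_cst_cube a `|cube_avg b a h - c| h0).
    exact: eq_integrable.
  move=> x _; rewrite [X in _ <= _ + X]distrC.
  by rewrite (le_trans _ (ler_normD _ _))// addrA subrK.
rewrite RintegralD//; [|exact: iN|exact: integrable_cst_cube].
by rewrite cE -/I; lra.
Qed.

(** A cube of side h is contained in a ball of radius (n + 1) h, whose volume
    is comparable to h^n; the average over the ball may replace the average
    over the cube by cube_oscillation_le. *)
Lemma bmo_borel_version b : bmo b ->
  exists b', [/\ measurable_fun setT b', ae_eq mu setT b b' &
    exists2 M : R, 0 < M & cube_bmo b' M].
Proof.
move=> [locb normb].
have [[b' mb' bb'] _] := locb [tuple 0 | _ < n] 1 ltr01.
exists b'; split=> //.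
have [m m0 normm] : exists2 m : R, 0 < m & (bmo_norm b <= m%:E)%E.
  move: normb; case: (bmo_norm b) => [r _|//|_]; last by exists 1; [exact: ltr01|exact: leNye].
    exists (Num.max r 1); first by rewrite lt_max ltr01 orbT.
    by rewrite lee_fin le_max lexx.
set k : R := 2 * n.+1%:R; have k0 : 0 < k by rewrite mulr_gt0 ?ltr0n.
exists (2 * (m * k ^+ n)); first by rewrite !mulr_gt0 ?exprn_gt0.
move=> a h h0; set p := [tuple a i | i < n]; set r := n.+1%:R * h.
have r0 : 0 < r by rewrite mulr_gt0 ?ltr0n.
have mQ := measurable_cube a h.
have mB := measurable_eball p r.
have QB := @cube_sub_eball a h h0; rewrite -/p -/r in QB.
have hn0 : 0 < h ^+ n by rewrite exprn_gt0.
have muB := mu_eball_le p (ltW r0).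
have muBfin : mu (eball p r) \is a fin_num.
  by rewrite ge0_fin_numE//; exact: le_lt_trans muB (ltry _).
have muB0 : 0 < fine (mu (eball p r)).
  rewrite -lte_fin fineK//; apply: (@lt_le_trans _ _ (h ^+ n)%:E); first by rewrite lte_fin.
  by rewrite -(mu_cube a (ltW h0)); apply: le_measure; rewrite ?inE.
have ib : mu.-integrable (cube a h) (EFin \o b').
  apply/integrableP; split; first exact/measurable_funTS/measurable_EFinP.
  have [_] := locb p r r0; apply: le_lt_trans.
  rewrite (integral_modification (g := fun x => `|(b' x)%:E|%E) mB); last 2 first.
  - by apply/measurable_funTS; apply: measurableT_comp => //; exact/measurable_EFinP.
  - by apply: filterS bb' => x + _ => /(_ I) /= ->.
  apply: ge0_subset_integral => //.
  by apply/measurable_funTS; apply: measurableT_comp => //; exact/measurable_EFinP.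
split=> //; set c := average b (eball p r).
apply: le_trans (cube_oscillation_le c h0 ib) _.
rewrite -mulrA ler_pM2l//.
have mosc D : measurable_fun D (fun x => `|b' x - c|%:E).
  apply/measurable_funTS/measurable_EFinP.
  apply: (measurableT_comp (f := fun u : R => `|u|)) => //.
  by apply: measurable_funB.
have oscB : (\int[mu]_(x in eball p r) `|b' x - c|%:E <= (m * fine (mu (eball p r)))%:E)%E.
  rewrite -(integral_modification (f := fun x => `|b x - c|%:E) mB); last 2 first.
  - exact: mosc.
  - by apply: filterS bb' => x + _ => /(_ I) /= ->.
  have : ((fine (mu (eball p r)))^-1%:E * \int[mu]_(y in eball p r) `|b y - c|%:E <= m%:E)%E.
    by apply: le_trans normm; apply: ereal_sup_ubound; exists p, r.
  by rewrite lee_pdivrMl// -EFinM mulrC.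
rewrite -lee_fin /Rintegral fineK; last first.
  have := integrable_norm (integrable_sub_cube c h0 ib).
  by move=> /(integrable_fin_num mQ).
apply: (@le_trans _ _ (m * fine (mu (eball p r)))%:E).
  by apply: le_trans oscB; apply: ge0_subset_integral.
rewrite lee_fin -mulrA ler_pM2l// -exprMn.
by rewrite -lee_fin fineK// /k -mulrA.
Qed.

End bmo_on_cubes.

(** * The commutator of Borel functions *)

Section commutator_of_borel_functions.
Context {R : realType} {n : nat}.
Local Notation T := (Rn[R]_n).
Local Notation mu := (lebesgue_measure_n n : set T -> \bar R).
Implicit Types (b f : T -> R) (Phi Psi : R -> \bar R).

Lemma measurable_scaled_norm f (l : R) : measurable_fun setT f ->
  measurable_fun setT (fun y => `|f y| / l).
Proof.
move=> mf; apply: measurable_funM => //.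
exact: (measurableT_comp (f := fun u : R => `|u|)).
Qed.

Lemma all_levels_bounded b M alpha Phi Psi :
  measurable_fun setT b -> 0 < M -> cube_bmo b M -> 0 < alpha < n%:R ->
  young_function Phi -> young_function Psi -> Delta2 Phi -> nabla2 Phi ->
  Delta2 Psi ->
  young_inv_dominated (alpha / n%:R) Phi Psi ->
  exists2 c : R, 0 < c & exists2 C1 : R, 0 <= C1 &
    forall f, measurable_fun setT f -> (forall y, 0 <= f y) ->
    (\int[mu]_y Phi (f y) <= 1)%E -> weak_levels_bounded b alpha f Psi c C1.
Proof.
move=> mb M0 bM alP yPhi yPsi D2Phi nPhi D2Psi H.
have [c c0 [C1 C10 bound]] :=
  truncated_modular_bound mb M0 bM alP yPhi yPsi D2Phi nPhi D2Psi H.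
exists c => //; exists C1 => // f mf f0 modf e' m Om e'0 mOm Omy.
apply: (weighted_levels_limit (w := fun i => fine (Psi (c * (e' * 2 ^+ i))))
  (s := fun i => e' * 2 ^+ i)) => // [i|N].
  by rewrite fine_ge0// (young_ge0 yPsi)// !mulr_ge0 ?exprn_ge0 ?ltW.
apply: (bound (2 ^- N) (N + N)%N (truncate f N)) => //.
- exact: measurable_truncate.
- by move=> y; exact: truncate_ge0.
- by move=> y; rewrite /truncate; case: ifPn => [|_]; [right|left].
- apply: le_trans modf; apply: ge0_integral_mono => y _.
    by apply: (young_ge0 yPhi); exact: truncate_ge0.
  rewrite -(fineK (young_fin_num yPhi D2Phi (truncate_ge0 N (f0 y)))).
  rewrite -(fineK (young_fin_num yPhi D2Phi (f0 y))) lee_fin.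
  by apply: young_nondecreasing => //; [exact: truncate_ge0|exact: truncate_le].
Qed.

Lemma measurable_commutator_integrand alpha b f d (X : measurableType d)
    (g1 g2 : X -> T) : measurable_fun setT b -> measurable_fun setT f ->
  measurable_fun setT g1 -> measurable_fun setT g2 ->
  measurable_fun setT (fun z => commutator_integrand alpha b f (g1 z) (g2 z)).
Proof.
move=> mb mf m1 m2; apply: measurable_funM; last exact: measurableT_comp.
apply: measurable_funM.
  by apply: measurable_funB; exact: measurableT_comp.
exact: measurable_eucl_dist_powRV.
Qed.

Lemma norm_commutator_integrand alpha b f x y :
  `|commutator_integrand alpha b f x y| = kern b alpha x y * `|f y|.
Proof.
by rewrite /commutator_integrand !normrM normfV (ger0_norm (powR_ge0 _ _)).
Qed.

Lemma measurable_commutator alpha b f : measurable_fun setT b ->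
  measurable_fun setT f -> measurable_fun setT (commutator alpha b f).
Proof.
move=> mb mf; pose F (p : T * T) := (commutator_integrand alpha b f p.1 p.2)%:E.
have mF : measurable_fun setT F.
  apply/measurable_EFinP; apply: measurable_commutator_integrand => //.
have mpos : measurable_fun setT (fun x => \int[mu]_y F^\+ (x, y))%E.
  apply: (measurable_fun_fubini_tonelli_F F^\+%E); first exact: measurable_funepos.
  exact: funepos_ge0.
have mneg : measurable_fun setT (fun x => \int[mu]_y F^\- (x, y))%E.
  apply: (measurable_fun_fubini_tonelli_F F^\-%E); first exact: measurable_funeneg.
  exact: funeneg_ge0.
rewrite (_ : commutator alpha b f = fine \o (fun x =>
   \int[mu]_y F^\+ (x, y) - \int[mu]_y F^\- (x, y))%E); last first.
  apply/funext => x; rewrite /commutator /Rintegral /= integralE; congr fine.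
  congr (_ - _)%E; apply: eq_integral => y _.
    by rewrite !funeposE.
  by rewrite !funenegE.
by apply: measurableT_comp => //; exact: emeasurable_funB.
Qed.

Lemma integral_norm_commutator_integrand alpha b f x :
  (\int[mu]_y `|commutator_integrand alpha b f x y|%:E)%E =
  potential b alpha (fun y => `|f y|) x.
Proof. by apply: eq_integral => y _; rewrite norm_commutator_integrand. Qed.

(** If the potential is finite, the integral that defines the commutator
    converges absolutely; otherwise the bound is void. *)
Lemma norm_commutator_le_potential alpha b f x : measurable_fun setT b ->
  measurable_fun setT f ->
  (`|commutator alpha b f x|%:E <= potential b alpha (fun y => `|f y|%R) x)%E.
Proof.
move=> mb mf.
have p0 : (0 <= potential b alpha (fun y => `|f y|%R) x)%E by exact: potential_ge0.
have [potfin|] := boolP (potential b alpha (fun y => `|f y|%R) x < +oo)%E; last first.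
  by rewrite -leNgt => /(le_trans _); apply; exact: leey.
have pf : potential b alpha (fun y => `|f y|) x \is a fin_num by rewrite ge0_fin_numE.
rewrite -(fineK pf) -integral_norm_commutator_integrand lee_fin.
apply: le_normr_Rintegral => //; apply/integrableP; split.
  by apply/measurable_EFinP; exact: measurable_commutator_integrand.
by rewrite integral_norm_commutator_integrand.
Qed.

Lemma potential_scale b alpha f (l : R) x : 0 <= l -> measurable_fun setT b ->
  measurable_fun setT f -> (forall y, 0 <= f y) ->
  potential b alpha (fun y => l * f y) x = (l%:E * potential b alpha f x)%E.
Proof.
move=> l0 mb mf f0; rewrite /potential -ge0_integralZl_EFin//.
- by apply: eq_integral => y _; rewrite -EFinM mulrCA.
- by move=> y _; rewrite lee_fin mulr_ge0 ?kern_ge0.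
- apply/measurable_EFinP; apply: measurable_funM => //.
  by apply: measurable_kern.
Qed.

(** By convexity, dividing the function by a number K >= 1 divides the modular
    by at least K; this turns the bound of modular_le_of_weak_levels into
    1. *)
Lemma borel_commutator_bounded b M alpha Phi Psi :
  measurable_fun setT b -> 0 < M -> cube_bmo b M -> 0 < alpha < n%:R ->
  young_function Phi -> young_function Psi -> Delta2 Phi -> nabla2 Phi ->
  Delta2 Psi ->
  young_inv_dominated (alpha / n%:R) Phi Psi ->
  exists2 C : R, 0 < C & forall f (l : R), measurable_fun setT f -> 0 < l ->
    (\int[mu]_y Phi (`|f y| / l)%R <= 1)%E ->
    {ae mu, forall x, (potential b alpha (fun y => `|f y|%R) x < +oo)%E} /\
    (\int[mu]_x Psi (`|commutator alpha b f x| / (C * l))%R <= 1)%E.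
Proof.
move=> mb M0 bM alP yPhi yPsi D2Phi nPhi D2Psi H.
have [c c0 [C1 C10 bound]] :=
  all_levels_bounded mb M0 bM alP yPhi yPsi D2Phi nPhi D2Psi H.
have [CD [CD0 DC]] : exists CD : R, 0 <= CD /\
    forall r, 0 < r -> fine (Psi (2 * r)) <= CD * fine (Psi r).
  have [CD CD1 DC] := D2Psi; exists CD; split; first by lra.
  move=> r r0; have := DC r r0.
  have f1 := young_fin_num yPsi D2Psi (ltW r0).
  have f2 : Psi (2 * r) \is a fin_num.
    by apply: young_fin_num => //; rewrite mulr_ge0// ltW.
  by rewrite -(fineK f1) -(fineK f2) -EFinM lee_fin.
pose K := Num.max (CD * CD * C1) 1.
have K1 : 1 <= K by rewrite le_max lexx orbT.
have K0 : 0 < K by lra.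
exists (K / c); first by rewrite divr_gt0.
move=> f l mf l0 modf; pose u y := `|f y| / l.
have u0 y : 0 <= u y by rewrite divr_ge0// ltW.
have mu_ : measurable_fun setT u by exact: measurable_scaled_norm.
have weak := bound u mu_ u0 modf.
have potE x : potential b alpha (fun y => `|f y|) x = (l%:E * potential b alpha u x)%E.
  rewrite -potential_scale//; last exact: ltW.
  by apply: eq_integral => y _; rewrite /u [l * _]mulrC divfK// gt_eqF.
split.
  have := potential_ae_finite yPsi D2Psi c0 C10 mb mu_ u0 weak.
  apply: filterS => x px; rewrite potE.
  have pf : potential b alpha u x \is a fin_num.
    by rewrite ge0_fin_numE//; exact: potential_ge0.
  by rewrite -(fineK pf) -EFinM ltry.
pose g x := `|commutator alpha b f x| / l.
have mT := measurable_commutator alpha mb mf.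
have mg : measurable_fun setT g by exact: measurable_scaled_norm.
have g0 x : 0 <= g x by rewrite divr_ge0// ltW.
have gpot x : ((g x)%:E <= potential b alpha u x)%E.
  have := norm_commutator_le_potential alpha x mb mf; rewrite potE.
  by rewrite /g mulrC EFinM lee_pdivrMl.
have modg := modular_le_of_weak_levels yPsi D2Psi c0 C10 CD0 DC mb mu_ u0 weak mg g0 gpot.
have cg0 x : 0 <= c * g x by rewrite mulr_ge0// ltW.
have mcg : measurable_fun setT (fun x => c * g x) by exact: measurable_funM.
apply: (@le_trans _ _ (\int[mu]_x ((K^-1)%:E * Psi (c * g x)%R))%E).
  apply: ge0_integral_mono => x _.
    by apply: (young_ge0 yPsi); rewrite divr_ge0// mulr_ge0 ?divr_ge0 ?ltW.
  have -> : `|commutator alpha b f x| / (K / c * l) = K^-1 * (c * g x).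
    by rewrite /g; field; rewrite !gt_eqF.
  have K'0 : 0 <= K^-1 by rewrite invr_ge0 ltW.
  have f1 := young_fin_num yPsi D2Psi (cg0 x).
  have f2 := young_fin_num yPsi D2Psi (mulr_ge0 K'0 (cg0 x)).
  rewrite -(fineK f1) -(fineK f2) -EFinM lee_fin.
  by apply: young_convex0 => //; rewrite K'0 invf_le1.
rewrite ge0_integralZl_EFin//.
- rewrite lee_pdivrMl// mule1; apply: le_trans modg _.
  by rewrite lee_fin le_max lexx.
- by move=> x _; exact: (young_ge0 yPsi).
- exact: measurable_young_ereal.
- by rewrite invr_ge0 ltW.
Qed.

End commutator_of_borel_functions.

(** * Orlicz norms and conclusion *)

Section orlicz_functions.
Context {R : realType} {n : nat}.
Local Notation T := (Rn[R]_n).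
Local Notation mu := (lebesgue_measure_n n : set T -> \bar R).
Implicit Types (b f : T -> R) (Phi Psi : R -> \bar R).

Lemma integral_young_version Phi f f' (l : R) :
  young_function Phi -> Delta2 Phi -> measurable_fun setT f' ->
  ae_eq mu setT f f' -> 0 < l ->
  (\int[mu]_x Phi (`|f x| / l)%R = \int[mu]_x Phi (`|f' x| / l)%R)%E.
Proof.
move=> yPhi D2 mf' ff' l0; apply: integral_modification => //.
  apply: measurable_young_ereal => //; first exact: measurable_scaled_norm.
  by move=> y; rewrite divr_ge0// ltW.
by apply: filterS ff' => x + _ => /(_ I) /= ->.
Qed.

(** Dividing k * f by the maximum of 1 and its modular makes the modular at
    most 1, by convexity. *)
Lemma orlicz_normalizable Phi f : young_function Phi -> Delta2 Phi ->
  orlicz_space Phi f ->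
  exists2 l : R, 0 < l & (\int[mu]_x Phi (`|f x| / l)%R <= 1)%E.
Proof.
move=> yPhi D2 [[f' mf' ff'] [k k0 kf]].
pose u y := k * `|f' y|.
have u0 y : 0 <= u y by rewrite mulr_ge0// ltW.
have mu_ : measurable_fun setT u.
  by apply: measurable_funM => //; exact: (measurableT_comp (f := fun u : R => `|u|)).
have mPhiu := measurable_young_ereal yPhi D2 mu_ u0.
have uI : (\int[mu]_x Phi (k * `|f x|)%R = \int[mu]_x Phi (u x))%E.
  apply: integral_modification => //.
  by apply: filterS ff' => x + _ => /(_ I) /= ->.
have J0 : (0 <= \int[mu]_x Phi (u x))%E.
  by apply: integral_ge0 => x _; exact: (young_ge0 yPhi).
have Jfin : (\int[mu]_x Phi (u x))%E \is a fin_num by rewrite ge0_fin_numE// -uI.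
pose J := Num.max (fine (\int[mu]_x Phi (u x))%E) 1.
have J1 : 1 <= J by rewrite le_max lexx orbT.
have Jp : 0 < J by lra.
exists (J / k); first by rewrite divr_gt0.
have J'0 : 0 <= J^-1 by rewrite invr_ge0 ltW.
rewrite (integral_modification (g := fun x => Phi (J^-1 * u x))) //; last 2 first.
- apply: measurable_young_ereal => //; last by move=> y; rewrite mulr_ge0.
  exact: measurable_funM.
- apply: filterS ff' => x + _ => /(_ I) /= ->; congr Phi.
  by rewrite /u; field; rewrite !gt_eqF.
apply: (@le_trans _ _ (\int[mu]_x ((J^-1)%:E * Phi (u x)))%E).
  apply: ge0_integral_mono => x _.
    by apply: (young_ge0 yPhi); rewrite mulr_ge0.
  have f1 := young_fin_num yPhi D2 (u0 x).
  have f2 := young_fin_num yPhi D2 (mulr_ge0 J'0 (u0 x)).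
  rewrite -(fineK f1) -(fineK f2) -EFinM lee_fin.
  by apply: young_convex0 => //; rewrite J'0 invf_le1.
rewrite ge0_integralZl_EFin//; last by move=> x _; exact: (young_ge0 yPhi).
by rewrite lee_pdivrMl// mule1 -(fineK Jfin) lee_fin le_max lexx.
Qed.

(** The norms are infima of the numbers l for which the modular of f / l is at
    most 1, so a bound between modulars with one constant C for all l is a
    bound between norms. *)
Lemma bounded_operator_of_modular Phi Psi (S : (T -> R) -> T -> R) (C : R) :
  young_function Phi -> Delta2 Phi -> 0 < C ->
  (forall f, orlicz_space Phi f -> lebesgue_measurable (S f)) ->
  (forall f (l : R), orlicz_space Phi f -> 0 < l ->
    (\int[mu]_x Phi (`|f x| / l)%R <= 1)%E ->
    (\int[mu]_x Psi (`|S f x| / (C * l))%R <= 1)%E) ->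
  bounded_operator (orlicz_space Phi) (orlicz_space Psi)
    (orlicz_norm Phi) (orlicz_norm Psi) S.
Proof.
move=> yPhi D2 C0 mS modS; exists C => // f fPhi; split.
  split; first exact: mS.
  have [l l0 lf] := orlicz_normalizable yPhi D2 fPhi.
  exists (C * l)^-1; first by rewrite invr_gt0 mulr_gt0.
  under eq_integral do rewrite mulrC.
  by apply: le_lt_trans (modS f l fPhi l0 lf) _; rewrite ltry.
rewrite -lee_pdivrMl//; apply: le_ereal_inf_tmp => _ [l [l0 lf] <-].
rewrite lee_pdivrMl// -EFinM; apply: ereal_inf_lbound; exists (C * l) => //.
by split; [rewrite mulr_gt0|exact: modS].
Qed.

End orlicz_functions.

Section borel_versions.
Context {R : realType} {n : nat}.
Local Notation T := (Rn[R]_n).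
Local Notation mu := (lebesgue_measure_n n : set T -> \bar R).
Variables (alpha : R) (b f b' f' : T -> R).
Hypotheses (mb' : measurable_fun setT b') (mf' : measurable_fun setT f')
  (bb' : ae_eq mu setT b b') (ff' : ae_eq mu setT f f').

Lemma ae_commutator_integrand x : b x = b' x ->
  ae_eq mu setT (commutator_integrand alpha b f x)
                (commutator_integrand alpha b' f' x).
Proof.
move=> bx; apply: filterS2 bb' ff' => y /(_ I) by_ /(_ I) fy _.
by rewrite /commutator_integrand bx by_ fy.
Qed.

Lemma measurable_commutator_integrand_at x :
  measurable_fun setT (commutator_integrand alpha b' f' x).
Proof. exact: measurable_commutator_integrand. Qed.

(** Altering f, or b under the integral sign, on a null set does not change
    the integrals; altering the value b x matters only for x in a null set. *)
Lemma ae_commutator :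
  ae_eq mu setT (commutator alpha b f) (commutator alpha b' f').
Proof.
apply: filterS bb' => x /(_ I) bx _; congr fine.
apply: integral_modification => //.
  by apply/measurable_EFinP; exact: measurable_commutator_integrand_at.
by apply: filterS (ae_commutator_integrand bx) => y /= + _ => /(_ I) ->.
Qed.

Lemma commutator_defined_of_version :
  {ae mu, forall x, (potential b' alpha (fun y => `|f' y|%R) x < +oo)%E} ->
  commutator_defined alpha b f.
Proof.
move=> potfin; apply: filterS2 bb' potfin => x /(_ I) bx px.
have ae := ae_commutator_integrand bx; split.
  by exists (commutator_integrand alpha b' f' x) => //; exact: measurable_commutator_integrand_at.
rewrite (integral_modification (g := fun y => `|commutator_integrand alpha b' f' x y|%:E)) //.
- by rewrite integral_norm_commutator_integrand.
- apply/measurable_EFinP; apply: (measurableT_comp (f := fun u : R => `|u|)) => //.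
  exact: measurable_commutator_integrand_at.
- by apply: filterS ae => y /= + _ => /(_ I) ->.
Qed.

End borel_versions.

Theorem corollary3p8 (R : realType) (n : nat) (alpha : R)
    (b : Rn[R]_n -> R) (Phi Psi : R -> \bar R) :
  0 < alpha -> alpha < n%:R ->
  bmo b ->
  young_function Phi -> young_function Psi ->
  Delta2 Phi -> nabla2 Phi ->
  Delta2 Psi -> nabla2 Psi ->
  (exists2 C : R, 0 < C & forall r : R, 0 < r ->
    ((r `^ (- (alpha / n%:R)))%:E * young_inv Phi r%:E
       <= C%:E * young_inv Psi r%:E)%E) ->
  (forall f, @orlicz_space R n Phi f -> commutator_defined alpha b f) /\
  bounded_operator (orlicz_space Phi) (orlicz_space Psi)
    (orlicz_norm Phi) (orlicz_norm Psi) (commutator alpha b).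
Proof.
move=> al0 aln /bmo_borel_version[b' [mb' bb' [M M0 bM]]] yPhi yPsi D2Phi nPhi D2Psi _ H.
have alP : 0 < alpha < n%:R by rewrite al0.
have [C C0 bound] := borel_commutator_bounded mb' M0 bM alP yPhi yPsi D2Phi nPhi D2Psi H.
split=> [f fPhi|].
  have [[f' mf' ff'] _] := fPhi.
  have [l l0 lf] := orlicz_normalizable yPhi D2Phi fPhi.
  have lf' := lf; rewrite (integral_young_version yPhi D2Phi mf' ff' l0) in lf'.
  have [potfin _] := bound f' l mf' l0 lf'.
  exact: commutator_defined_of_version mb' mf' bb' ff' potfin.
apply: (bounded_operator_of_modular (C := C)) => // [f [[f' mf' ff'] _]|f l].
  exists (commutator alpha b' f'); first exact: measurable_commutator.
  exact: ae_commutator.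
move=> [[f' mf' ff'] _] l0; rewrite (integral_young_version yPhi D2Phi mf' ff' l0).
move=> /(bound f' l mf' l0)[_].
rewrite (integral_young_version yPsi D2Psi (measurable_commutator alpha mb' mf')
  (ae_commutator alpha mb' mf' bb' ff'))//.
exact: mulr_gt0.
Qed.
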